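(* Let $w\in AF[0,1]$ (so $w_x\in\mathrm{J\text{-}R}$) and $\lambda>0$. Then there exists a unique mild solution $u^\lambda$ to $$\lambda u+A(u)=\lambda w\ \text{ in }(0,1),\qquad u(0)=w(0),\ u(1)=w(1),\qquad A=-\partial_x\,\mathrm{sgn}\,\partial_x,$$ and it fulfills $\|u^\lambda_x\|_{BV[0,1]}\le\|w_x\|_{BV[0,1]}$. Moreover, there is $\lambda_0>0$ such that for all $\lambda>\lambda_0$ $$K_{ess}(u^\lambda_x)=K_{ess}(w_x)\quad\text{and}\quad \|u^\lambda_x\|_{\mathrm{J\text{-}R}}\le\|w_x\|_{\mathrm{J\text{-}R}}.$$ Furthermore, if $L(w_x)=d>0$, then the equation can be restated as $$\lambda u^\lambda-\partial_x\big(\mathrm{sgn}\,\bar\circ\,u^\lambda_x\big)=\lambda w+V(\lambda,x),$$ where $V(\lambda,\cdot)\to0$ in $L_q(0,1)$ for all $q<\infty$ as $\lambda\to\infty$. In addition, $$A_\lambda(u^\lambda)\to-\partial_x\big(\mathrm{sgn}\,\bar\circ\,w_x\big)\quad\text{in }L_q(0,1)\text{ as }\lambda\to\infty,\text{ for every } q<\infty.$$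
   Context: Conventions: ''increasing''/''decreasing''/''monotone'' are in the weak sense; $q\in[1,\infty)$. $\mathrm{sgn}$ is the multivalued maximal monotone graph: $\mathrm{sgn}(p)=\{1\}$ for $p>0$, $\{-1\}$ for $p<0$, $\mathrm{sgn}(0)=[-1,1]$; for a set $S$, $\mathrm{sgn}(S)=\bigcup_{p\in S}\mathrm{sgn}(p)$. $BV[0,1]$ is the space of functions $f$ with $\|Df\|=\int_0^1|Df|<\infty$ (total variation of the measure $Df$), with $\|f\|_{BV}=\|Df\|+\|f\|_{L_1}$. If $u$ is absolutely continuous and $u_x\in BV[0,1]$, then $u$ is Lipschitz with one-sided derivatives $u_x^\pm$ everywhere, and its Clarke differential is $\partial_xu(x)=\{\tau u_x^-(x)+(1-\tau)u_x^+(x):\tau\in[0,1]\}$ (at an endpoint of $[0,1]$, the one-sided derivative). We identify $u_x$ with the multifunction $\partial_x u$. Facets. A facet $F(\xi^-,\xi^+)$ of $u$ is a closed connected piece of the graph of $u$ over $[\xi^-,\xi^+]$ on which $u$ is constant, maximal with respect to inclusion; $[\xi^-,\xi^+]$ is its parameter set. A facet $F(\zeta^-,\zeta^+)$ (possibly degenerate, $\zeta^-=\zeta^+$, in which case $u$ has a strict local extremum there) is essential if for some $\epsilon>0$ either (convex) $u$ is decreasing on $(\zeta^--\epsilon,\zeta^-)$ with $u>u(\zeta^-)$ there and $u$ is increasing on $(\zeta^+,\zeta^++\epsilon)$ with $u>u(\zeta^+)$ there, or (concave) $u$ is increasing on $(\zeta^--\epsilon,\zeta^-)$ with $u<u(\zeta^-)$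 there and $u$ is decreasing on $(\zeta^+,\zeta^++\epsilon)$ with $u<u(\zeta^+)$ there. The parameter set of an essential facet lies in the open interval $(0,1)$; facets touching the boundary are not essential. For $w=\partial_xu$: $\Xi(w)=\{x\in[0,1]:0\in w(x)\}$; $\Xi_{ess}(w)$ is the union of the parameter sets of all essential facets of $u$; $K_{ess}(w)$ is the number of essential facets (including degenerate ones). $w$ is J-regular, $w\in\mathrm{J\text{-}R}[0,1]$, if $w\in BV[0,1]$ and $\Xi_{ess}(w)$ consists of finitely many components $[a_i,b_i]$, $a_i\le b_i$, each the parameter set of an essential facet (so $[0,1]$ splits into finitely many intervals on which $u$ is monotone). Put $\|w\|_{\mathrm{J\text{-}R}}=\|w\|_{BV[0,1]}+K_{ess}(w)$ and $L(w)=\min\{b-a:[a,b]\text{ a connected component of }\Xi_{ess}(w)\}$ (with $\min\emptyset=+\infty$); $L(w)=0$ iff $u$ has a degenerate essential facet. $AF[0,1]$ (admissible functions, for boundary data $a_b,a_e\in\mathbb R$): functions $a:[0,1]\to\mathbb R$, absolutely continuous, with $\partial_xa\in\mathrm{J\text{-}R}[0,1]$, $a(0)=a_b$, $a(1)=a_e$. Composition $\mathrm{sgn}\,\bar\circ\,\alpha$ for $\alpha=\partial_x\beta$, $\beta\in AF[0,1]$: on each component of $[0,1]\setminus\Xi_{ess}(\alpha)$ the function $\beta$ is monotone and $\mathrm{sgn}\,\bar\circ\,\alpha=1$ there if $\beta$ is increasing, $=-1$ if $\beta$ is decreasing; on a component $[p,q]$, $p<q$, of $\Xi_{ess}(\alpha)$,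 $\mathrm{sgn}\,\bar\circ\,\alpha(x)=\frac{2}{q-p}x-\frac{2p}{q-p}-1$ if $F(p,q)$ is a convex facet of $\beta$, and $\mathrm{sgn}\,\bar\circ\,\alpha(x)=-\frac{2}{q-p}x+\frac{2p}{q-p}+1$ if it is concave. Mild solution of $\lambda u+A(u)=\lambda w$ with $u=w$ at $x=0,1$: a function $u\in AF[0,1]$ for which there is a selection $\sigma(x)\in\mathrm{sgn}(\partial_xu(x))$, $x\in[0,1]$, with $\int_0^x(u-w)\,dx'-\frac1\lambda\big(\sigma(x)-\sigma(0)\big)=0$ for every $x\in[0,1]$. Yosida approximation: for $v\in AF[0,1]$ let $R_\lambda v$ denote the unique mild solution $z$ of $\lambda z+A(z)=\lambda v$, $z=v$ at $x=0,1$; then $A_\lambda(v)=\lambda(v-R_\lambda v)$. *)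

(* Defs.v *)
From HB Require Import structures.
From mathcomp Require Import all_boot all_order all_algebra.
From mathcomp Require Import all_classical all_reals all_analysis.

Set Implicit Arguments.
Unset Strict Implicit.
Unset Printing Implicit Defensive.

Import Order.TTheory GRing.Theory Num.Theory.
Import numFieldNormedType.Exports.

Local Open Scope classical_set_scope.
Local Open Scope ring_scope.

(* A function on [0,1] is represented by a total function R -> R; every notion
   below depends only on its values on [0,1]. The notions attached to a
   derivative w = u_x (facets, J-regularity, ...) take the primitive u as
   argument. *)

Section Defs.
Context {R : realType}.
Implicit Types (u v w f beta : R -> R) (A : set R).

Notation mu := (@lebesgue_measure R).
Notation I01 := (`[0, 1]%classic : set R).
Notation O01 := (`]0, 1[%classic : set R).

Definition increasing_on A f := {in A &, {homo f : x y / x <= y}}.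
Definition decreasing_on A f := {in A &, {homo f : x y / x <= y >-> y <= x}}.

Definition abs_continuous f :=
  forall e : R, 0 < e -> exists2 d : R, 0 < d &
    forall (n : nat) (s t : 'I_n -> R),
      (forall i, 0 <= s i /\ s i <= t i /\ t i <= 1) ->
      trivIset setT (fun i => `]s i, t i[%classic) ->
      \sum_(i < n) (t i - s i) < d ->
      \sum_(i < n) `|f (t i) - f (s i)| < e.

(* ||Df|| = int_0^1 |Df|, the total variation on (0,1) of the distributional
   derivative of f, computed against compactly supported C^1 functions. *)
Definition test_function (phi : R -> R) :=
  [/\ (forall x, derivable phi x 1), continuous (derive1 phi),
      (exists c d : R, [/\ 0 < c, d < 1 &
         forall x, x \notin `[c, d] -> phi x = 0])
    & forall x, `|phi x| <= 1].

Definition Dvariation f : \bar R :=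
  ereal_sup [set (\int[mu]_(x in O01) (f x * derive1 phi x))%:E
            | phi in [set phi | test_function phi]].

Definition BV f := mu.-integrable O01 (EFin \o f) /\ (Dvariation f < +oo)%E.

Definition BV_norm f : \bar R :=
  (Dvariation f + \int[mu]_(x in O01) `|f x|%:E)%E.

Definition right_derivative f (x d : R) :=
  h^-1 * (f (x + h) - f x) @[h --> 0^'+] --> d.
Definition left_derivative f (x d : R) :=
  h^-1 * (f (x + h) - f x) @[h --> 0^'-] --> d.

(* the Clarke differential of u : [0,1] -> R, as a multifunction *)
Definition clarke u (x : R) : set R :=
  [set p | [\/ x = 0 /\ right_derivative u x p,
               x = 1 /\ left_derivative u x p
             | 0 < x < 1 /\ exists dl dr tau : R,
                 [/\ left_derivative u x dl, right_derivative u x dr,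
                     0 <= tau <= 1 & p = tau * dl + (1 - tau) * dr]]].

Definition sgn_graph (p : R) : set R :=
  [set s | [\/ 0 < p /\ s = 1, p < 0 /\ s = -1 | p = 0 /\ -1 <= s <= 1]].
Definition sgn_set (S : set R) : set R := \bigcup_(p in S) sgn_graph p.

Definition constant_on A f := {in A &, forall x y, f x = f y}.

(* `[a, b] is the parameter set of a facet of u *)
Definition facet u (a b : R) :=
  [/\ 0 <= a, a <= b, b <= 1, constant_on `[a, b] u
    & forall a' b', 0 <= a' -> a' <= a -> b <= b' -> b' <= 1 ->
        constant_on `[a', b'] u -> a' = a /\ b' = b].

(* The bounds on a - e and b + e keep the facet away from the boundary. *)
Definition convex_facet u (a b : R) := facet u a b /\
  exists e : R, [/\ 0 < e, 0 <= a - e & b + e <= 1] /\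
    [/\ decreasing_on `]a - e, a[ u,
        (forall x, x \in `]a - e, a[ -> u a < u x),
        increasing_on `]b, b + e[ u
      & forall x, x \in `]b, b + e[ -> u b < u x].

Definition concave_facet u (a b : R) := facet u a b /\
  exists e : R, [/\ 0 < e, 0 <= a - e & b + e <= 1] /\
    [/\ increasing_on `]a - e, a[ u,
        (forall x, x \in `]a - e, a[ -> u x < u a),
        decreasing_on `]b, b + e[ u
      & forall x, x \in `]b, b + e[ -> u x < u b].

Definition essential_facet u (a b : R) :=
  convex_facet u a b \/ concave_facet u a b.

Definition Xi_ess u : set R :=
  [set x | exists a b : R, essential_facet u a b /\ a <= x <= b].

Definition K_ess u : \bar R :=
  counting [set ab : R * R | essential_facet u ab.1 ab.2].

Definition components A : set (set R) :=
  [set connected_component A x | x in A].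

(* u_x belongs to J-R[0,1]. The splitting into finitely many intervals of
   monotonicity is required explicitly: finiteness of Xi_ess does not imply
   it, e.g. if u_x = \sum_n s_n c_n 1_(I_n) with (I_n) the gaps of a Cantor set,
   0 < c_n summable and signs s_n oscillating near each point of that set, u
   has no essential facet and is not monotone. *)
Definition J_regular u :=
  [/\ BV (derive1 u),
      finite_set (components (Xi_ess u)),
      (forall C, components (Xi_ess u) C ->
         exists a b : R, essential_facet u a b /\ C = `[a, b]%classic)
    & exists (n : nat) (t : nat -> R), [/\ t 0%N = 0, t n = 1 &
        forall i, (i < n)%N -> t i <= t i.+1 /\
          (increasing_on `[t i, t i.+1] u \/ decreasing_on `[t i, t i.+1] u)]].

Definition JR_norm u : \bar R := (BV_norm (derive1 u) + K_ess u)%E.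

Definition L_ess u : \bar R :=
  ereal_inf [set l | exists a b : R,
    [/\ a <= b, components (Xi_ess u) `[a, b]%classic & l = (b - a)%:E]].

Definition AF (ab ae : R) : set (R -> R) :=
  [set a | [/\ abs_continuous a, J_regular a, a 0 = ab & a 1 = ae]].

(* For a constant beta, both increasing and decreasing, the value is 1. On a
   degenerate essential facet and outside [0,1] the value is 0. *)
Definition sgn_bar_graph beta (x y : R) :=
  [\/ exists p q : R, [/\ convex_facet beta p q, p < q, p <= x <= q
        & y = 2 / (q - p) * x - 2 * p / (q - p) - 1],
      exists p q : R, [/\ concave_facet beta p q, p < q, p <= x <= q
        & y = - (2 / (q - p)) * x + 2 * p / (q - p) + 1]
    | exists C, [/\ components (I01 `\` Xi_ess beta) C, C x
        & (increasing_on C beta /\ y = 1) \/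
          [/\ decreasing_on C beta, ~ increasing_on C beta & y = -1]]].

Definition sgn_bar beta (x : R) : R := xget 0 [set y | sgn_bar_graph beta x y].

(* mild solution of lambda u + A(u) = lambda w with u = w at 0 and 1 *)
Definition mild_solution (lambda : R) w u :=
  AF (w 0) (w 1) u /\
  exists sigma : R -> R,
    (forall x, x \in `[0, 1] -> sgn_set (clarke u x) (sigma x)) /\
    (forall x, x \in `[0, 1] ->
      \int[mu]_(y in `[0, x]) (u y - w y)
        - lambda^-1 * (sigma x - sigma 0) = 0).

Definition resolvent (lambda : R) v : R -> R :=
  xget v [set z | mild_solution lambda v z].

Definition yosida (lambda : R) v : R -> R :=
  fun x => lambda * (v x - resolvent lambda v x).

(* F lambda --> f in L_q(0,1) as lambda --> +oo *)
Definition cvg_Lq (q : R) (F : R -> R -> R) f :=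
  [/\ f \_ O01 \in Lfun mu q%:E,
      \forall lambda \near +oo, F lambda \_ O01 \in Lfun mu q%:E
    & Lnorm mu q%:E (EFin \o ((F lambda \- f) \_ O01)) @[lambda --> +oo]
        --> 0%E].

End Defs.

(* Main.v *)
Require Import Defs.
From HB Require Import structures.
From mathcomp Require Import all_boot all_order all_algebra.
From mathcomp Require Import all_classical all_reals all_analysis.
From mathcomp Require Import ring lra unstable measurable_realfun.

Set Implicit Arguments.
Unset Strict Implicit.
Unset Printing Implicit Defensive.

Import Order.TTheory GRing.Theory Num.Theory.
Import numFieldNormedType.Exports.

Local Open Scope classical_set_scope.
Local Open Scope ring_scope.

(* Put T = 1 / lambda and p = T * sigma. A mild solution is then a function u
   with the boundary values of w for which some p with |p| <= T and p' = u - w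
   satisfies: u is nondecreasing where p > - T and nonincreasing where p < T
   ([sol], a taut string problem).

   A maximum principle for p' - p yields uniqueness and |p' - p| <= T' - T for
   the solutions at two parameters T <= T'. Solving first with T1 and then, from
   the result, with T2 amounts to solving with T1 + T2. For small T the solution
   is explicit: every local extremum of w is cut off at the level for which the
   removed area is 2 T. Hence the set of T for which a solution exists is open to
   the right by composition, and closed by the comparison of the p's, so it is
   the whole half-line.

   Outside of the contact set u is locally constant, and u is obtained from w by
   flattening finitely many intervals whose end points lie on the same level of
   w; this increases neither the variation nor the L^1 norm of the derivative.

   As T -> 0 the cuts at an extremal facet [p, q] of w take place on intervals
   shrinking to [p, q], so (u_T - w) / T tends to -+ 2 / (q - p) on [p, q] and to
   0 elsewhere, boundedly, which is the derivative of the sign composed with w_x.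
   Since R_lambda u^lambda is the solution at 2 T, the Yosida approximation
   is (u_T - w) / T - 2 (u_2T - w) / (2 T), which tends to the opposite. *)

(** The amount [2 T] comes from the dual variable: across a local maximum it has to pass from [T] to
    [- T], and its derivative is [u - w]. The range of [T] in which the explicit cut works shrinks
    with the heights of the extrema and is not bounded below along the compositions, hence an
    induction over the half-line instead of finitely many steps. The maximum principle has one
    exception, constant solutions, whose dual variable is determined only up to a constant; such a
    solution persists for all larger [T]. A selection of [sgn] of the Clarke differential is
    required at every point, not almost everywhere, so one-sided derivatives must exist everywhere;
    they come from the smallness of the variation on short one-sided neighbourhoods. *)

(* [lra] is slow in large contexts. *)
Ltac lin :=
  repeat match goal with H : ?P |- _ =>
    lazymatch P with
    | is_true _ => fail
    | @eq _ _ _ => fail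
    | _ => match type of P with Prop => clear H end
    end
  end;
  first [repeat match goal with H : context [@Rintegral] |- _ => clear H end; lra | lra].

(** * Monotone absolutely continuous functions *)

Section absolutely_continuous_density.
Context {R : realType}.
Notation mu := (@lebesgue_measure R).
Implicit Types (F : R -> R) (U : set R).

(** Open on the left and closed on the right: the cells of one level tile []0, 1]] disjointly, and
    these are the intervals on which a Stieltjes measure is an increment. *)
Definition dyad (n k : nat) : set R :=
  `]k%:R / (2 ^ n)%:R, k.+1%:R / (2 ^ n)%:R]%classic.

Lemma dyadP n k x : dyad n k x <-> k%:R < x * (2 ^ n)%:R <= k.+1%:R.
Proof.
rewrite /dyad/= in_itv/= ltr_pdivrMr ?ler_pdivlMr//;
by rewrite ltr0n expn_gt0.
Qed.

Lemma dyad_trivIset n : trivIset setT (dyad n).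
Proof.
apply/trivIsetP => i j _ _ ij; apply/seteqP; split => // x [/dyadP/andP[a b] /dyadP/andP[c d]].
have := lt_le_trans a d; have := lt_le_trans c b.
by rewrite !ltr_nat !ltnS => ? ?; apply: (negP ij); rewrite eqn_leq; apply/andP.
Qed.

(** A rejected cell becomes [set0], so every level keeps the index range [k < 2 ^ n] and inherits
    the disjointness of the cells. *)
Definition dyad_in U n k := if `[< dyad n k `<=` U >] then dyad n k else set0.

Definition dyad_approx U n : set R :=
  \big[setU/set0]_(k < (2 ^ n)%N) dyad_in U n k.

Lemma dyad_approxP U n x : dyad_approx U n x <->
  exists k, [/\ (k < 2 ^ n)%N, dyad n k `<=` U & dyad n k x].
Proof.
rewrite /dyad_approx -bigcup_mkord /dyad_in; split.
  by move=> [k /= kn]; case: asboolP => // kU kx; exists k.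
by move=> [k [kn kU kx]]; exists k => //; case: asboolP.
Qed.

(** Halving a cell contained in [U] gives two cells of the next level contained in [U]. *)
Lemma dyad_approx_nd U : nondecreasing_seq (dyad_approx U).
Proof.
apply/nondecreasing_seqP => n; apply/subsetPset => x /dyad_approxP[k [kn kU kx]].
apply/dyad_approxP.
have H m : (2 ^ n.+1)%:R * m = 2 * ((2 ^ n)%:R * m) :> R.
  by rewrite expnS natrM mulrA.
have H2 j y : j = k.*2 \/ j = k.*2.+1 -> dyad n.+1 j y -> dyad n k y.
  move=> jk /dyadP; rewrite mulrC H => /andP[a b]; apply/dyadP.
  rewrite mulrC.
  have E : (k.*2)%:R = 2 * k%:R :> R by rewrite -mul2n natrM.
  by case: jk => jk; move: a b; rewrite jk -?natr1 E => a b; lin.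
move: (kx) => /dyadP/andP[a b].
have E : (k.*2)%:R = 2 * k%:R :> R by rewrite -mul2n natrM.
have [c|c] := leP (x * (2 ^ n.+1)%:R) (k.*2.+1)%:R.
  exists k.*2; split.
  - by rewrite expnS mul2n ltn_double.
  - by move=> y /H2 h; apply: kU; apply: h; left.
  - apply/dyadP; rewrite c andbT mulrC H E; lin.
exists k.*2.+1; split.
- by rewrite expnS mul2n ltn_Sdouble.
- by move=> y /H2 h; apply: kU; apply: h; right.
- apply/dyadP; rewrite c /= mulrC H -!natr1 E; rewrite -natr1 in b; lin.
Qed.

Lemma dyad_approx_bigcup U : open U ->
  U `&` `]0, 1]%classic `<=` \bigcup_n dyad_approx U n.
Proof.
move=> oU x [Ux]; rewrite /= in_itv/= => /andP[x0 x1].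
have [e /= e0 eU] := open_subball oU Ux.
(* Since [n < 2 ^ n], the cells of level [n] are shorter than [e / 2]. *)
pose n := Num.bound (e / 2)^-1.
exists n => //; apply/dyad_approxP.
have N0 : (0 : R) < (2 ^ n)%:R by rewrite ltr0n expn_gt0.
have xN : 0 < x * (2 ^ n)%:R by rewrite mulr_gt0.
have [k kx] : exists k, dyad n k x.
  have [m] : exists m, x * (2 ^ n)%:R <= m%:R.
    by exists (Num.bound (x * (2 ^ n)%:R)); apply/ltW/ltr_bound.
  elim: m => [|m IH] xm; first by rewrite leNgt xN in xm.
  have [/IH//|h] := leP (x * (2 ^ n)%:R) m%:R.
  by exists m; apply/dyadP; rewrite h.
exists k; split=> //.
  move/dyadP : kx => /andP[kx _].
  have : k%:R < (2 ^ n)%:R :> R.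
    apply: lt_le_trans kx _; rewrite -[leRHS]mul1r ler_wpM2r//; exact: ltW.
  by rewrite ltr_nat.
move=> y ky; apply: (eU (e / 2)) => //=.
- rewrite sub0r normrN ger0_norm; lin.
- lin.
move: kx ky => /dyadP/andP[a b] /dyadP/andP[c d].
have : `|x - y| * (2 ^ n)%:R < 1.
  rewrite -[X in _ * X](@gtr0_norm _ (2 ^ n)%:R)// -normrM mulrBl ltr_norml.
  rewrite -natr1 in b d; apply/andP; split; lin.
rewrite -ball_normE/= => h.
have N1 : (e / 2)^-1 < (2 ^ n)%:R.
  have : (e / 2)^-1 < n%:R by exact: ltr_bound.
  by move/lt_le_trans; apply; rewrite ler_nat ltnW// ltn_expl.
rewrite -(ltr_pM2r N0); apply: lt_trans h _.
have e20 : 0 < e / 2 by lin.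
by rewrite -[ltLHS](mulfV (lt0r_neq0 e20)) ltr_pM2l.
Qed.

Lemma measurable_dyad_in U n k : measurable (dyad_in U n k).
Proof. by rewrite /dyad_in; case: ifP => // _; exact: measurable_itv. Qed.

Lemma measurable_dyad_approx U n : measurable (dyad_approx U n).
Proof. by apply: bigsetU_measurable => k _; exact: measurable_dyad_in. Qed.

Lemma dyad_in_trivIset U n : trivIset setT (dyad_in U n).
Proof.
apply/trivIsetP => i j _ _ ij; have /trivIsetP/(_ i j I I ij) := @dyad_trivIset n.
by rewrite /dyad_in; do 2 case: ifP => _; rewrite ?set0I ?setI0.
Qed.

Lemma dyad_approx_sub U n : dyad_approx U n `<=` U.
Proof. by move=> x /dyad_approxP[k [_ kU /kU]]. Qed.

Lemma measure_dyad_approx (nu : {measure set (measurableTypeR R) -> \bar R}) U n :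
  nu (dyad_approx U n) = (\sum_(k < (2 ^ n)%N) nu (dyad_in U n k))%E.
Proof.
apply: measure_semi_additive_ord_I.
- by move=> k _; exact: measurable_dyad_in.
- by apply: sub_trivIset; last exact: dyad_in_trivIset.
- exact: measurable_dyad_approx.
Qed.

Lemma dyad_in_endpoints U n k : (k < 2 ^ n)%N -> exists st : R * R,
  [/\ 0 <= st.1, st.1 <= st.2, st.2 <= 1 & dyad_in U n k = `]st.1, st.2]%classic].
Proof.
move=> kn; have N0 : (0 : R) < (2 ^ n)%:R by rewrite ltr0n expn_gt0.
rewrite /dyad_in; case: ifP => _; last first.
  (* A rejected cell is the degenerate interval []0, 0]], so that absolute continuity applies to all
     [2 ^ n] indices at once. *)
  by exists (0, 0); split; rewrite /= ?ler01 ?lexx ?set_itvoc0.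
exists (k%:R / (2 ^ n)%:R, k.+1%:R / (2 ^ n)%:R); split => /=.
- by rewrite divr_ge0// ltW.
- by rewrite ler_pM2r ?invr_gt0// ler_nat.
- by rewrite ler_pdivrMr// mul1r ler_nat.
- by [].
Qed.

Lemma stieltjes_itv (F : cumulative R R) a b : a <= b ->
  lebesgue_stieltjes_measure F `]a, b]%classic = (F b - F a)%:E.
Proof.
move=> ab; rewrite /lebesgue_stieltjes_measure.
rewrite /measure_extension measurable_mu_extE/=; last exact: is_ocitv.
by rewrite wlength_itv_bnd.
Qed.

(** By outer regularity [N] lies in an open set [U] of measure below the [d] of absolute continuity.
    The finite unions of dyadic cells inside [U] then have Stieltjes measure at most [e], and they
    increase to a set containing [N] within []0, 1]]. *)
Lemma abs_continuous_stieltjes_null (F : cumulative R R) N :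
  abs_continuous F -> measurable N -> mu N = 0%E ->
  lebesgue_stieltjes_measure F (N `&` `]0, 1]%classic) = 0%E.
Proof.
move=> acF mN N0; set nu := lebesgue_stieltjes_measure F.
apply/eqP; rewrite eq_le measure_ge0 andbT.
apply/lee_addgt0Pr => e e0; rewrite add0e.
have [d d0 Fd] := acF e e0.
have [U [oU NU Ud]] : exists U, [/\ open U, N `<=` U & (mu (U `\` N) < d%:E)%E].
  have Noo : (mu N < +oo)%E by rewrite N0 ltry.
  exact: lebesgue_regularity_outer.
have muU : (mu U < d%:E)%E.
  have mU : measurable U by exact: open_measurable.
  rewrite -(setDUK NU) measureU//; last 2 first.
  - exact: measurableD.
  - by rewrite setDIK.
  rewrite (_ : (_ + _)%E = (0 + mu (U `\` N))%E); first by rewrite add0e.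
  by congr adde; exact: N0.
have le_e n : (nu (dyad_approx U n) <= e%:E)%E.
  have -> : nu (dyad_approx U n) = _ := measure_dyad_approx (lebesgue_stieltjes_measure F) U n.
  have [st stP] := choice (fun k : 'I_(2 ^ n) => dyad_in_endpoints U (ltn_ord k)).
  have nuE k : nu (dyad_in U n (nat_of_ord k)) = (F (st k).2 - F (st k).1)%:E.
    by have [_ h _ ->] := stP k; exact: stieltjes_itv.
  have muE k : mu (dyad_in U n (nat_of_ord k)) = ((st k).2 - (st k).1)%:E.
    have [_ h _ ->] := stP k; rewrite lebesgue_measure_itv/= lte_fin.
    by case: ltP => // h'; congr EFin; lin.
  rewrite (eq_bigr _ (fun k _ => nuE k)) sumEFin lee_fin.
  apply: (le_trans (ler_sum _ (fun k _ => ler_norm _))).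
  apply/ltW/Fd.
  - by move=> k; have [] := stP k.
  - apply/trivIsetP => i j _ _ ij; apply/seteqP; split => // x [].
    have [_ _ _ Ei] := stP i; have [_ _ _ Ej] := stP j.
    have oc a b : x \in `]a, b[ -> x \in `]a, b].
      by rewrite !in_itv/= => /andP[-> /ltW].
    move=> /oc xi /oc xj.
    have /trivIsetP := @dyad_in_trivIset U n => /(_ i j I I).
    by move=> /(_ ij); rewrite Ei Ej => /seteqP[D _]; apply: (D x); split.
  - rewrite -lte_fin -sumEFin -(eq_bigr _ (fun k _ => muE k)).
    rewrite -(measure_dyad_approx mu); apply: le_lt_trans muU.
    apply: le_measure; rewrite ?inE.
    + exact: measurable_dyad_approx.
    + exact: open_measurable.
    + exact: dyad_approx_sub.
have mB : measurable (\bigcup_n dyad_approx U n).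
  by apply: bigcupT_measurable => n; exact: measurable_dyad_approx.
apply: (@le_trans _ _ (nu (\bigcup_n dyad_approx U n))).
  apply: le_measure; rewrite ?inE//.
  - by apply: measurableI => //; exact: measurable_itv.
  - apply: subset_trans (dyad_approx_bigcup oU).
    exact: setSI.
have /cvg_lim <- // : nu (dyad_approx U n) @[n --> \oo] --> nu (\bigcup_n dyad_approx U n).
  apply: nondecreasing_cvg_mu => //; first by move=> n; exact: measurable_dyad_approx.
  exact: dyad_approx_nd.
apply: lime_le.
  apply: ereal_nondecreasing_is_cvgn => m n mn; apply: le_measure; rewrite ?inE.
  - exact: measurable_dyad_approx.
  - exact: measurable_dyad_approx.
  - by apply/subsetPset; exact: dyad_approx_nd.
by apply: nearW.
Qed.

(** Restricted to []0, 1]], the Stieltjes measure of [F] is finite and vanishes on Lebesgue null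
    sets; the density is its Radon-Nikodym derivative. *)
Lemma abs_continuous_density F : {homo F : x y / x <= y} -> continuous F ->
  abs_continuous F -> exists2 g : R -> R, mu.-integrable setT (EFin \o g) &
    forall x y, 0 <= x -> x <= y -> y <= 1 ->
      F y - F x = \int[mu]_(t in `]x, y]) g t.
Proof.
move=> ndF cF acF.
pose C := HB.pack_for (cumulative R R) F (isCumulative.Build R _ R F ndF (right_continuousW cF)).
pose D : set (measurableTypeR R) := `]0, 1]%classic.
have mD : measurable D by exact: measurable_itv.
have Doo : (lebesgue_stieltjes_measure C D < +oo)%E.
  by rewrite stieltjes_itv// ltry.
pose nu := mfrestr mD Doo.
have [|f [f0 ffin fint fE]] :=
    @radon_nikodym_sigma_finite _ _ R mu nu.
  apply/null_content_dominatesP => A mA A0.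
  exact: abs_continuous_stieltjes_null.
exists (fine \o f).
  rewrite (_ : _ \o _ = f)//.
  by apply/funext => x /=; rewrite fineK.
move=> x y x0 xy y1.
rewrite /Rintegral -[LHS]/(fine (C y - C x)%:E) -stieltjes_itv//; congr fine.
transitivity (nu `]x, y]%classic).
  rewrite /nu /mfrestr /mrestr/= setIidl// => z/=; rewrite !in_itv/=.
  by move=> /andP[a b]; apply/andP; split; [exact: le_lt_trans a|exact: le_trans y1].
transitivity (\int[mu]_(z in `]x, y]) f z)%E; first by apply: fE; exact: measurable_itv.
by apply: eq_integral => z _ /=; rewrite fineK.
Qed.

End absolutely_continuous_density.

(** * The fundamental theorem of calculus for absolutely continuous, piecewise monotone functions *)

Section ftc_absolutely_continuous.
Context {R : realType}.
Notation mu := (@lebesgue_measure R).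
Implicit Types (f g : R -> R) (a b x y z : R).

Lemma integrable_oocc f a b : mu.-integrable `]a, b[ (EFin \o f) ->
  mu.-integrable `[a, b] (EFin \o f).
Proof.
move=> /integrableP[mf foo]; apply/integrableP; split.
  by apply/emeasurable_fun_itv_obnd_cbndP/emeasurable_fun_itv_bndo_bndcP.
rewrite integral_itv_bndoo//.
exact: measurableT_comp.
Qed.

Lemma integrable_sub f a b x y : a <= x -> y <= b ->
  mu.-integrable `[a, b] (EFin \o f) -> mu.-integrable `[x, y] (EFin \o f).
Proof.
move=> ax yb; apply: integrableS => //.
by apply: subset_itv; rewrite bnd_simp.
Qed.

Lemma Rintegral_itvD f x y z : x <= y -> y <= z ->
  mu.-integrable `[x, z] (EFin \o f) ->
  \int[mu]_(t in `[x, z]) f t =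
    \int[mu]_(t in `[x, y]) f t + \int[mu]_(t in `[y, z]) f t.
Proof.
move=> xy yz fi.
have := @Rintegral_itvB R f (BLeft x) (BRight z) y fi.
rewrite !bnd_simp => /(_ xy yz) E.
rewrite -[X in _ + X]Rintegral_itv_obnd_cbnd; last first.
  by apply: integrableS fi => //; apply: subset_itv; rewrite bnd_simp.
by rewrite -E addrC subrK.
Qed.

Lemma Rintegral_itvxx f x : \int[mu]_(t in `[x, x]) f t = 0.
Proof. by rewrite set_itv1 Rintegral_set1. Qed.

(** Precomposition with this projection onto [[a, b]] extends a function by its boundary values to
    the whole line, preserving monotonicity, continuity and absolute continuity. *)
Definition clamp a b x := if x < a then a else if b < x then b else x.

Lemma clamp_id a b x : a <= x -> x <= b -> clamp a b x = x.
Proof. by move=> ax xb; rewrite /clamp !ltNge ax xb. Qed.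

Lemma clamp_ge a b x : a <= b -> a <= clamp a b x.
Proof. by move=> ab; rewrite /clamp; repeat (case: ifPn; rewrite -?leNgt => ?); lin. Qed.

Lemma clamp_le a b x : a <= b -> clamp a b x <= b.
Proof. by move=> ab; rewrite /clamp; repeat (case: ifPn; rewrite -?leNgt => ?); lin. Qed.

Lemma clamp_homo a b : a <= b -> {homo clamp a b : x y / x <= y}.
Proof. by move=> ab x y xy; rewrite /clamp; repeat (case: ifPn; rewrite -?leNgt => ?); lin. Qed.

Lemma clamp_lip a b x y : a <= b -> x <= y -> clamp a b y - clamp a b x <= y - x.
Proof. by move=> ab xy; rewrite /clamp; repeat (case: ifPn; rewrite -?leNgt => ?); lin. Qed.

Lemma lt_clampl a b x z : clamp a b x < z -> z <= b -> x < z.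
Proof. by rewrite /clamp; repeat (case: ifPn; rewrite -?leNgt => ?); lin. Qed.

Lemma lt_clampr a b x z : a <= z -> z < clamp a b x -> z < x.
Proof. by rewrite /clamp; repeat (case: ifPn; rewrite -?leNgt => ?); lin. Qed.

Lemma clamp_disj a b x y x' y' : a <= b ->
  `]x, y[%classic `&` `]x', y'[%classic = set0 ->
  `]clamp a b x, clamp a b y[%classic `&` `]clamp a b x', clamp a b y'[%classic = set0.
Proof.
move=> ab /seteqP[D _]; apply/seteqP; split => // z [] /=.
rewrite !in_itv/= => /andP[h1 h2] /andP[h3 h4].
have zb : z <= b := le_trans (ltW h2) (clamp_le y ab).
have az : a <= z := le_trans (clamp_ge x ab) (ltW h1).
by apply: (D z); split => /=; rewrite in_itv/= ?(lt_clampl h1 zb) ?(lt_clampr az h2)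
  ?(lt_clampl h3 zb) ?(lt_clampr az h4).
Qed.

Lemma clamp_dist a b x y : a <= b -> `|clamp a b x - clamp a b y| <= `|x - y|.
Proof.
move=> ab; wlog xy : x y / x <= y.
  by move=> h; case: (leP x y) => [/h//|/ltW/h]; rewrite distrC [X in _ <= X]distrC.
rewrite distrC [X in _ <= X]distrC !ger0_norm ?subr_ge0//; first exact: clamp_lip.
exact: clamp_homo.
Qed.

Lemma abs_continuous_clamp f a b : 0 <= a -> a <= b -> b <= 1 ->
  abs_continuous f -> abs_continuous (f \o clamp a b).
Proof.
move=> a0 ab b1 acf e e0; have [d d0 fd] := acf e e0.
exists d => // n s t st tr sd.
apply: (fd n (clamp a b \o s) (clamp a b \o t)).
- move=> i /=; have [_ [sti _]] := st i; split; [|split].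
  + exact: le_trans (clamp_ge _ ab).
  + exact: (clamp_homo ab).
  + exact: le_trans (clamp_le _ ab) _.
- apply/trivIsetP => i j _ _ ij /=.
  by apply: clamp_disj => //; move/trivIsetP : tr; apply.
- apply: le_lt_trans sd; apply: ler_sum => i _; apply: clamp_lip => //.
  by have [_ []] := st i.
Qed.

Lemma abs_continuous_dist f : abs_continuous f -> forall e, 0 < e ->
  exists2 d, 0 < d & forall x y, 0 <= x -> x <= 1 -> 0 <= y -> y <= 1 ->
    `|x - y| < d -> `|f x - f y| < e.
Proof.
move=> acf e e0; have [d d0 fd] := acf e e0; exists d => //.
have H x y : 0 <= x -> x <= y -> y <= 1 -> y - x < d -> `|f y - f x| < e.
  move=> x0 xy y1 xyd.
  have := fd 1%N (fun=> x) (fun=> y); rewrite !big_ord1; apply => //.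
  by apply/trivIsetP => i j _ _; rewrite (ord1 i) (ord1 j) eqxx.
move=> x y x0 x1 y0 y1; case: (leP x y) => xy.
  by rewrite distrC [X in _ -> X < _]distrC ger0_norm ?subr_ge0//; exact: H.
by rewrite gtr0_norm ?subr_gt0//; apply: H => //; exact: ltW.
Qed.

Lemma abs_continuous_clamp_continuous f a b : 0 <= a -> a <= b -> b <= 1 ->
  abs_continuous f -> continuous (f \o clamp a b).
Proof.
move=> a0 ab b1 acf x; apply/cvgrPdist_lt => e e0 /=.
have [d d0 fd] := abs_continuous_dist acf e0.
near=> y; apply: fd.
- exact: le_trans (clamp_ge _ ab).
- exact: le_trans (clamp_le _ ab) _.
- exact: le_trans (clamp_ge _ ab).
- exact: le_trans (clamp_le _ ab) _.
apply: (le_lt_trans (clamp_dist _ _ ab)).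
by near: y; exact: (@cvgr_dist_lt _ R^o).
Unshelve. all: by end_near. Qed.

(** The sign [s] lets one argument serve nondecreasing ([s = 1]) and nonincreasing ([s = -1])
    functions. *)
Definition smono (s : R) f a b := forall x y, a <= x -> x <= y -> y <= b ->
  s * f x <= s * f y.

(** Up to the sign, the extension of [f] by clamping is nondecreasing and has a density [g]. By
    Lebesgue differentiation [derive1 f] equals [s * g] almost everywhere on []a, b[], and the
    integrals of [g] are the increments. *)
Lemma abs_continuous_smono_ftc (s : R) f a b x y :
  s = 1 \/ s = -1 -> abs_continuous f ->
  mu.-integrable `[0, 1] (EFin \o derive1 f) ->
  0 <= a -> b <= 1 -> smono s f a b -> a <= x -> x <= y -> y <= b ->
  \int[mu]_(t in `[x, y]) derive1 f t = f y - f x.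
Proof.
move=> s1 acf f'i a0 b1 mf ax xy yb.
have ab : a <= b by lin.
pose F := s \*o (f \o clamp a b).
have ss : s * s = 1 by case: s1 => ->; ring.
have ndF : {homo F : x y / x <= y}.
  move=> u v uv; apply: mf.
  - exact: clamp_ge.
  - exact: clamp_homo.
  - exact: clamp_le.
have cF : continuous F.
  move=> u; apply: cvgM; first exact: cvg_cst.
  exact: abs_continuous_clamp_continuous.
have acF : abs_continuous F.
  move=> e e0; have [d d0 fd] := abs_continuous_clamp a0 ab b1 acf e0.
  exists d => // n S T st tr sd; have := fd n S T st tr sd.
  congr (_ < _); apply: eq_bigr => i _; rewrite /F/= -mulrBr normrM.
  by case: s1 => ->; rewrite ?normrN normr1 mul1r.
have [g gi gF] := abs_continuous_density ndF cF acF.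
have gloc : locally_integrable [set: R] g.
  by apply: open_integrable_locally => //; exact: openT.
have gi0 z : mu.-integrable [set` Interval (BLeft 0) (BRight z)] (EFin \o g).
  by apply: integrableS gi.
have := FTC1 gi0 gloc.
set G := (fun x => _) => aeG.
have f'E : {ae mu, forall t, a < t < b -> derive1 f t = s * g t}.
  move: aeG; apply: filterS; first exact: (ae_filter_ringOfSetsType mu).
  move=> t + /andP[tA tb].
  move=> h; have {h}[|dG G't] := h; first by rewrite (@lte_fin R); lin.
  have ft : {near t, f =1 (fun r => s * F 0 + s * G r)}.
    near=> r.
    have [r0 rr] : a <= r /\ r <= b.
      by split; apply/ltW; near: r; [exact: lt_nbhsr|exact: lt_nbhsl].
    have := gF 0 r (lexx _) (le_trans a0 r0) (le_trans rr b1).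
    rewrite Rintegral_itv_obnd_cbnd; last by apply: integrableS gi.
    rewrite -/(G r) => <-.
    by rewrite -mulrDr addrC subrK /F/= mulrA ss mul1r clamp_id.
  rewrite derive1E (near_eq_derive _ ft).
  rewrite deriveD; [|exact: derivable_cst|exact: derivableZ].
  rewrite derive_cst add0r deriveZ// -derive1E G't//.
have gi' : mu.-integrable setT (EFin \o (s \*o g)).
  by have := integrableZl measurableT s gi; apply: eq_integrable.
transitivity (\int[mu]_(t in `[x, y]) (s * g t)).
  have mf' : measurable_fun `]x, y[ (EFin \o derive1 f).
    apply: measurable_funS (measurable_int mu f'i) => //.
    by apply: subset_itv; rewrite bnd_simp; lin.
  have mg' : measurable_fun `]x, y[ (EFin \o (s \*o g)).
    by apply: measurable_funTS; exact: (measurable_int mu gi').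
  rewrite /Rintegral integral_itv_bndoo// [in RHS]integral_itv_bndoo//.
  congr fine; apply: ae_eq_integral => //.
  move: f'E; apply: filterS; first exact: (ae_filter_ringOfSetsType mu).
  move=> t h; rewrite /= in_itv/= => /andP[xt ty].
  by rewrite h//; apply/andP; split; [exact: le_lt_trans xt|exact: lt_le_trans yb].
rewrite RintegralZl//; last by apply: integrableS gi.
rewrite -Rintegral_itv_obnd_cbnd; last by apply: integrableS gi.
rewrite -gF; [|lin..].
by rewrite /F/= -mulrBr mulrA ss mul1r !clamp_id//; lin.
Unshelve. all: by end_near. Qed.

Lemma increasing_on_smono f a b : increasing_on `[a, b] f -> smono 1 f a b.
Proof.
move=> mf x y ax xy yb; rewrite !mul1r; apply: mf => //.
  by rewrite inE/= in_itv/= ax (le_trans xy yb).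
by rewrite inE/= in_itv/= yb (le_trans ax xy).
Qed.

Lemma decreasing_on_smono f a b : decreasing_on `[a, b] f -> smono (-1) f a b.
Proof.
move=> mf x y ax xy yb; rewrite !mulN1r lerN2; apply: mf => //.
  by rewrite inE/= in_itv/= ax (le_trans xy yb).
by rewrite inE/= in_itv/= yb (le_trans ax xy).
Qed.

Definition piecewise_smono n (t : nat -> R) (s : nat -> R) f :=
  [/\ t 0%N = 0, t n = 1 & forall i, (i < n)%N ->
    [/\ t i <= t i.+1, s i = 1 \/ s i = -1 & smono (s i) f (t i) (t i.+1)]].

Lemma piecewise_smono_ge0 n t s f i : piecewise_smono n t s f -> (i <= n)%N -> 0 <= t i.
Proof.
move=> [t0 _ ts]; elim: i => [|i IH] ni; first by rewrite t0.
by have [h _ _] := ts _ ni; exact: le_trans (IH (ltnW ni)) h.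
Qed.

Lemma piecewise_smono_le n t s f i j : piecewise_smono n t s f ->
  (i <= j)%N -> (j <= n)%N -> t i <= t j.
Proof.
move=> [t0 _ ts]; elim: j => [|j IH]; first by rewrite leqn0 => /eqP ->.
rewrite leq_eqVlt => /predU1P[->//|]; rewrite ltnS => ij jn.
by have [h _ _] := ts _ jn; exact: le_trans (IH ij (ltnW jn)) h.
Qed.

Lemma piecewise_smono_le1 n t s f i : piecewise_smono n t s f -> (i <= n)%N -> t i <= 1.
Proof. by move=> pf ni; have [_ <- _] := pf; exact: piecewise_smono_le pf _ _. Qed.

Lemma J_regular_piecewise f : J_regular f -> exists n t s, piecewise_smono n t s f.
Proof.
move=> [_ _ _ [n [t [t0 t1 ti]]]]; exists n, t.
exists (fun i => if `[< increasing_on `[t i, t i.+1] f >] then 1 else -1).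
split => // i ni; have [tii mi] := ti i ni; split => //.
  by case: asboolP; [left|right].
case: asboolP => [h|h]; first exact: increasing_on_smono.
by case: mi => // h'; exact: decreasing_on_smono.
Qed.

Definition ftc_on f := mu.-integrable `[0, 1] (EFin \o derive1 f) /\
  forall x y, 0 <= x -> x <= y -> y <= 1 ->
    \int[mu]_(t in `[x, y]) derive1 f t = f y - f x.

Lemma abs_continuous_ftc n t s f : abs_continuous f -> piecewise_smono n t s f ->
  mu.-integrable `[0, 1] (EFin \o derive1 f) -> ftc_on f.
Proof.
move=> acf pf f'i; split => // x y x0 xy y1.
have [t0 tn ts] := pf.
suff H i : (i <= n)%N -> forall x y, 0 <= x -> x <= y -> y <= t i ->
    \int[mu]_(t in `[x, y]) derive1 f t = f y - f x.
  by apply: (H n) => //; rewrite tn.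
elim: i => {x y x0 xy y1} [|i IH] ni x y x0 xy yi.
  have -> : x = y by rewrite t0 in yi; lin.
  by rewrite Rintegral_itvxx subrr.
have [tii si mi] := ts i ni.
have ti0 := piecewise_smono_ge0 pf (ltnW ni).
have ti1 := piecewise_smono_le1 pf ni.
have [yt|ty] := leP y (t i); first exact: IH (ltnW ni) _ _ _ _ _.
have piece u v : t i <= u -> u <= v -> v <= t i.+1 ->
    \int[mu]_(t in `[u, v]) derive1 f t = f v - f u.
  exact: abs_continuous_smono_ftc si acf f'i ti0 ti1 mi.
have [tx|xt] := leP (t i) x; first exact: piece.
rewrite (@Rintegral_itvD _ _ (t i)) ?(ltW ty) ?(ltW xt)//; last first.
  by apply: integrable_sub f'i => //; lin.
rewrite (IH (ltnW ni))//; last exact: ltW.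
rewrite piece//; [lin|exact: ltW].
Qed.

End ftc_absolutely_continuous.

(** * Variation against Lipschitz test functions *)

Section lipschitz_tests.
Context {R : realType}.
Notation mu := (@lebesgue_measure R).
Implicit Types (f g phi psi : R -> R) (a b c d x y z V : R).

(** For [a = 0] and [b = 1] this is [test_function]; other end points localize the variation to a
    subinterval. *)
Definition test_in a b (phi : R -> R) :=
  [/\ (forall x, derivable phi x 1), continuous (derive1 phi),
      (exists c d : R, [/\ a < c, d < b &
         forall x, x \notin `[c, d] -> phi x = 0])
    & forall x, `|phi x| <= 1].

(* [dvar_le 0 1 g V] says [Dvariation g <= V]. *)
Definition dvar_le a b g V := forall phi, test_in a b phi ->
  \int[mu]_(x in `]0, 1[) (g x * derive1 phi x) <= V.

(** Continuity on a compact interval in metric form: only the values on [[a, b]] enter, and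
    restriction and gluing need no subspace topology. *)
Definition ucont_on a b f := forall e : R, 0 < e -> exists2 d : R, 0 < d &
  forall x y, a <= x -> x <= b -> a <= y -> y <= b -> `|x - y| < d -> `|f x - f y| < e.

Lemma dvar_le_ge0 a b g V : a < b -> dvar_le a b g V -> 0 <= V.
Proof.
move=> ab /(_ (cst 0)).
have d0 : derive1 (cst 0) = cst 0 :> (R -> R) by apply/funext => x; rewrite derive1_cst.
rewrite d0; have -> : (fun x => g x * cst 0 x) = cst 0.
  by apply/funext => x; rewrite mulr0.
rewrite Rintegral_cst// mul0r; apply; split.
- by move=> x; exact: derivable_cst.
- by rewrite d0; exact: cst_continuous.
- by exists (a + (b - a) / 3), (b - (b - a) / 3); split => //; lin.
- by move=> x; rewrite normr0.
Qed.

Lemma is_derive_shift_fun (P : R -> R) k x l : is_derive (x + k) 1 P l ->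
  is_derive x 1 (fun y => P (y + k)) l.
Proof.
move=> [dP Pl].
have E : (fun h => h^-1 *: (((fun y => P (y + k)) \o shift x) (h *: 1) - P (x + k))) =
    (fun h => h^-1 *: ((P \o shift (x + k)) (h *: 1) - P (x + k))).
  by apply/funext => h /=; rewrite addrA.
apply: DeriveDef; first by rewrite /derivable E.
by rewrite /derive E.
Qed.

Definition lipschitz_by (L : R) f := forall x y, `|f x - f y| <= L * `|x - y|.

Lemma lipschitz_by_continuous L f : lipschitz_by L f -> continuous f.
Proof.
move=> Lf x; apply/cvgrPdist_lt => e e0.
have L0 : 0 < `|L| + 1 by rewrite ltr_wpDl.
near=> y; apply: (le_lt_trans (Lf x y)).
apply: (@le_lt_trans _ _ ((`|L| + 1) * `|x - y|)).
  by apply: ler_wpM2r => //; rewrite (le_trans (ler_norm _))// lerDl.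
rewrite mulrC -ltr_pdivlMr//; near: y; apply: (@cvgr_dist_lt _ R^o) => //.
by rewrite divr_gt0.
Unshelve. all: by end_near. Qed.

Lemma within_continuous_integrable f a b : {within `[a, b], continuous f} ->
  mu.-integrable `[a, b] (EFin \o f).
Proof.
move=> cf; apply: continuous_compact_integrable => //; exact: segment_compact.
Qed.

Lemma compact_support_antiderivative phi c d : continuous phi ->
  (forall x, x \notin `[c, d] -> phi x = 0) ->
  exists P : R -> R, forall x, is_derive x 1 P (phi x).
Proof.
move=> cphi phi0.
have iphi : mu.-integrable setT (EFin \o phi).
  have -> : EFin \o phi = (EFin \o phi) \_ `[c, d].
    apply/funext => x; rewrite patchE; case: ifPn => //.
    by rewrite notin_setE/= => /negP h; rewrite phi0.
  have [h _] := @integrable_mkcond _ _ R mu `[c, d]%classic (EFin \o phi) (measurable_itv _).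
  apply: h.
  by apply: within_continuous_integrable; exact: continuous_subspaceT.
exists (fun x => \int[mu]_(t in `]-oo, x]) phi t) => x.
have [|||dP PE] := @continuous_FTC1 R phi -oo%O x (x + 1) _ _ _ (cphi x).
- by rewrite ltrDl.
- by apply: integrableS iphi.
- exact: ltNyr.
apply: (@DeriveDef _ _ _ x 1 _ (phi x) dP).
by rewrite -derive1E; exact: PE.
Qed.

(** The average of [phi] over [[x, x + e]] is of class C^1 with the difference quotient of [phi] as
    derivative. By the mean value theorem it is a value of [phi], which preserves the bound and
    extends the support only by [e] to the left. *)
Lemma mollified_test a b c d phi L e : lipschitz_by L phi ->
  a < c -> d < b -> (forall x, x \notin `[c, d] -> phi x = 0) ->
  (forall x, `|phi x| <= 1) -> 0 < e -> a < c - e ->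
  exists2 rho, test_in a b rho &
    forall x, derive1 rho x = e^-1 * (phi (x + e) - phi x).
Proof.
move=> Lphi ac db phi0 phi1 e0 ae.
have cphi := lipschitz_by_continuous Lphi.
have [P dP] := compact_support_antiderivative cphi phi0.
pose rho := fun x => e^-1 * (P (x + e) - P x).
have drho x : is_derive x 1 rho (e^-1 * (phi (x + e) - phi x)).
  have h1 := is_derive_shift_fun (dP (x + e)).
  have h2 := dP x.
  rewrite /rho; exact: is_deriveZ.
have rhoE x : exists2 z, x < z < x + e & rho x = phi z.
  have [||z] := @MVT R P phi x (x + e) _ (fun y _ => dP y).
  - by rewrite ltrDl.
  - apply: derivable_within_continuous => y _; exact: (@ex_derive _ _ _ _ _ _ _ (dP y)).
  rewrite in_itv/= => xze E; exists z => //.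
  rewrite /rho E; have -> : x + e - x = e by ring.
  by rewrite mulrC mulfK// gt_eqF.
exists rho; last by move=> x; rewrite derive1E (@derive_val _ _ _ _ _ _ _ (drho x)).
split.
- by move=> x; exact: (@ex_derive _ _ _ _ _ _ _ (drho x)).
- have -> : derive1 rho = fun x => e^-1 * (phi (x + e) - phi x).
    by apply/funext => x; rewrite derive1E (@derive_val _ _ _ _ _ _ _ (drho x)).
  move=> x; apply: cvgM; first exact: cvg_cst.
  apply: cvgB; last exact: cphi.
  apply: (@continuous_comp _ _ _ (fun y => y + e) phi); last exact: cphi.
  by apply: cvgD; [exact: cvg_id|exact: cvg_cst].
- exists (c - e), d; split => // x xcd.
  have [z /andP[xz ze] ->] := rhoE x; apply: phi0.
  move: xcd; rewrite !in_itv/= !negb_and -!ltNge => /orP[h|h]; apply/orP; [left|right]; lin.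
- by move=> x; have [z _ ->] := rhoE x.
Qed.

(** This admits piecewise affine test functions. The derivatives of the mollified tests are
    difference quotients of [phi]: they are bounded by [L], converge to the right derivative, and
    the integrals pass to the limit by domination with [L * |g|]. *)
Lemma lipschitz_test a b c d phi psi L g V : lipschitz_by L phi ->
  a < b -> a < c -> d < b -> (forall x, x \notin `[c, d] -> phi x = 0) ->
  (forall x, `|phi x| <= 1) ->
  (forall x, x \in `]0, 1[ -> right_derivative phi x (psi x)) ->
  mu.-integrable `[0, 1] (EFin \o g) -> dvar_le a b g V ->
  \int[mu]_(x in `]0, 1[) (g x * psi x) <= V.
Proof.
move=> Lphi ab ac db phi0 phi1 dphi ig gV.
have {}ig : mu.-integrable `]0, 1[ (EFin \o g).
  by apply: integrableS ig => //; exact: subset_itv_oo_cc.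
have cphi := lipschitz_by_continuous Lphi.
(* The averages extend the support to the left by [e n]; the shifted index makes [e n < c - a], so
   that the support stays inside []a, b[]. *)
pose e n : R := (c - a) * (harmonic n.+1).
have e0 n : 0 < e n by rewrite mulr_gt0// ?subr_gt0// invr_gt0.
have ele n : a < c - e n.
  have : (harmonic n.+1 : R) < 1 by rewrite /= invf_lt1// ltr1n.
  rewrite -(@ltr_pM2l _ (c - a)) ?subr_gt0// -/(e n); lin.
have ecvg : e n @[n --> \oo] --> (0 : R).
  rewrite -(mulr0 (c - a)); apply: cvgM; first exact: cvg_cst.
  by have := @cvg_harmonic R; rewrite -cvg_shiftS.
pose f_ n x : \bar R := (g x * ((e n)^-1 * (phi (x + e n) - phi x)))%:E.
have mf (n : nat) : measurable_fun (`]0, 1[%classic : set R) (f_ n).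
  apply/measurable_EFinP; apply: measurable_funM.
    by apply/measurable_EFinP; exact: measurable_int ig.
  apply: measurable_funTS; apply: measurable_funM => //.
  apply: measurable_funB; last exact: continuous_measurable_fun.
  apply: continuous_measurable_fun => x.
  apply: (@continuous_comp _ _ _ (fun y => y + e n) phi); last exact: cphi.
  by apply: cvgD; [exact: cvg_id|exact: cvg_cst].
have fcvg x : `]0, 1[%classic x -> f_ ^~ x @ \oo --> (g x * psi x)%:E.
  move=> x01; apply: cvg_EFin; first by apply: nearW.
  apply: cvgM; first exact: cvg_cst.
  have := dphi x x01 => /cvg_at_rightP/(_ e); apply; split => //.
have L0 x : `|phi (x + 1) - phi x| <= L.
  by apply: (le_trans (Lphi _ _)); rewrite addrAC subrr add0r normr1 mulr1.
have L_ge0 : 0 <= L by apply: le_trans (L0 0).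
have H := @dominated_cvg _ _ R mu `]0, 1[%classic (measurable_itv _) f_
  (fun x => (g x * psi x)%:E) (fun x => (L * `|g x|)%:E) mf fcvg.
have fin : (forall x : R, `]0, 1[%classic x -> (L * `|g x|)%:E \is a fin_num) by [].
have iLg : mu.-integrable `]0, 1[ (fun x => (L * `|g x|)%:E).
  have iag := integrable_norm ig.
  have := @integrableZl _ _ R mu `]0, 1[%classic (measurable_itv _) L _ iag.
  by apply: eq_integrable.
have dom n x : `]0, 1[%classic x -> (`|f_ n x| <= (L * `|g x|)%:E)%E.
  move=> _; rewrite /f_ abse_EFin lee_fin normrM mulrC ler_wpM2r//.
  rewrite normrM normfV (gtr0_norm (e0 n)) ler_pdivrMl// mulrC.
  apply: (le_trans (Lphi _ _)); rewrite addrAC subrr add0r gtr0_norm//.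
have {}H := H fin iLg dom.
have Hle n : (\int[mu]_(x in `]0%R, 1%R[) f_ n x <= V%:E)%E.
  have [rho rhot rhoE] := mollified_test Lphi ac db phi0 phi1 (e0 n) (ele n).
  have := gV rho rhot; rewrite /Rintegral.
  have -> : (fun x => (g x * derive1 rho x)%:E) = f_ n.
    by apply/funext => x; rewrite rhoE.
  move=> h; rewrite -(@fineK _ (integral _ _ _)) ?lee_fin//.
  apply: integrable_fin_num => //.
  apply: le_integrable iLg => //; last first.
    by move=> x xx; rewrite [leRHS]gee0_abs ?lee_fin ?mulr_ge0//; exact: dom.
  exact: mf.
rewrite /Rintegral; set I := integral _ _ _ in H *.
have IV : (I <= V%:E)%E.
  rewrite -(cvg_lim _ H)//; apply: lime_le; first by apply/cvg_ex; exists I.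
  exact: nearW.
(* For the value [-oo] the real integral is 0 by default, which is at most [V] because [V] is
   nonnegative. *)
by case: I IV {H} => [r||]//=; rewrite ?lee_fin// => _; apply: dvar_le_ge0 gV.
Qed.

End lipschitz_tests.

(** * The equation as a taut string problem *)

Section mild.
Context {R : realType}.
Notation mu := (@lebesgue_measure R).
Implicit Types (f g w u v p q : R -> R) (a b c d x y z T : R).

Lemma ucont_on_clamp a b f : a <= b -> ucont_on a b f -> continuous (f \o clamp a b).
Proof.
move=> ab cf x; apply/cvgrPdist_lt => e e0 /=.
have [d d0 fd] := cf e e0.
near=> y; apply: fd; rewrite ?clamp_ge ?clamp_le//.
apply: (le_lt_trans (clamp_dist _ _ ab)).
by near: y; exact: (@cvgr_dist_lt _ R^o).
Unshelve. all: by end_near. Qed.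

Lemma ucont_on_within a b f : a <= b -> ucont_on a b f -> {within `[a, b], continuous f}.
Proof.
move=> ab cf.
have := continuous_subspaceT (A := `[a, b]) (ucont_on_clamp ab cf).
apply: subspace_eq_continuous => x; rewrite inE/= in_itv/= => /andP[h1 h2].
by change (f (clamp a b x) = f x); rewrite clamp_id.
Qed.

Lemma ucont_on_integrable a b f : ucont_on a b f -> mu.-integrable `[a, b] (EFin \o f).
Proof.
have [ab cf|ba _] := leP a b.
  exact: within_continuous_integrable (ucont_on_within ab cf).
by rewrite set_itv_ge ?bnd_simp -?ltNge//; exact: integrable_set0.
Qed.

Lemma ucont_on_sub a b x y f : a <= x -> y <= b -> ucont_on a b f -> ucont_on x y f.
Proof.
move=> ax yb cf e e0; have [d d0 fd] := cf e e0.
by exists d => // s t h1 h2 h3 h4; apply: fd; lin.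
Qed.

Lemma ucont_onD a b f g : ucont_on a b f -> ucont_on a b g -> ucont_on a b (fun x => f x + g x).
Proof.
move=> cf cg e e0; have e20 : 0 < e / 2 by lin.
have [d d0 fd] := cf _ e20; have [d' d'0 gd] := cg _ e20.
exists (Num.min d d'); first by rewrite lt_min d0.
move=> x y h1 h2 h3 h4; rewrite lt_min => /andP[h5 h6].
rewrite opprD addrACA; apply: (le_lt_trans (ler_normD _ _)).
by rewrite (splitr e); apply: ltrD; [exact: fd|exact: gd].
Qed.

Lemma ucont_onN a b f : ucont_on a b f -> ucont_on a b (fun x => - f x).
Proof.
move=> cf e e0; have [d d0 fd] := cf _ e0; exists d => // x y h1 h2 h3 h4 h5.
by rewrite -opprD normrN; exact: fd.
Qed.

Lemma ucont_onB a b f g : ucont_on a b f -> ucont_on a b g -> ucont_on a b (fun x => f x - g x).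
Proof. by move=> cf cg; apply: (ucont_onD cf); exact: ucont_onN. Qed.

Lemma ucont_on_bounded a b f : ucont_on a b f ->
  exists2 M, 0 < M & forall x, a <= x -> x <= b -> `|f x| <= M.
Proof.
have [ab cf|ba _] := leP a b; last by exists 1 => // x h1 h2; exfalso; lin.
have [M [_ MM]] := @compact_bounded R R _ (continuous_compact (ucont_on_within ab cf) (@segment_compact R a b)).
exists (`|M| + 1); first by rewrite ltr_wpDl.
move=> x ax xb; apply: (MM (`|M| + 1)); first by rewrite ltr_pwDr// ler_norm.
by exists x => //=; rewrite in_itv/= ax.
Qed.

Lemma Rint_cst x y (k : R) : x <= y -> \int[mu]_(t in `[x, y]) k = k * (y - x).
Proof.
move=> xy; rewrite Rintegral_cst//= lebesgue_measure_itv/= lte_fin.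
have [//|h] := ltP x y; have -> : y = x by lin.
by rewrite subrr !mulr0.
Qed.

Lemma Rint_ge f x y (k : R) : x <= y -> ucont_on x y f ->
  (forall t, x <= t -> t <= y -> k <= f t) -> k * (y - x) <= \int[mu]_(t in `[x, y]) f t.
Proof.
move=> xy cf kf.
rewrite -(Rint_cst k xy).
apply: le_Rintegral => //.
- by apply: (@within_continuous_integrable R (cst k)); exact: continuous_subspaceT (@cst_continuous _ _ k).
- exact: ucont_on_integrable.
- by move=> t; rewrite /= in_itv/= => /andP[h1 h2]; exact: kf.
Qed.

Lemma Rint_le f x y (k : R) : x <= y -> ucont_on x y f ->
  (forall t, x <= t -> t <= y -> f t <= k) -> \int[mu]_(t in `[x, y]) f t <= k * (y - x).
Proof.
move=> xy cf kf.
rewrite -(Rint_cst k xy).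
apply: le_Rintegral => //.
- exact: ucont_on_integrable.
- by apply: (@within_continuous_integrable R (cst k)); exact: continuous_subspaceT (@cst_continuous _ _ k).
- by move=> t; rewrite /= in_itv/= => /andP[h1 h2]; exact: kf.
Qed.

(** Induction on the real line: the supremum of the points up to which [P] holds satisfies [P] by
    the closedness clause and cannot lie below [b] by the openness clause. *)
Lemma interval_ind (P : R -> Prop) a b : a <= b -> P a ->
  (forall x, a <= x -> x < b -> P x -> exists2 e : R, 0 < e & forall y, x <= y -> y <= x + e -> y <= b -> P y) ->
  (forall x, a < x -> x <= b -> (forall y, a <= y -> y < x -> P y) -> P x) ->
  forall x, a <= x -> x <= b -> P x.
Proof.
move=> ab Pa Popen Pclosed x0 ax0 x0b.
pose S := [set x | a <= x <= b /\ forall y, a <= y -> y <= x -> P y].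
have Sa : S a by split; [rewrite lexx|move=> y h1 h2; have -> : y = a by lin].
have hS : has_sup S by split; [exists a|exists b => x [/andP[]]].
pose s := sup S.
have as_ : a <= s by apply: sup_upper_bound.
have sb : s <= b by apply: ge_sup; [exists a|move=> x [/andP[]]].
have Pbelow y : a <= y -> y < s -> P y.
  move=> ay ys; have h : 0 < s - y by lin.
  by have [z [_ Sz] yz] := sup_adherent h hS; apply: Sz => //; move: yz; rewrite -/s => yz; lin.
have Ps : P s.
  have [->//|sa] := eqVneq s a.
  by apply: Pclosed => //; rewrite lt_neqAle eq_sym sa.
have Pall y : a <= y -> y <= s -> P y.
  by move=> ay; rewrite le_eqVlt => /predU1P[->//|]; exact: Pbelow.
have sbE : s = b.
  apply/eqP; rewrite eq_le sb leNgt; apply/negP => sb'.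
  have [e e0 Pe] := Popen s as_ sb' Ps.
  pose t := Num.min (s + e) b.
  have St : S t.
    split; first by rewrite /t le_min ge_min lexx orbT; apply/andP; split => //; lin.
    move=> y ay; rewrite le_min => /andP[ys yb].
    by case: (leP y s) => h; [exact: Pall|apply: Pe => //; exact: ltW].
  have : t <= s by apply: sup_upper_bound.
  by rewrite /t ge_min => /orP[]; lin.
by apply: Pall => //; rewrite sbE.
Qed.

(* The equation with [T = 1 / lambda], in terms of [p = T * sigma]; the last two
   clauses express that [sigma] is a selection of [sgn u_x]. *)
Definition sol a b T w u p :=
  [/\ u a = w a /\ u b = w b,
    forall x, a <= x -> x <= b -> `|p x| <= T,
    forall x y, a <= x -> x <= y -> y <= b -> p y - p x = \int[mu]_(t in `[x, y]) (u t - w t),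
    forall x y, a <= x -> x <= y -> y <= b -> (forall z, x <= z -> z <= y -> - T < p z) -> u x <= u y
  & forall x y, a <= x -> x <= y -> y <= b -> (forall z, x <= z -> z <= y -> p z < T) -> u y <= u x].

Lemma RintegralN x y f : ucont_on x y f ->
  \int[mu]_(t in `[x, y]) (- f t) = - \int[mu]_(t in `[x, y]) f t.
Proof.
move=> cf; rewrite -mulN1r -RintegralZl//; last exact: ucont_on_integrable.
by apply: eq_Rintegral => t _; rewrite mulN1r.
Qed.

Lemma sol_opp a b T w u p : ucont_on a b w -> ucont_on a b u ->
  sol a b T w u p -> sol a b T (fun x => - w x) (fun x => - u x) (fun x => - p x).
Proof.
move=> cw cu [[ua ub] pT pE up down]; split.
- by rewrite ua ub.
- by move=> x h1 h2; rewrite normrN; exact: pT.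
- move=> x y h1 h2 h3; rewrite -opprD pE// -RintegralN.
    by apply: eq_Rintegral => t _; rewrite opprD.
  by apply: ucont_on_sub (ucont_onB cu cw).
- by move=> x y h1 h2 h3 h; rewrite lerN2; apply: down => // z h4 h5; have := h z h4 h5; lin.
- by move=> x y h1 h2 h3 h; rewrite lerN2; apply: up => // z h4 h5; have := h z h4 h5; lin.
Qed.

Lemma ucont_on_local a b f x (k : R) : ucont_on a b f -> a <= x -> x <= b -> k < f x ->
  exists2 e : R, 0 < e & forall y, a <= y -> y <= b -> `|x - y| <= e -> k < f y.
Proof.
move=> cf ax xb kf; have [d d0 fd] := cf (f x - k) ltac:(lin).
exists (d / 2); first lin.
move=> y ay yb xy; have : `|f x - f y| < f x - k by apply: fd => //; lin.
by rewrite ltr_norml => /andP[]; lin.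
Qed.

Lemma sol_ucont a b T w u p : ucont_on a b w -> ucont_on a b u ->
  sol a b T w u p -> ucont_on a b p.
Proof.
move=> cw cu [_ _ pE _ _] e e0.
have cuw := ucont_onB cu cw.
have [M M0 uwM] := ucont_on_bounded cuw.
exists (e / M); first by rewrite divr_gt0.
move=> x y; wlog xy : x y / x <= y.
  by move=> h; case: (leP x y) => [/h//|/ltW/h h'] *; rewrite distrC h'// distrC.
move=> ax xb ay yb; rewrite distrC ger0_norm ?subr_ge0// ltr_pdivlMr// => h.
have cxy : ucont_on x y (fun t => u t - w t) by apply: ucont_on_sub cuw.
rewrite distrC pE// ltr_norml; apply/andP; split.
  apply: (@lt_le_trans _ _ (- M * (y - x))); first lin.
  apply: Rint_ge => // t h1 h2; have := uwM t (le_trans ax h1) (le_trans h2 yb).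
  by rewrite ler_norml => /andP[].
apply: (@le_lt_trans _ _ (M * (y - x))); last lin.
apply: Rint_le => // t h1 h2; have := uwM t (le_trans ax h1) (le_trans h2 yb).
by rewrite ler_norml => /andP[].
Qed.

(** An interior [z] with [p z = T] is a maximum of [p], so the derivative [u - w] vanishes there; at
    the end points the boundary condition gives the equality. *)
Lemma sol_contact_pos a b T w u p z : ucont_on a b w -> ucont_on a b u ->
  sol a b T w u p -> a <= z -> z <= b -> p z = T -> u z = w z.
Proof.
move=> cw cu S az zb pz; have [[ua ub] pT pE _ _] := S.
have [->//|za] := eqVneq z a; have [->//|zb'] := eqVneq z b.
have {za}az' : a < z by rewrite lt_neqAle eq_sym za.
have {zb'}zb' : z < b by rewrite lt_neqAle zb'.
have cuw := ucont_onB cu cw.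
apply/eqP; rewrite eq_le; apply/andP; split; rewrite leNgt; apply/negP => h.
- have [|e e0 H] := @ucont_on_local a b _ z ((u z - w z) / 2) cuw az zb; first lin.
  pose y := Num.min (z + e) b.
  have [yz [yb zy]] : y <= z + e /\ y <= b /\ z < y.
    by rewrite /y ge_min lexx ge_min lexx orbT lt_min zb' andbT; split => //; split => //; lin.
  have := pT y ltac:(lin) yb; rewrite ler_norml => /andP[_].
  have := pE z y az (ltW zy) yb.
  have := @Rint_ge (fun t => u t - w t) z y ((u z - w z) / 2) (ltW zy) (ucont_on_sub az yb cuw).
  set I := \int[mu]_(t in _) _ => H1.
  have H2 : (u z - w z) / 2 * (y - z) <= I.
    by apply: H1 => t h1 h2; apply/ltW/H; [lin|lin|rewrite ler0_norm; lin].
  have H3 : 0 < (u z - w z) / 2 * (y - z) by apply: mulr_gt0; lin.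
  lin.
- have [|e e0 H] := @ucont_on_local a b _ z ((w z - u z) / 2) (ucont_onB cw cu) az zb; first lin.
  pose y := Num.max (z - e) a.
  have [yz [yb zy]] : z - e <= y /\ a <= y /\ y < z.
    by rewrite /y le_max lexx le_max lexx orbT gt_max az' andbT; split => //; split => //; lin.
  have := pT y yb ltac:(lin); rewrite ler_norml => /andP[_].
  have := pE y z yb (ltW zy) zb.
  have := @Rint_le (fun t => u t - w t) y z (- ((w z - u z) / 2)) (ltW zy) (ucont_on_sub yb zb cuw).
  set I := \int[mu]_(t in _) _ => H1.
  have H2 : I <= - ((w z - u z) / 2) * (z - y).
    apply: H1 => t h1 h2; have : (w z - u z) / 2 < w t - u t by apply: H; [lin|lin|rewrite ger0_norm; lin].
    lin.
  have H3 : 0 < (w z - u z) / 2 * (z - y) by apply: mulr_gt0; lin.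
  lin.
Qed.

Lemma sol_contact a b T w u p z : ucont_on a b w -> ucont_on a b u ->
  sol a b T w u p -> a <= z -> z <= b -> `|p z| = T -> u z = w z.
Proof.
move=> cw cu S az zb; have [p0|p0] := leP 0 (p z).
  by rewrite ger0_norm//; exact: sol_contact_pos S az zb.
rewrite ltr0_norm// => pz; apply: oppr_inj.
exact: (sol_contact_pos (ucont_onN cw) (ucont_onN cu) (sol_opp cw cu S) az zb pz).
Qed.

(* At a contact point the solution touches the datum. *)
Definition contact a b T p z := [\/ z = a, z = b | `|p z| = T].

Lemma sol_contactP a b T w u p z : ucont_on a b w -> ucont_on a b u ->
  sol a b T w u p -> a <= z -> z <= b -> contact a b T p z -> u z = w z.
Proof.
move=> cw cu S az zb; have [[ua ub] _ _ _ _] := S.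
by case=> [->//|->//|]; exact: sol_contact S az zb.
Qed.

Lemma noncontact_local a b T w u p z : ucont_on a b w -> ucont_on a b u ->
  sol a b T w u p -> a <= z -> z <= b -> ~ contact a b T p z ->
  exists2 e : R, 0 < e & forall y, `|z - y| <= e -> [/\ a < y, y < b & `|p y| < T].
Proof.
move=> cw cu S az zb Nz; have cp := sol_ucont cw cu S.
have [_ pT _ _ _] := S.
have az' : a < z by rewrite lt_neqAle az andbT; apply/eqP => E; apply: Nz; constructor 1.
have zb' : z < b by rewrite lt_neqAle zb andbT; apply/eqP => E; apply: Nz; constructor 2.
have pz : `|p z| < T by rewrite lt_neqAle pT// andbT; apply/eqP => E; apply: Nz; constructor 3.
move: (pz); rewrite ltr_norml => /andP[p1 p2].
have [e e0 E1] := ucont_on_local cp az zb p1.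
have p2' : - T < - p z by lin.
have [e' e'0 E2] := ucont_on_local (ucont_onN cp) az zb p2'.
pose m := Num.min (Num.min e e') (Num.min ((z - a) / 2) ((b - z) / 2)).
have m0 : 0 < m by rewrite !lt_min e0 e'0; apply/andP; split => //; apply/andP; split; lin.
have : m <= m by []; rewrite {2}/m !le_min => /andP[/andP[h1 h2] /andP[h3 h4]].
exists m => // y ym.
have [ay yb] : a < y /\ y < b.
  by move: ym; rewrite ler_norml => /andP[]; split; lin.
split => //; rewrite ltr_norml; apply/andP; split.
  by apply: E1; [lin|lin|exact: le_trans ym _].
by have := E2 y (ltW ay) (ltW yb) (le_trans ym h2); lin.
Qed.

Lemma sol_const a b T w u p x y : ucont_on a b u -> sol a b T w u p ->
  a <= x -> x <= y -> y <= b -> (forall z, x <= z -> z <= y -> `|p z| < T) -> u y = u x.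
Proof.
move=> cu [_ _ _ up down] ax xy yb H; apply/eqP; rewrite eq_le; apply/andP; split.
  by apply: down => // z h1 h2; have := H z h1 h2; rewrite ltr_norml => /andP[].
by apply: up => // z h1 h2; have := H z h1 h2; rewrite ltr_norml => /andP[].
Qed.

(** The contact set is closed and contains [b], so the infimum [x'] of its part beyond [x] belongs
    to it. Before [x'] one has [|p| < T], so [u] is constant there, and up to [x'] by continuity. *)
Lemma sol_next a b T w u p x : ucont_on a b w -> ucont_on a b u ->
  sol a b T w u p -> a <= x -> x <= b -> exists x', [/\ x <= x', x' <= b, contact a b T p x',
    (forall y, x <= y -> y < x' -> ~ contact a b T p y) &
    forall y, x <= y -> y <= x' -> u y = u x].
Proof.
move=> cw cu S ax xb.
pose Z := [set z | x <= z <= b /\ contact a b T p z].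
have Zb : Z b by split; [rewrite xb lexx|constructor 2].
have hZ : has_inf Z by split; [exists b|exists x => z [/andP[]]].
pose x' := inf Z.
have xx' : x <= x' by apply: lb_le_inf; [exists b|move=> z [/andP[]]].
have x'b : x' <= b by apply: ge_inf Zb; exists x => z [/andP[]].
have Nc y : x <= y -> y < x' -> ~ contact a b T p y.
  move=> xy yx' cy; have : x' <= y.
    apply: ge_inf; first by exists x => z [/andP[]].
    by split => //; rewrite xy ltW// (lt_le_trans yx').
  by rewrite leNgt yx'.
have cx' : contact a b T p x'.
  apply: contrapT => N.
  have [e e0 E] := noncontact_local cw cu S (le_trans ax xx') x'b N.
  have [z [/andP[xz zb] cz]] := inf_adherent e0 hZ.
  rewrite -/x' => zx'.
  have x'z : x' <= z by apply: ge_inf; [exists x => t [/andP[]]|split; rewrite ?xz].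
  have [h1 h2 h3] := E z ltac:(rewrite ler0_norm; lin).
  by case: cz => h; [move: h1; rewrite h ltxx|move: h2; rewrite h ltxx|move: h3; rewrite h ltxx].
have cst y : x <= y -> y < x' -> u y = u x.
  move=> xy yx'; apply: (sol_const cu S ax xy); first exact: le_trans (ltW yx') x'b.
  move=> z xz zy; have [_ pT _ _ _] := S.
  rewrite lt_neqAle pT ?andbT; [|exact: le_trans ax xz|lin].
  apply/eqP => E; apply: (Nc z xz (le_lt_trans zy yx')); constructor 3 => //.
exists x'; split => // y xy; rewrite le_eqVlt => /predU1P[->|]; last exact: cst.
have [<-//|xnx'] := eqVneq x x'.
have {}xnx' : x < x' by rewrite lt_neqAle xnx'.
apply/eqP; rewrite -subr_eq0 -normr_le0; apply/ler_addgt0Pr => e e0; rewrite add0r.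
have [d d0 ud] := cu e e0.
pose z := Num.max x (x' - d / 2).
have [z1 [z2 z3]] : x <= z /\ x' - d / 2 <= z /\ z < x'.
  by rewrite /z le_max lexx le_max lexx orbT gt_max xnx'; split => //; split => //; lin.
rewrite -(cst z z1 z3); apply/ltW/ud; try lin.
by rewrite ger0_norm; lin.
Qed.

Lemma sol_prev a b T w u p x : ucont_on a b w -> ucont_on a b u ->
  sol a b T w u p -> a <= x -> x <= b -> exists x', [/\ x' <= x, a <= x', contact a b T p x',
    (forall y, x' < y -> y <= x -> ~ contact a b T p y) &
    forall y, x' <= y -> y <= x -> u y = u x].
Proof.
move=> cw cu S ax xb.
pose Z := [set z | a <= z <= x /\ contact a b T p z].
have Za : Z a by split; [rewrite ax lexx|constructor 1].
have hZ : has_sup Z by split; [exists a|exists x => z [/andP[]]].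
pose x' := sup Z.
have xx' : x' <= x by apply: ge_sup; [exists a|move=> z [/andP[]]].
have x'b : a <= x' by apply: sup_upper_bound.
have Nc y : x' < y -> y <= x -> ~ contact a b T p y.
  move=> yx' xy cy; have : y <= x'.
    apply: sup_upper_bound => //.
    by split => //; rewrite xy ltW// (le_lt_trans x'b).
  by rewrite leNgt yx'.
have cx' : contact a b T p x'.
  apply: contrapT => N.
  have [e e0 E] := noncontact_local cw cu S x'b (le_trans xx' xb) N.
  have [z [/andP[az zx] cz]] := sup_adherent e0 hZ.
  rewrite -/x' => zx'.
  have x'z : z <= x' by apply: sup_upper_bound => //; split; rewrite ?az.
  have [h1 h2 h3] := E z ltac:(rewrite ger0_norm; lin).
  by case: cz => h; [move: h1; rewrite h ltxx|move: h2; rewrite h ltxx|move: h3; rewrite h ltxx].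
have cst y : x' < y -> y <= x -> u y = u x.
  move=> x'y yx; apply/esym; apply: (sol_const cu S _ yx xb); first exact: le_trans x'b (ltW x'y).
  move=> z yz zx; have [_ pT _ _ _] := S.
  rewrite lt_neqAle pT ?andbT; [|lin|lin].
  apply/eqP => E; apply: (Nc z (lt_le_trans x'y yz) zx); constructor 3 => //.
exists x'; split => // y; rewrite le_eqVlt => /predU1P[<-|h1 h2]; last exact: cst.
move=> _; have [<-//|xnx'] := eqVneq x' x.
have {}xnx' : x' < x by rewrite lt_neqAle xnx'.
apply/eqP; rewrite -subr_eq0 -normr_le0; apply/ler_addgt0Pr => e e0; rewrite add0r.
have [d d0 ud] := cu e e0.
pose z := Num.min x (x' + d / 2).
have [z1 [z2 z3]] : z <= x /\ z <= x' + d / 2 /\ x' < z.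
  by rewrite /z ge_min lexx ge_min lexx orbT lt_min xnx'; split => //; split => //; lin.
rewrite -(cst z z3 z1); apply/ltW/ud; try lin.
by rewrite ler0_norm; lin.
Qed.

(** [u] is constant from [x] to the next contact point and from the last contact point to [y], and
    it agrees with [w] at both; without a contact point in between, both increments vanish. This is
    how [u] inherits monotonicity, modulus of continuity and absolute continuity from [w]. *)
Lemma sol_clip a b T w u p x y : ucont_on a b w -> ucont_on a b u ->
  sol a b T w u p -> a <= x -> x <= y -> y <= b ->
  exists x' y', [/\ x <= x', x' <= y', y' <= y & u y - u x = w y' - w x'].
Proof.
move=> cw cu S ax xy yb.
have [x' [x1 x2 x3 _ x5]] := sol_next cw cu S ax (le_trans xy yb).
have [y' [y1 y2 y3 y4 y5]] := sol_prev cw cu S (le_trans ax xy) yb.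
have [x'y|yx'] := leP x' y; last first.
  by exists x, x; split => //; rewrite (x5 y)// ?ltW// !subrr.
exists x', y'; split => //.
  by rewrite leNgt; apply/negP => h; exact: (y4 x' h x'y).
rewrite -(sol_contactP cw cu S (le_trans ax x1) x2 x3) (x5 x')//.
by rewrite -(sol_contactP cw cu S y2 (le_trans y1 yb) y3) (y5 y').
Qed.

Lemma sol_increment a b T w u p x y (s : R) : s = 1 \/ s = -1 -> ucont_on a b w -> ucont_on a b u ->
  sol a b T w u p -> a <= x -> x <= y -> y <= b -> smono s w x y ->
  0 <= s * (u y - u x) <= s * (w y - w x).
Proof.
move=> s1 cw cu S ax xy yb mw.
have [x' [y' [h1 h2 h3 ->]]] := sol_clip cw cu S ax xy yb.
have m1 := mw x x' (lexx _) h1 (le_trans h2 h3).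
have m2 := mw x' y' h1 h2 h3.
have m3 := mw y' y (le_trans h1 h2) h3 (lexx _).
by rewrite !mulrBr; apply/andP; split; lin.
Qed.

Lemma sol_smono a b T w u p x y (s : R) : s = 1 \/ s = -1 -> ucont_on a b w -> ucont_on a b u ->
  sol a b T w u p -> a <= x -> y <= b -> smono s w x y -> smono s u x y.
Proof.
move=> s1 cw cu S ax yb mw x' y' h1 h2 h3.
have mw' : smono s w x' y' by move=> t t' k1 k2 k3; apply: mw; lin.
have /andP[] := sol_increment s1 cw cu S (le_trans ax h1) h2 (le_trans h3 yb) mw'.
by rewrite mulrBr; lin.
Qed.

Lemma sol_modulus a b T w u p (e d : R) : ucont_on a b w -> ucont_on a b u -> sol a b T w u p ->
  (forall x y, a <= x -> x <= b -> a <= y -> y <= b -> `|x - y| < d -> `|w x - w y| < e) ->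
  forall x y, a <= x -> x <= b -> a <= y -> y <= b -> `|x - y| < d -> `|u x - u y| < e.
Proof.
move=> cw cu S wd x y; wlog xy : x y / x <= y.
  by move=> h; case: (leP x y) => [/h//|/ltW/h h'] *; rewrite distrC h'// distrC.
move=> ax xb ay yb; rewrite distrC ger0_norm ?subr_ge0// => h.
have [x' [y' [h1 h2 h3 E]]] := sol_clip cw cu S ax xy yb.
rewrite distrC E; apply: wd; try lin.
by rewrite ger0_norm; lin.
Qed.

(** Each interval of a family is replaced by the smaller one of [sol_clip]: the family stays
    disjoint and its total length does not grow. *)
Lemma sol_abs_continuous T w u p : ucont_on 0 1 w -> ucont_on 0 1 u -> sol 0 1 T w u p ->
  abs_continuous w -> abs_continuous u.
Proof.
move=> cw cu S acw e e0; have [d d0 wd] := acw e e0; exists d => // n s t st tr sd.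
have clip i : exists xy : R * R, [/\ s i <= xy.1, xy.1 <= xy.2, xy.2 <= t i &
    u (t i) - u (s i) = w xy.2 - w xy.1].
  have [h1 [h2 h3]] := st i.
  by have [x' [y' [k1 k2 k3 k4]]] := sol_clip cw cu S h1 h2 h3; exists (x', y').
have [f fP] := choice clip.
rewrite (eq_bigr (fun i => `|w (f i).2 - w (f i).1|)); last first.
  by move=> i _; have [_ _ _ ->] := fP i.
apply: wd.
- move=> i; have [k1 k2 k3 _] := fP i; have [h1 [h2 h3]] := st i.
  by split; [exact: le_trans h1 k1|split => //; exact: le_trans k3 h3].
- apply/trivIsetP => i j _ _ ij; apply/seteqP; split => // x [] /=.
  rewrite !in_itv/= => /andP[h1 h2] /andP[h3 h4].
  have [k1 k2 k3 _] := fP i; have [l1 l2 l3 _] := fP j.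
  move/trivIsetP : tr => /(_ i j I I ij)/seteqP[D _]; apply: (D x).
  by split => /=; rewrite in_itv/=; apply/andP; split;
    [exact: le_lt_trans k1 h1|exact: lt_le_trans h2 k3|exact: le_lt_trans l1 h3|exact: lt_le_trans h4 l3].
- apply: le_lt_trans sd; apply: ler_sum => i _.
  by have [k1 k2 k3 _] := fP i; lin.
Qed.

Lemma sol_right_local a b T w u p x : ucont_on a b w -> ucont_on a b u -> sol a b T w u p ->
  a <= x -> x <= b -> - T < p x ->
  exists2 e : R, 0 < e & forall y z, a <= y -> y <= z -> z <= b ->
    x - e <= y -> z <= x + e -> u y <= u z.
Proof.
move=> cw cu S ax xb px; have [_ _ _ up _] := S.
have [e e0 E] := ucont_on_local (sol_ucont cw cu S) ax xb px.
exists e => // y z h1 h2 h3 h4 h5; apply: up => // t t1 t2.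
by apply: E; [lin|lin|rewrite ler_norml; apply/andP; split; lin].
Qed.

Lemma locally_increasing a b f : ucont_on a b f ->
  (forall x, a <= x -> x < b -> exists2 e : R, 0 < e & forall y, x <= y -> y <= x + e -> y <= b -> f x <= f y) ->
  forall x, a <= x -> x <= b -> f a <= f x.
Proof.
move=> cf H x ax xb; have ab := le_trans ax xb.
apply: (@interval_ind (fun y => f a <= f y) a b ab _ _ _ x ax xb) => //.
  move=> y ay yb fy; have [e e0 E] := H y ay yb.
  by exists e => // z h1 h2 h3; apply: le_trans fy (E z h1 h2 h3).
move=> y ay yb fy; apply/ler_addgt0Pr => e e0; have [d d0 fd] := cf e e0.
pose z := Num.max a (y - d / 2).
have [z1 [z2 z3]] : a <= z /\ y - d / 2 <= z /\ z < y.
  by rewrite /z le_max lexx le_max lexx orbT gt_max ay; split => //; split => //; lin.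
have h : `|y - z| < d by rewrite ger0_norm; lin.
have := fd y z (ltW ay) yb z1 ltac:(lin) h; have := fy z z1 z3.
by rewrite ltr_norml => ? /andP[]; lin.
Qed.

(** At each point either [p1 > - T1], and then [u] is nondecreasing nearby and [v] inherits this
    from its datum [u], or [p2 > - T2], and then [v] is nondecreasing nearby directly. *)
Lemma sol_comp_up a b T1 T2 w u v p1 p2 : ucont_on a b w -> ucont_on a b u -> ucont_on a b v ->
  sol a b T1 w u p1 -> sol a b T2 u v p2 ->
  forall x y, a <= x -> x <= y -> y <= b ->
    (forall z, x <= z -> z <= y -> - (T1 + T2) < p1 z + p2 z) -> v x <= v y.
Proof.
move=> cw cu cv S1 S2 x y ax xy yb H.
apply: (@locally_increasing x y v) => //; first exact: ucont_on_sub cv.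
move=> z xz zy; have az := le_trans ax xz; have zb := le_trans (ltW zy) yb.
have [h|h] := ltP (- T1) (p1 z).
  have [e e0 E] := sol_right_local cw cu S1 az zb h.
  exists e => // t zt te ty; have tb := le_trans ty yb.
  have m : smono 1 u z t by move=> r r' h1 h2 h3; rewrite !mul1r; apply: E; lin.
  by have /andP[] := sol_increment (or_introl erefl) cu cv S2 az zt tb m; rewrite mul1r subr_ge0.
have h2 : - T2 < p2 z by have := H z xz (ltW zy); lin.
have [e e0 E] := sol_right_local cu cv S2 az zb h2.
by exists e => // t zt te ty; apply: E; lin.
Qed.

Lemma sol_comp a b T1 T2 w u v p1 p2 : ucont_on a b w -> ucont_on a b u -> ucont_on a b v ->
  sol a b T1 w u p1 -> sol a b T2 u v p2 ->
  sol a b (T1 + T2) w v (fun x => p1 x + p2 x).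
Proof.
move=> cw cu cv S1 S2.
have [[ua ub] p1T p1E _ _] := S1; have [[va vb] p2T p2E _ _] := S2.
split.
- by rewrite va vb.
- by move=> x h1 h2; apply: (le_trans (ler_normD _ _)); apply: lerD; [exact: p1T|exact: p2T].
- move=> x y h1 h2 h3; rewrite opprD addrACA p1E// p2E// -RintegralD//.
  + by apply: eq_Rintegral => t _; ring.
  + by apply: ucont_on_integrable; apply: ucont_on_sub (ucont_onB cu cw).
  + by apply: ucont_on_integrable; apply: ucont_on_sub (ucont_onB cv cu).
- exact: sol_comp_up S1 S2.
- move=> x y h1 h2 h3 H; rewrite -lerN2.
  apply: (sol_comp_up (ucont_onN cw) (ucont_onN cu) (ucont_onN cv) (sol_opp cw cu S1) (sol_opp cu cv S2)) => //.
  by move=> z h4 h5; have := H z h4 h5; lin.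
Qed.

Lemma interval_ind_left (P : R -> Prop) a b : a <= b -> P b ->
  (forall x, a < x -> x <= b -> P x -> exists2 e : R, 0 < e & forall y, y <= x -> x - e <= y -> a <= y -> P y) ->
  (forall x, a <= x -> x < b -> (forall y, x < y -> y <= b -> P y) -> P x) ->
  forall x, a <= x -> x <= b -> P x.
Proof.
move=> ab Pb Po Pc x ax xb.
have -> : x = a + b - (a + b - x) by ring.
apply: (@interval_ind (fun y => P (a + b - y)) a b ab) => [|||//|//]; try lin.
- by have -> : a + b - a = b by ring.
- move=> y ay yb Py; have [e e0 E] := Po (a + b - y) ltac:(lin) ltac:(lin) Py.
  by exists e => // z h1 h2 h3; apply: E; lin.
- move=> y ay yb H; apply: Pc; [lin|lin|move=> z h1 h2].
  have -> : z = a + b - (a + b - z) by ring.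
  by apply: H; lin.
Qed.

Lemma locally_constant_propagates a b q z : ucont_on a b q -> a <= z -> z <= b ->
  (forall x, a <= x -> x <= b -> q x = q z ->
     exists2 e : R, 0 < e & forall y, a <= y -> y <= b -> x - e <= y -> y <= x + e -> q y = q z) ->
  forall x, a <= x -> x <= b -> q x = q z.
Proof.
move=> cq az zb local.
have cl x : a <= x -> x <= b -> (forall e : R, 0 < e -> exists y, [/\ a <= y, y <= b, `|x - y| < e & q y = q z]) -> q x = q z.
  move=> ax xb H; apply/eqP; rewrite -subr_eq0 -normr_le0; apply/ler_addgt0Pr => e e0; rewrite add0r.
  have [d d0 qd] := cq e e0; have [y [h1 h2 h3 <-]] := H d d0.
  exact/ltW/qd.
have right_ x : z <= x -> x <= b -> q x = q z.
  apply: (@interval_ind (fun x => q x = q z) z b zb) => //.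
    move=> y h1 h2 h3; have [e e0 E] := local y (le_trans az h1) (ltW h2) h3.
    by exists e => // t k1 k2 k3; apply: E; lin.
  move=> y h1 h2 h3; apply: cl; [lin|lin|move=> e e0].
  have [t [z1 [z2 z3]]] : exists t, z <= t /\ y - e / 2 <= t /\ t < y.
    by exists (Num.max z (y - e / 2)); rewrite le_max lexx le_max lexx orbT gt_max h1; split => //; split => //; lin.
  by exists t; split; [lin|lin|rewrite ger0_norm; lin|exact: h3].
have left_ x : a <= x -> x <= z -> q x = q z.
  apply: (@interval_ind_left (fun x => q x = q z) a z az) => //.
    move=> y h1 h2 h3; have [e e0 E] := local y (ltW h1) (le_trans h2 zb) h3.
    by exists e => // t k1 k2 k3; apply: E; lin.
  move=> y h1 h2 h3; apply: cl; [lin|lin|move=> e e0].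
  have [t [z1 [z2 z3]]] : exists t, t <= z /\ t <= y + e / 2 /\ y < t.
    by exists (Num.min z (y + e / 2)); rewrite ge_min lexx ge_min lexx orbT lt_min h2; split => //; split => //; lin.
  by exists t; split; [lin|lin|rewrite ler0_norm; lin|exact: h3].
move=> x ax xb; have [h|/ltW h] := leP z x; [exact: right_|exact: left_].
Qed.

(* Near a maximum of the primitive [q] of [D], where [D] is increasing, [D]
   vanishes at the maximum, hence [q] is also nondecreasing away from it. *)
Lemma max_of_primitive a b (D : R -> R) q x (e : R) : ucont_on a b D -> 0 < e ->
  a <= x -> x <= b ->
  (forall y t, a <= y -> y <= t -> t <= b -> q t - q y = \int[mu]_(r in `[y, t]) D r) ->
  (forall y t, a <= y -> y <= t -> t <= b -> x - e <= y -> t <= x + e -> D y <= D t) ->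
  (x = a -> D x = 0) -> (x = b -> D x = 0) ->
  (forall y, a <= y -> y <= b -> q y <= q x) ->
  forall y, a <= y -> y <= b -> x - e <= y -> y <= x + e -> q y = q x.
Proof.
move=> cD e0 ax xb qE Dm Da Db qmax.
have D0 : D x = 0.
  have [/Da//|xa] := eqVneq x a; have [/Db//|xb'] := eqVneq x b.
  have {}xa : a < x by rewrite lt_neqAle eq_sym xa.
  have {}xb' : x < b by rewrite lt_neqAle xb'.
  apply/eqP; rewrite eq_le; apply/andP; split; rewrite leNgt; apply/negP => Dx.
    have [y [y1 [y2 y3]]] : exists y, y <= x + e /\ y <= b /\ x < y.
      by exists (Num.min (x + e) b); rewrite ge_min lexx ge_min lexx orbT lt_min xb' andbT; split => //; split => //; lin.
    have xe : x - e <= x by lin.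
    have := @Rint_ge _ x y (D x) (ltW y3) (ucont_on_sub ax y2 cD)
      (fun t h1 h2 => Dm x t ax h1 (le_trans h2 y2) xe (le_trans h2 y1)).
    rewrite -(qE x y ax (ltW y3) y2); have := qmax y (le_trans ax (ltW y3)) y2.
    have : 0 < D x * (y - x) by rewrite mulr_gt0// subr_gt0.
    by lin.
  have [y [y1 [y2 y3]]] : exists y, x - e <= y /\ a <= y /\ y < x.
    by exists (Num.max (x - e) a); rewrite le_max lexx le_max lexx orbT gt_max xa andbT; split => //; split => //; lin.
  have xe : x <= x + e by lin.
  have := @Rint_le _ y x (D x) (ltW y3) (ucont_on_sub y2 xb cD)
    (fun t h1 h2 => Dm t x (le_trans y2 h1) h2 xb (le_trans y1 h1) xe).
  rewrite -(qE y x y2 (ltW y3) xb); have := qmax y y2 (le_trans (ltW y3) xb).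
  have : D x * (x - y) < 0 by rewrite nmulr_rlt0// subr_gt0.
  by lin.
move=> y ay yb y1 y2; apply/eqP; rewrite eq_le qmax//= -subr_ge0.
have xe : x <= x + e by lin.
have ex : x - e <= x by lin.
have [xy|/ltW yx] := leP x y.
  rewrite (qE x y ax xy yb) -(mul0r (y - x)); apply: Rint_ge => //; first exact: ucont_on_sub cD.
  by move=> t h1 h2; rewrite -D0; exact: (Dm x t ax h1 (le_trans h2 yb) ex (le_trans h2 y2)).
rewrite -opprB oppr_ge0 (qE y x ay yx xb) -(mul0r (x - y)); apply: Rint_le => //; first exact: ucont_on_sub cD.
by move=> t h1 h2; rewrite -D0; exact: (Dm t x (le_trans ay h1) h2 xb (le_trans y1 h1) xe).
Qed.

(** If [p' - p] exceeds [T' - T] at its maximum, then near it [p' > - T'] and [p < T], so [u' - u]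
    is nondecreasing and [max_of_primitive] makes [p' - p] constant nearby, hence on [[a, b]]. Then
    [u'] is nondecreasing and [u] nonincreasing with common end values, so both are constant. *)
Lemma sol_compare_max a b T T' w u u' p p' : a <= b ->
  ucont_on a b w -> ucont_on a b u -> ucont_on a b u' ->
  sol a b T w u p -> sol a b T' w u' p' -> T <= T' ->
  (forall x, a <= x -> x <= b -> p' x - p x <= T' - T) \/
  (forall x, a <= x -> x <= b -> u x = u a /\ u' x = u' a).
Proof.
move=> ab cw cu cu' S S' TT.
have cq : ucont_on a b (fun x => p' x - p x) := ucont_onB (sol_ucont cw cu' S') (sol_ucont cw cu S).
have [z zab zmax] := EVT_max ab (ucont_on_within ab cq).
move: zab; rewrite in_itv/= => /andP[az zb].
have {}zmax x : a <= x -> x <= b -> p' x - p x <= p' z - p z.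
  by move=> ax xb; apply: zmax; rewrite in_itv/= ax.
have [h|h] := leP (p' z - p z) (T' - T).
  by left => x ax xb; apply: le_trans (zmax x ax xb) h.
right.
have [[ua ub] pT pE up down] := S; have [[ua' ub'] pT' pE' up' down'] := S'.
(* The bound on [p] follows from [p' <= T'], the bound on [p'] from [- T <= p] together with
   [T <= T']. *)
have bounds x : a <= x -> x <= b -> p' x - p x = p' z - p z -> - T' < p' x /\ p x < T.
  move=> ax xb qx; have := pT x ax xb; have := pT' x ax xb; rewrite !ler_norml => /andP[h1 h2] /andP[h3 h4].
  by rewrite -qx in h; split; lin.
have qz x : a <= x -> x <= b -> p' x - p x = p' z - p z.
  apply: (@locally_constant_propagates a b (fun x => p' x - p x) z cq az zb) => {}x ax xb qx.
  have [b1 b2] := bounds x ax xb qx.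
  have [e1 e10 E1] := sol_right_local cw cu' S' ax xb b1.
  have b3 : - T < - p x by rewrite ltrN2.
  have [e2 e20 E2] := sol_right_local (ucont_onN cw) (ucont_onN cu) (sol_opp cw cu S) ax xb b3.
  have [e [ee1 [ee2 e0]]] : exists e, e <= e1 /\ e <= e2 /\ 0 < e.
    by exists (Num.min e1 e2); rewrite !ge_min !lexx orbT lt_min e10 e20.
  exists e => // y ay yb y1 y2; rewrite -qx.
  apply: (@max_of_primitive a b (fun t => u' t - u t) (fun x => p' x - p x) x e (ucont_onB cu' cu)) => //.
  - move=> y' t h1 h2 h3 /=.
    have -> : p' t - p t - (p' y' - p y') = (p' t - p' y') - (p t - p y') by ring.
    rewrite pE// pE'// -RintegralB//.
    + by apply: eq_Rintegral => r _; ring.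
    + by apply: ucont_on_integrable; apply: ucont_on_sub (ucont_onB cu' cw).
    + by apply: ucont_on_integrable; apply: ucont_on_sub (ucont_onB cu cw).
  - move=> y' t h1 h2 h3 h4 h5 /=.
    have k1 : x - e1 <= y' by lin.
    have k2 : t <= x + e1 by lin.
    have k3 : x - e2 <= y' by lin.
    have k4 : t <= x + e2 by lin.
    by have := E1 y' t h1 h2 h3 k1 k2; have := E2 y' t h1 h2 h3 k3 k4; lin.
  - by move=> ->; rewrite ua ua' subrr.
  - by move=> ->; rewrite ub ub' subrr.
  - by move=> y' h1 h2; rewrite qx; exact: zmax.
have upD x y : a <= x -> x <= y -> y <= b -> u' x <= u' y /\ u y <= u x.
  move=> ax xy yb; split.
    apply: up' => // t h1 h2; have at_ := le_trans ax h1; have tb := le_trans h2 yb.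
    by have [] := bounds t at_ tb (qz t at_ tb).
  apply: down => // t h1 h2; have at_ := le_trans ax h1; have tb := le_trans h2 yb.
  by have [] := bounds t at_ tb (qz t at_ tb).
move=> x ax xb.
have [h1 h2] := upD a x (lexx _) ax xb; have [h3 h4] := upD x b ax xb (lexx _).
rewrite ua' ub' in h1 h3; rewrite ua ub in h2 h4.
have E : w a = w b by apply/eqP; rewrite eq_le (le_trans h1 h3) (le_trans h4 h2).
by rewrite ua ua'; split; apply/eqP; rewrite eq_le ?h1 ?h2 ?E ?h3 ?h4 ?andbT //= -?E.
Qed.

End mild.

(** * Comparison, uniqueness, gluing, and the cut of a single extremum *)

Section existence.
Context {R : realType}.
Notation mu := (@lebesgue_measure R).
Notation ucont := (ucont_on 0 1).
Implicit Types (f g w u v p q : R -> R) (a b c d x y z T : R).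

Lemma Rint0_eq0 a b f : a < b -> ucont_on a b f ->
  (forall x y, a <= x -> x <= y -> y <= b -> \int[mu]_(t in `[x, y]) f t = 0) ->
  forall x, a <= x -> x <= b -> f x = 0.
Proof.
move=> ab.
have H g : ucont_on a b g ->
    (forall x y, a <= x -> x <= y -> y <= b -> \int[mu]_(t in `[x, y]) g t = 0) ->
    forall x, a <= x -> x <= b -> g x <= 0.
  move=> cg g0 x ax xb; rewrite leNgt; apply/negP => gx.
  have [|e e0 E] := @ucont_on_local _ a b g x (g x / 2) cg ax xb; first lin.
  pose y := Num.max a (x - e); pose z := Num.min b (x + e).
  have [y1 [y2 y3]] : a <= y /\ x - e <= y /\ y <= x.
    by rewrite /y le_max lexx le_max lexx orbT ge_max ax; split => //; split => //; lin.
  have [z1 [z2 z3]] : z <= b /\ z <= x + e /\ x <= z.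
    by rewrite /z ge_min lexx ge_min lexx orbT le_min xb; split => //; split => //; lin.
  have yz : y < z.
    by rewrite /y /z gt_max !lt_min ab; apply/andP; split; [apply/andP; split|]; lin.
  have := @Rint_ge _ g y z (g x / 2) (ltW yz) (ucont_on_sub y1 z1 cg).
  rewrite g0 ?(ltW yz)// => h.
  have : 0 < g x / 2 * (z - y) by apply: mulr_gt0; lin.
  rewrite ltNge h// => t h1 h2; apply/ltW/E; [lin|lin|].
  by rewrite ler_norml; apply/andP; split; lin.
move=> cf f0 x ax xb; apply/eqP; rewrite eq_le (H f)//= -oppr_le0.
apply: (H (fun x => - f x)) => //; first exact: ucont_onN.
move=> y z h1 h2 h3; rewrite RintegralN ?f0 ?oppr0//.
exact: ucont_on_sub cf.
Qed.

(** The second alternative is unavoidable: if [w] is constant, then [u = w] with every constant [p]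
    in [[- T, T]], so dual variables for the same parameter may be [2 T] apart. *)
Lemma sol_compare a b T T' w u u' p p' : a <= b ->
  ucont_on a b w -> ucont_on a b u -> ucont_on a b u' ->
  sol a b T w u p -> sol a b T' w u' p' -> T <= T' ->
  (forall x, a <= x -> x <= b -> `|p' x - p x| <= T' - T) \/
  (forall x, a <= x -> x <= b -> u x = u a /\ u' x = u' a).
Proof.
move=> ab cw cu cu' S S' TT.
have [h1|] := sol_compare_max ab cw cu cu' S S' TT; last by right.
have [h2|h2] := sol_compare_max ab (ucont_onN cw) (ucont_onN cu) (ucont_onN cu')
  (sol_opp cw cu S) (sol_opp cw cu' S') TT; last first.
  by right => x ax xb; have [e1 e2] := h2 x ax xb; split; exact: oppr_inj.
left => x ax xb; rewrite ler_norml; have := h1 x ax xb; have := h2 x ax xb.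
by move=> *; apply/andP; split; lin.
Qed.

(** For equal parameters the comparison gives [p = p'], so [u - u'] has integral 0 over every
    subinterval; in the exceptional case both are constant with the same end value. *)
Lemma sol_unique a b T w u u' p p' : a <= b ->
  ucont_on a b w -> ucont_on a b u -> ucont_on a b u' ->
  sol a b T w u p -> sol a b T w u' p' -> forall x, a <= x -> x <= b -> u x = u' x.
Proof.
move=> ab cw cu cu' S S' x ax xb.
have [[ua ub] _ pE _ _] := S; have [[ua' ub'] _ pE' _ _] := S'.
have [h|h] := sol_compare ab cw cu cu' S S' (lexx T); last first.
  by have [-> ->] := h x ax xb; rewrite ua ua'.
have [E|nab] := eqVneq a b; first by have -> : x = a; [apply/eqP; rewrite eq_le ax E xb|rewrite ua ua'].
have ab' : a < b by rewrite lt_neqAle nab.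
apply/eqP; rewrite -subr_eq0; apply/eqP.
apply: (@Rint0_eq0 a b (fun t => u t - u' t)) => //; first exact: ucont_onB.
move=> y z h1 h2 h3.
have qq t : a <= t -> t <= b -> p' t = p t.
  move=> t1 t2; have := h t t1 t2; rewrite subrr normr_le0 subr_eq0 => /eqP.
  by [].
transitivity (\int[mu]_(t in `[y, z]) ((u t - w t) - (u' t - w t))).
  by apply: eq_Rintegral => t _; ring.
rewrite RintegralB//.
- rewrite -pE// -pE'//; rewrite !qq; [ring|lin..].
- by apply: ucont_on_integrable; apply: ucont_on_sub (ucont_onB cu cw).
- by apply: ucont_on_integrable; apply: ucont_on_sub (ucont_onB cu' cw).
Qed.

Lemma ucont_on_glue a c b f : ucont_on a c f -> ucont_on c b f -> ucont_on a b f.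
Proof.
move=> c1 c2 e e0; have e20 : 0 < e / 2 by lin.
have [d1 d10 f1] := c1 _ e20; have [d2 d20 f2] := c2 _ e20.
exists (Num.min d1 d2); first by rewrite lt_min d10.
move=> x y; wlog xy : x y / x <= y.
  by move=> h; case: (leP x y) => [/h//|/ltW/h h'] *; rewrite distrC h'// distrC.
move=> ax xb ay yb; rewrite lt_min distrC ger0_norm ?subr_ge0// => /andP[h1 h2].
have dist (u v : R) : u <= v -> `|u - v| = v - u by move=> uv; rewrite distrC ger0_norm// subr_ge0.
have [yc|cy] := leP y c.
  by have := f1 x y ax ltac:(lin) ay yc; rewrite dist// => /(_ h1); lin.
have [cx|xc] := leP c x.
  by have := f2 x y cx xb ltac:(lin) yb; rewrite dist// => /(_ h2); lin.
have -> : f x - f y = (f x - f c) + (f c - f y) by ring.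
apply: (le_lt_trans (ler_normD _ _)); rewrite (splitr e); apply: ltrD.
  by apply: f1; [lin|lin|lin|lin|rewrite dist; lin].
by apply: f2; [lin|lin|lin|lin|rewrite dist; lin].
Qed.

Lemma eq_ucont_on a b f g : (forall x, a <= x -> x <= b -> f x = g x) ->
  ucont_on a b f -> ucont_on a b g.
Proof.
move=> fg cf e e0; have [d d0 fd] := cf e e0; exists d => // x y h1 h2 h3 h4 h5.
by rewrite -!fg//; exact: fd.
Qed.

Lemma sol_ext a b T w u v p q : (forall x, a <= x -> x <= b -> u x = v x) ->
  (forall x, a <= x -> x <= b -> p x = q x) -> a <= b ->
  sol a b T w u p -> sol a b T w v q.
Proof.
move=> uv pq ab [[ua ub] pT pE up down]; split.
- by rewrite -!uv.
- by move=> x h1 h2; rewrite -pq//; exact: pT.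
- move=> x y h1 h2 h3; rewrite -!pq ?pE//; [|lin|lin].
  apply: eq_Rintegral => t; rewrite inE/= in_itv/= => /andP[t1 t2].
  by rewrite uv//; lin.
- move=> x y h1 h2 h3 h; rewrite -!uv; [|lin..]; apply: up => // z z1 z2.
  by rewrite pq; [exact: h|lin|lin].
- move=> x y h1 h2 h3 h; rewrite -!uv; [|lin..]; apply: down => // z z1 z2.
  by rewrite pq; [exact: h|lin|lin].
Qed.

Lemma sol_glue a c b T w u p : a <= c -> c <= b -> ucont_on a b w -> ucont_on a b u ->
  sol a c T w u p -> sol c b T w u p -> sol a b T w u p.
Proof.
move=> ac cb cw cu [[ua uc] pT1 pE1 up1 down1] [[_ ub] pT2 pE2 up2 down2].
have pT x : a <= x -> x <= b -> `|p x| <= T.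
  by move=> h1 h2; case: (leP x c) => h; [exact: pT1|apply: pT2 => //; exact: ltW].
split => //.
- move=> x y ax xy yb; have [yc|/ltW cy] := leP y c; first exact: pE1.
  have [cx|/ltW xc] := leP c x; first exact: pE2.
  rewrite (@Rintegral_itvD _ _ x c y)//; last first.
    by apply: ucont_on_integrable; apply: ucont_on_sub (ucont_onB cu cw).
  by rewrite -pE1// -pE2//; ring.
- move=> x y ax xy yb h; have [yc|/ltW cy] := leP y c; first exact: up1.
  have [cx|/ltW xc] := leP c x; first exact: up2.
  apply: (@le_trans _ _ (u c)).
    by apply: up1 => // z h1 h2; apply: h => //; lin.
  by apply: up2 => // z h1 h2; apply: h => //; lin.
- move=> x y ax xy yb h; have [yc|/ltW cy] := leP y c; first exact: down1.
  have [cx|/ltW xc] := leP c x; first exact: down2.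
  apply: (@le_trans _ _ (u c)).
    by apply: down2 => // z h1 h2; apply: h => //; lin.
  by apply: down1 => // z h1 h2; apply: h => //; lin.
Qed.

(** With [p] constantly equal to [s * T], one of the two monotonicity clauses is void and the other
    is the monotonicity of [w]. *)
Lemma sol_smono_id a b T w (s : R) : s = 1 \/ s = -1 -> 0 <= T -> smono s w a b ->
  sol a b T w w (fun=> s * T).
Proof.
move=> s1 T0 mw; split => //.
- move=> x _ _; rewrite normrM (ger0_norm T0).
  by case: s1 => ->; rewrite ?normrN normr1 mul1r.
- move=> x y _ xy _; rewrite subrr; transitivity (\int[mu]_(t in `[x, y]) (0 : R)).
    by rewrite Rint_cst// mul0r.
  by apply: eq_Rintegral => t _; rewrite subrr.
- move=> x y ax xy yb h; have := h x (lexx _) xy.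
  by case: s1 mw => -> mw; [have := mw x y ax xy yb; rewrite !mul1r|rewrite mulN1r ltxx].
- move=> x y ax xy yb h; have := h x (lexx _) xy.
  by case: s1 mw => -> mw; [rewrite mul1r ltxx|have := mw x y ax xy yb; rewrite !mulN1r lerN2].
Qed.

Definition excess w c x := Num.max (w x - c) 0.

Lemma excess_lip w c c' x : `|excess w c x - excess w c' x| <= `|c - c'|.
Proof.
rewrite /excess; wlog cc : c c' / c <= c'.
  by move=> h; case: (leP c c') => [/h//|/ltW/h]; rewrite distrC [X in _ <= X]distrC.
rewrite [X in _ <= X]distrC [X in _ <= X]ger0_norm ?subr_ge0//.
by rewrite !maxEle; case: ifPn; case: ifPn; rewrite -?ltNge => h1 h2; rewrite ler_norml;
  apply/andP; split; lin.
Qed.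

Lemma ucont_on_excess a b w c : ucont_on a b w -> ucont_on a b (excess w c).
Proof.
move=> cw e e0; have [d d0 wd] := cw e e0; exists d => // x y h1 h2 h3 h4 h5.
apply: le_lt_trans (wd x y h1 h2 h3 h4 h5); rewrite /excess.
wlog xy : x y h1 h2 h3 h4 h5 / w x <= w y.
  by move=> h; case: (leP (w x) (w y)) => [/h|/ltW/h]; [apply|move=> hh; rewrite distrC [X in _ <= X]distrC; apply: hh => //; rewrite distrC].
rewrite [X in _ <= X]distrC [X in _ <= X]ger0_norm ?subr_ge0//.
by rewrite !maxEle; case: ifPn; case: ifPn; rewrite -?ltNge => k1 k2; rewrite ler_norml;
  apply/andP; split; lin.
Qed.

Lemma excess_ge0 w c x : 0 <= excess w c x.
Proof. by rewrite /excess le_max lexx orbT. Qed.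

Lemma excess_int_gt0 a b w c x y : ucont_on a b w -> a <= x -> x <= y -> y <= b ->
  0 < \int[mu]_(t in `[x, y]) excess w c t -> exists z, [/\ x <= z, z <= y & c < w z].
Proof.
move=> cw ax xy yb I0; apply: contrapT => N.
move: I0; rewrite ltNge => /negP; apply.
rewrite -[leRHS](mul0r (y - x)); apply: Rint_le => //.
  by apply: ucont_on_sub (ucont_on_excess c cw).
move=> t h1 h2; rewrite /excess ge_max lexx andbT subr_le0 leNgt; apply/negP => h.
by apply: N; exists t.
Qed.

(** [p] runs from [T] down to [- T], as its derivative is minus the excess, of total mass [T + T].
    If [p y > - T], some excess remains to the right of [y], so the truncated function has not yet
    begun to descend from the level [c]; if [p x < T], some excess lies to the left of [x], so the
    ascent to [c] is over. *)
Lemma sol_cut_pos a t b T w c : a <= t -> t <= b -> ucont_on a b w ->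
  smono 1 w a t -> smono (-1) w t b -> w a <= c -> w b <= c ->
  \int[mu]_(x in `[a, b]) excess w c x = T + T ->
  sol a b T w (fun x => Num.min (w x) c) (fun x => T - \int[mu]_(y in `[a, x]) excess w c y).
Proof.
move=> at_ tb cw m1 m2 wac wbc IT; have ab := le_trans at_ tb.
have ce := ucont_on_excess c cw.
have i0 x y : a <= x -> x <= y -> y <= b -> 0 <= \int[mu]_(t in `[x, y]) excess w c t.
  by move=> _ _ _; apply: Rintegral_ge0 => z _; exact: excess_ge0.
have iD x y z : a <= x -> x <= y -> y <= z -> z <= b -> \int[mu]_(t in `[x, z]) excess w c t =
    \int[mu]_(t in `[x, y]) excess w c t + \int[mu]_(t in `[y, z]) excess w c t.
  move=> h1 h2 h3 h4; apply: Rintegral_itvD => //.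
  by apply: ucont_on_integrable; apply: ucont_on_sub ce.
split.
- by split; apply/min_idPl.
- move=> x ax xb; have := iD a x b (lexx _) ax xb (lexx _); rewrite IT.
  have := i0 a x (lexx _) ax xb; have := i0 x b ax xb (lexx _).
  set I := \int[mu]_(_ in `[a, x]) _; set J := \int[mu]_(_ in `[x, b]) _ => *.
  by rewrite ler_norml; apply/andP; split; lin.
- move=> x y ax xy yb; rewrite (iD a x y)// .
  set I := \int[mu]_(_ in `[a, x]) _; set J := \int[mu]_(_ in `[x, y]) _.
  have -> : T - (I + J) - (T - I) = - J by ring.
  rewrite -RintegralN; last by apply: ucont_on_sub ce.
  apply: eq_Rintegral => z _; rewrite /excess minEle maxEle.
  by case: ifPn; case: ifPn; rewrite -?ltNge => *; lin.
- move=> x y ax xy yb h; have ay := le_trans ax xy.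
  have := h y xy (lexx _); have := iD a y b (lexx _) ay yb (lexx _); rewrite IT.
  set I := \int[mu]_(_ in `[a, y]) _; set J := \int[mu]_(_ in `[y, b]) _ => E1 E2.
  have J0 : 0 < J by lin.
  have [z [yz zb cz]] := excess_int_gt0 cw ay yb (lexx _) J0.
  have [yt|ty] := leP y t.
    have := m1 x y ax xy yt; rewrite !mul1r => wxy.
    by rewrite le_min ge_min wxy ge_min lexx orbT.
  have := m2 y z (ltW ty) yz zb; rewrite !mulN1r lerN2 => wyz.
  by rewrite [leRHS](min_idPr _) ?ge_min ?lexx ?orbT//; lin.
- move=> x y ax xy yb h; have xb := le_trans xy yb.
  have := h x (lexx _) xy.
  set I := \int[mu]_(_ in `[a, x]) _ => E1.
  have J0 : 0 < I by lin.
  have [z [az zx cz]] := excess_int_gt0 cw (lexx _) ax xb J0.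
  have [tx|xt] := leP t x.
    have := m2 x y tx xy yb; rewrite !mulN1r lerN2 => wxy.
    by rewrite le_min ge_min wxy ge_min lexx orbT.
  have := m1 z x az zx (ltW xt); rewrite !mul1r => wyz.
  by rewrite [leRHS](min_idPr _) ?ge_min ?lexx ?orbT//; lin.
Qed.

(** The removed area is Lipschitz in the level, vanishes at the maximal level [w t] and is positive
    at [c0]; the intermediate value theorem yields the level for a prescribed area. *)
Lemma excess_level a t b w c0 : a < b -> a <= t -> t <= b -> ucont_on a b w ->
  (forall x, a <= x -> x <= b -> w x <= w t) -> c0 < w t ->
  exists2 T0 : R, 0 < T0 & forall T, 0 < T -> T <= T0 ->
    exists c, [/\ c0 < c, c < w t & \int[mu]_(x in `[a, b]) excess w c x = T + T].
Proof.
move=> ab at_ tb cw wt c0t.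
pose A c := \int[mu]_(x in `[a, b]) excess w c x.
have iex c : mu.-integrable `[a, b] (EFin \o excess w c).
  by apply: ucont_on_integrable; exact: ucont_on_excess.
have Alip c c' : `|A c - A c'| <= `|c - c'| * (b - a).
  rewrite /A -RintegralB//.
  have cB : ucont_on a b (fun x => excess w c x - excess w c' x).
    by apply: ucont_onB; exact: ucont_on_excess.
  rewrite ler_norml -mulNr; apply/andP; split.
    apply: Rint_ge => //; [exact: ltW|move=> x _ _].
    by have := excess_lip w c c' x; rewrite ler_norml => /andP[].
  apply: Rint_le => //; [exact: ltW|move=> x _ _].
  by have := excess_lip w c c' x; rewrite ler_norml => /andP[].
have cA : continuous A.
  apply: (@lipschitz_by_continuous R (b - a)) => x y.
  by rewrite mulrC; exact: Alip.
have At : A (w t) = 0.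
  rewrite /A -[RHS](mul0r (b - a)) -(Rint_cst 0 (ltW ab)); apply: eq_Rintegral => x.
  rewrite inE/= in_itv/= => /andP[h1 h2]; rewrite /excess; apply/max_idPr.
  by rewrite subr_le0 wt.
have A0 : 0 < A c0.
  have [|e e0 E] := @ucont_on_local _ a b w t ((w t + c0) / 2) cw at_ tb; first lin.
  pose y := Num.max a (t - e); pose z := Num.min b (t + e).
  have [y1 [y2 y3]] : a <= y /\ t - e <= y /\ y <= t.
    by rewrite /y le_max lexx le_max lexx orbT ge_max at_; split => //; split => //; lin.
  have [z1 [z2 z3]] : z <= b /\ z <= t + e /\ t <= z.
    by rewrite /z ge_min lexx ge_min lexx orbT le_min tb; split => //; split => //; lin.
  have yz : y < z.
    by rewrite /y /z gt_max !lt_min ab; apply/andP; split; [apply/andP; split|]; lin.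
  rewrite /A (@Rintegral_itvD _ _ a y b)//; [|lin].
  rewrite (@Rintegral_itvD _ _ y z b)//; [|exact: ltW|by apply: integrable_sub (iex c0)].
  apply: ltr_wpDl; first by apply: Rintegral_ge0 => x _; exact: excess_ge0.
  apply: ltr_wpDr; first by apply: Rintegral_ge0 => x _; exact: excess_ge0.
  apply: (@lt_le_trans _ _ ((w t - c0) / 2 * (z - y))); first by apply: mulr_gt0; lin.
  apply: Rint_ge; [exact: ltW|by apply: ucont_on_sub (ucont_on_excess c0 cw)|].
  move=> x h1 h2; have := E x ltac:(lin) ltac:(lin) ltac:(rewrite ler_norml; apply/andP; split; lin).
  by move=> ?; rewrite /excess le_max; apply/orP; left; lin.
(* Then [T + T] is at most half of [A c0], which keeps the level strictly above [c0]. *)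
exists (A c0 / 4); first lin.
move=> T T0 TT.
have [|c cI cE] := @IVT R A c0 (w t) (T + T) (ltW c0t) (continuous_subspaceT cA).
  rewrite At minEle maxEle; case: ifPn; rewrite -?ltNge => *; apply/andP; split; lin.
move: cI; rewrite in_itv/= => /andP[h1 h2]; exists c; split => //.
- rewrite lt_neqAle h1 andbT; apply/eqP => E; move: cE; rewrite -E; lin.
- rewrite lt_neqAle h2 andbT; apply/eqP => E; move: cE; rewrite E At; lin.
Qed.

(** The sign [r] reduces minima to maxima by passing to opposites. The end values [r * T] and
    [- r * T] of [p] are those that adjacent cuts of alternating sign share at their common end
    point. *)
Lemma sol_cut a t b w c0 (r : R) : r = 1 \/ r = -1 -> a < b -> a <= t -> t <= b -> ucont_on a b w ->
  smono r w a t -> smono (- r) w t b -> r * w a <= c0 -> r * w b <= c0 -> c0 < r * w t ->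
  exists2 T0 : R, 0 < T0 & forall T, 0 < T -> T <= T0 ->
    exists c u p, [/\ c0 < c < r * w t,
      \int[mu]_(x in `[a, b]) excess (fun y => r * w y) c x = T + T, sol a b T w u p /\ ucont_on a b u,
      p a = r * T /\ p b = - r * T & forall x, a <= x -> x <= b -> r * u x = Num.min (r * w x) c].
Proof.
move=> r1 ab at_ tb cw m1 m2 wa wb wt.
have rr : r * r = 1 by case: r1 => ->; ring.
pose w' x := r * w x.
have cw' : ucont_on a b w'.
  case: (r1) => E; first by apply: eq_ucont_on cw => x _ _; rewrite /w' E mul1r.
  by apply: eq_ucont_on (ucont_onN cw) => x _ _; rewrite /w' E mulN1r.
have m1' : smono 1 w' a t by move=> x y h1 h2 h3; rewrite !mul1r; exact: m1.
have m2' : smono (-1) w' t b by move=> x y h1 h2 h3; rewrite !mulN1r /w' -!mulNr; exact: m2.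
have wt' x : a <= x -> x <= b -> w' x <= w' t.
  move=> h1 h2; case: (leP x t) => h.
    by have := m1' x t h1 h (lexx _); rewrite !mul1r.
  by have := m2' t x (lexx _) (ltW h) h2; rewrite !mulN1r lerN2.
have [T0 T00 H] := excess_level ab at_ tb cw' wt' wt.
exists T0 => // T T1 T2; have [c [h1 h2 h3]] := H T T1 T2.
have S := sol_cut_pos at_ tb cw' m1' m2' (le_trans wa (ltW h1)) (le_trans wb (ltW h1)) h3.
set u' := (fun x => _) in S; set p' := (fun x => _) in S.
have cu' : ucont_on a b u'.
  apply: eq_ucont_on (ucont_onB cw' (ucont_on_excess c cw')) => x _ _.
  by rewrite /u' /excess minEle maxEle; case: ifPn; case: ifPn; rewrite -?ltNge => *; lin.
have p'a : p' a = T by rewrite /p' Rintegral_itvxx subr0.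
have p'b : p' b = - T by rewrite /p' h3; ring.
exists c; case: r1 => E.
  exists u', p'; split => //; first by rewrite h1.
  - split => //; have [S1 S2 S3 S4 S5] := S; split => //.
      by move: S1; rewrite /w' E !mul1r.
    by move=> x y k1 k2 k3; rewrite S3//; apply: eq_Rintegral => z _; rewrite /w' E mul1r.
  - by rewrite p'a p'b E mul1r mulN1r.
  - by move=> x _ _; rewrite {1}E mul1r.
have [S1 S2 S3 S4 S5] := sol_opp cw' cu' S.
exists (fun x => - u' x), (fun x => - p' x); split => //; first by rewrite h1.
- split; last exact: ucont_onN.
  split => //.
    by move: S1; rewrite /w' E !mulN1r !opprK.
  by move=> x y k1 k2 k3; rewrite S3//; apply: eq_Rintegral => z _; rewrite /w' E mulN1r opprK.
- by rewrite p'a p'b E; split; ring.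
- by move=> x _ _; rewrite {1}E mulN1r opprK.
Qed.

End existence.

(** * Limits of solutions, and reduction to alternating monotonicity *)

Section existence_all.
Context {R : realType}.
Notation mu := (@lebesgue_measure R).
Notation ucont := (ucont_on 0 1).
Implicit Types (f g w u v p q : R -> R) (a b c d x y z T : R).

Lemma uniform_limit a b (f : nat -> R -> R) :
  (forall e, 0 < e -> exists K, forall j k, (K <= j)%N -> (K <= k)%N ->
     forall x, a <= x -> x <= b -> `|f j x - f k x| <= e) ->
  exists g, forall e, 0 < e -> exists K, forall k, (K <= k)%N ->
     forall x, a <= x -> x <= b -> `|f k x - g x| <= e.
Proof.
move=> H; exists (fun x => lim (f k x @[k --> \oo])) => e e0.
have [K HK] := H e e0; exists K => k Kk x ax xb.
have /cvgrPdist_lt C : f k x @[k --> \oo] --> lim (f k x @[k --> \oo]).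
  apply: cauchy_cvg; apply: cauchy_exP => d d0 /=.
  have [N HN] := H (d / 2) ltac:(lin); exists (f N x); exists N => // j /= Nj.
  by rewrite /ball/=; have := HN N j (leqnn _) Nj x ax xb; lin.
apply/ler_addgt0Pr => d d0; have [N _ HN] := C d d0.
pose j := maxn K N.
have := HN j (leq_maxr _ _); have := HK k j Kk (leq_maxl _ _) x ax xb => /=.
set l := lim _ => h1 h2.
have -> : f k x - l = (f k x - f j x) - (l - f j x) by ring.
by apply: (le_trans (ler_normB _ _)); lin.
Qed.

(** As [T k + p k] is nondecreasing in [k], the condition [- T k < p k] valid near [z] for one index
    persists for all later ones on the same neighbourhood. There the monotonicity of all later [u j]
    passes to the limit. *)
Lemma limit_up (T : nat -> R) (T' : R) w (u p : nat -> R -> R) U P :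
  ucont w -> ucont U ->
  (forall k, sol 0 1 (T k) w (u k) (p k)) -> (forall k, ucont (u k)) ->
  (forall j k x, (j <= k)%N -> 0 <= x -> x <= 1 -> T j + p j x <= T k + p k x) ->
  (forall e, 0 < e -> exists K, forall k, (K <= k)%N -> T' - T k <= e) ->
  (forall e, 0 < e -> exists K, forall k, (K <= k)%N -> forall x, 0 <= x -> x <= 1 -> `|u k x - U x| <= e) ->
  (forall e, 0 < e -> exists K, forall k, (K <= k)%N -> forall x, 0 <= x -> x <= 1 -> `|p k x - P x| <= e) ->
  forall x y, 0 <= x -> x <= y -> y <= 1 -> (forall z, x <= z -> z <= y -> - T' < P z) -> U x <= U y.
Proof.
move=> cw cU S cu mT cT cuU cpP x y x0 xy y1 Pz.
apply: (@locally_increasing _ x y U) => //; first exact: ucont_on_sub cU.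
move=> z xz zy; have := Pz z xz (ltW zy); set e := (P z + T') / 3 => h.
have e0 : 0 < e by rewrite /e; lin.
have z0 : 0 <= z by lin.
have z1 : z <= 1 by lin.
have [K1 HK1] := cT e e0; have [K2 HK2] := cpP e e0.
pose k := maxn K1 K2.
have pk : - T k < p k z.
  have := HK1 k (leq_maxl _ _); have := HK2 k (leq_maxr _ _) z z0 z1.
  by rewrite ler_norml /e => /andP[*]; lin.
have [d d0 Hd] := @ucont_on_local _ 0 1 (p k) z (- T k) (sol_ucont cw (cu k) (S k)) z0 z1 pk.
exists d => // t zt td ty.
apply/ler_addgt0Pr => d' d'0; have [K3 HK3] := cuU (d' / 2) ltac:(lin).
pose j := maxn k K3.
have t0 : 0 <= t by lin.
have t1 : t <= 1 by lin.
have [_ _ _ up _] := S j.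
have := up z t z0 zt t1; have := HK3 j (leq_maxr _ _) z z0 z1; have := HK3 j (leq_maxr _ _) t t0 t1.
rewrite !ler_norml => /andP[h1 h2] /andP[h3 h4] h5.
have h6 : u j z <= u j t.
  apply: h5 => s s1 s2; have s3 : 0 <= s by lin.
  have s4 : s <= 1 by lin.
  have := mT k j s (leq_maxl _ _) s3 s4; have := Hd s s3 s4; rewrite ler_norml => hh.
  have := hh ltac:(apply/andP; split; lin); lin.
lin.
Qed.

Lemma sol_const_le a b T T' w u p : T <= T' -> (forall x, a <= x -> x <= b -> u x = u a) ->
  sol a b T w u p -> sol a b T' w u p.
Proof.
move=> TT uc [ub pT pE _ _]; split => //.
- by move=> x h1 h2; exact: le_trans (pT x h1 h2) TT.
- by move=> x y h1 h2 h3 _; rewrite !uc//; lin.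
- by move=> x y h1 h2 h3 _; rewrite !uc//; lin.
Qed.

(** Turns closeness of the dual variables into closeness of the solutions. Over an interval of
    length [d] next to [x] the integral of [u' - u] is at most [2 d e], while by the common modulus
    of continuity the integrand differs from its value at [x] by at most [2 e]. *)
Lemma sol_close T T' w u u' p p' (e d : R) : ucont w -> ucont u -> ucont u' ->
  sol 0 1 T w u p -> sol 0 1 T' w u' p' -> 0 < d -> d <= 1 / 2 ->
  (forall x y, 0 <= x -> x <= 1 -> 0 <= y -> y <= 1 -> `|x - y| < d + d -> `|w x - w y| < e) ->
  (forall x, 0 <= x -> x <= 1 -> `|p' x - p x| <= d * e) ->
  forall x, 0 <= x -> x <= 1 -> u' x - u x <= 4 * e.
Proof.
move=> cw cu cu' S S' d0 d2 we pe x x0 x1.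
have mu1 := sol_modulus cw cu S we; have mu2 := sol_modulus cw cu' S' we.
have [y [y0 y1 yx xy]] : exists y, [/\ 0 <= y, y + d <= 1, y <= x & x <= y + d].
  by have [h|h] := leP x (1 / 2); [exists x|exists (x - d)]; split; lin.
have c1 : ucont_on y (y + d) (fun t => u' t - w t) by apply: ucont_on_sub (ucont_onB cu' cw).
have c2 : ucont_on y (y + d) (fun t => u t - w t) by apply: ucont_on_sub (ucont_onB cu cw).
have [_ _ pE _ _] := S; have [_ _ pE' _ _] := S'.
have ydy : y <= y + d by lin.
have I : \int[mu]_(t in `[y, y + d]) (u' t - u t) = (p' (y + d) - p' y) - (p (y + d) - p y).
  rewrite pE// pE'// -RintegralB//; try exact: ucont_on_integrable.
  by apply: eq_Rintegral => t _; ring.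
have k1 := pe y y0 ltac:(lin); have k2 := pe (y + d) ltac:(lin) y1.
have := @Rint_ge _ (fun t => u' t - u t) y (y + d) (u' x - u x - (e + e)) ydy.
rewrite I => h.
have {}h : (u' x - u x - (e + e)) * (y + d - y) <= p' (y + d) - p' y - (p (y + d) - p y).
  apply: h; first by apply: ucont_on_sub (ucont_onB cu' cu).
  move=> t t1 t2; have tt : `|x - t| < d + d by rewrite ltr_norml; apply/andP; split; lin.
  have t0 : 0 <= t by lin.
  have t3 : t <= 1 by lin.
  have := mu1 x t x0 x1 t0 t3 tt; have := mu2 x t x0 x1 t0 t3 tt.
  by rewrite !ltr_norml => /andP[? ?] /andP[? ?]; lin.
have {h} : (u' x - u x - (e + e)) * d <= d * (e + e).
  move: k1 k2 h; rewrite !ler_norml (_ : y + d - y = d); last by ring.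
  by clear => /andP[? ?] /andP[? ?] ?; lin.
rewrite mulrC ler_pM2l//; lin.
Qed.

Lemma sol_limit (T : nat -> R) (T' : R) w (u p : nat -> R -> R) : ucont w ->
  (forall k, sol 0 1 (T k) w (u k) (p k)) -> (forall k, ucont (u k)) ->
  (forall j k, (j <= k)%N -> T j <= T k) -> (forall k, T k <= T') ->
  (forall e, 0 < e -> exists K, forall k, (K <= k)%N -> T' - T k <= e) ->
  exists U P, sol 0 1 T' w U P /\ ucont U.
Proof.
move=> cw S cu mT TT' cT.
(* A constant solution stays one for every larger parameter; if there is none, the comparison of
   dual variables holds between all indices. *)
have [[k uk]|NC] := pselect (exists k, forall x, 0 <= x -> x <= 1 -> u k x = u k 0).
  by exists (u k), (p k); split => //; exact: sol_const_le (S k).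
have D j k x : (j <= k)%N -> 0 <= x -> x <= 1 -> `|p k x - p j x| <= T k - T j.
  move=> jk x0 x1.
  have [h|h] := sol_compare ler01 cw (cu j) (cu k) (S j) (S k) (mT _ _ jk); first exact: h.
  by exfalso; apply: NC; exists j => y y0 y1; have [] := h y y0 y1.
have D' K j k x : (K <= j)%N -> (K <= k)%N -> 0 <= x -> x <= 1 -> `|p j x - p k x| <= T' - T K.
  move=> Kj Kk x0 x1; have [jk|/ltnW kj] := leqP j k.
    rewrite distrC; apply: (le_trans (D _ _ _ jk x0 x1)).
    by have := mT _ _ Kj; have := TT' k; lin.
  by apply: (le_trans (D _ _ _ kj x0 x1)); have := mT _ _ Kk; have := TT' j; lin.
have [P cP] : exists g, forall e, 0 < e -> exists K, forall k, (K <= k)%N ->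
     forall x, 0 <= x -> x <= 1 -> `|p k x - g x| <= e.
  apply: uniform_limit => e e0; have [K HK] := cT e e0; exists K => j k Kj Kk x x0 x1.
  by apply: (le_trans (D' _ _ _ _ Kj Kk x0 x1)); exact: HK.
have [U cU] : exists g, forall e, 0 < e -> exists K, forall k, (K <= k)%N ->
     forall x, 0 <= x -> x <= 1 -> `|u k x - g x| <= e.
  apply: uniform_limit => e e0; have e40 : 0 < e / 4 by lin.
  have [d' d'0 wd'] := cw _ e40.
  have [d [d0 d2 dd]] : exists d, [/\ 0 < d, d <= 1 / 2 & d + d <= d'].
    exists (Num.min (d' / 2) (1 / 2)); rewrite lt_min ge_min lexx orbT; split => //.
      by apply/andP; split; lin.
    have : Num.min (d' / 2) (1 / 2) <= d' / 2 by rewrite ge_min lexx.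
    lin.
  have wd x y : 0 <= x -> x <= 1 -> 0 <= y -> y <= 1 -> `|x - y| < d + d -> `|w x - w y| < e / 4.
    by move=> *; apply: wd' => //; lin.
  have de : 0 < d * (e / 4) by rewrite mulr_gt0.
  have [K HK] := cT _ de; exists K => j k Kj Kk x x0 x1.
  have H i i' : (K <= i)%N -> (K <= i')%N -> u i x - u i' x <= e.
    move=> Ki Ki'; have -> : e = 4 * (e / 4) by field.
    apply: (@sol_close (T i') (T i) w (u i') (u i) (p i') (p i) (e / 4) d) => //.
    move=> y y0 y1; apply: (le_trans (D' K _ _ _ Ki Ki' y0 y1)); exact: HK.
  rewrite ler_norml; have := H _ _ Kj Kk; have := H _ _ Kk Kj => *.
  by apply/andP; split; lin.
have cUU : ucont U.
  move=> e e0; have e20 : 0 < e / 4 by lin.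
  have [d d0 wd] := cw _ e20; exists d => // x y x0 x1 y0 y1 xy.
  have [K HK] := cU _ e20; have := HK K (leqnn _) x x0 x1; have := HK K (leqnn _) y y0 y1.
  have := sol_modulus cw (cu K) (S K) wd x0 x1 y0 y1 xy.
  by rewrite !ler_norml !ltr_norml => /andP[? ?] /andP[? ?] /andP[? ?]; apply/andP; split; lin.
have cPP : ucont P.
  move=> e e0; have e20 : 0 < e / 4 by lin.
  have [K HK] := cP _ e20.
  have [d d0 wd] := sol_ucont cw (cu K) (S K) e20; exists d => // x y x0 x1 y0 y1 xy.
  have := HK K (leqnn _) x x0 x1; have := HK K (leqnn _) y y0 y1; have := wd x y x0 x1 y0 y1 xy.
  by rewrite !ler_norml !ltr_norml => /andP[? ?] /andP[? ?] /andP[? ?]; apply/andP; split; lin.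
have U01 x : 0 <= x -> x <= 1 -> (forall k, u k x = w x) -> U x = w x.
  move=> x0 x1 ux; apply/eqP; rewrite -subr_eq0 -normr_eq0; apply/eqP.
  apply/eqP; rewrite eq_le normr_ge0 andbT; apply/ler_addgt0Pr => e e0.
  by have [K HK] := cU _ e0; have := HK K (leqnn _) x x0 x1; rewrite ux distrC add0r.
exists U, P; split => //; split.
- by split; apply: U01 => // k; have [[]] := S k.
- move=> x x0 x1; apply/ler_addgt0Pr => e e0.
  have [K HK] := cP _ e0; have := HK K (leqnn _) x x0 x1.
  have [_ pT _ _ _] := S K; have := pT x x0 x1; have := TT' K.
  by rewrite !ler_norml => ? /andP[? ?] /andP[? ?]; apply/andP; split; lin.
- move=> x y x0 xy y1.
  have h0 : 0 <= y by lin.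
  have h1 : x <= 1 by lin.
  apply/eqP; rewrite -subr_eq0 -normr_eq0; apply/eqP.
  apply/eqP; rewrite eq_le normr_ge0 andbT; apply/ler_addgt0Pr => e e0; rewrite add0r.
  have e30 : 0 < e / 3 by lin.
  have [K1 HK1] := cU _ e30; have [K2 HK2] := cP _ e30.
  pose k := maxn K1 K2.
  have [_ _ pE _ _] := S k.
  have c1 : ucont_on x y (fun t => U t - w t) by apply: ucont_on_sub (ucont_onB cUU cw).
  have c2 : ucont_on x y (fun t => u k t - w t) by apply: ucont_on_sub (ucont_onB (cu k) cw).
  have cd : ucont_on x y (fun t => u k t - U t) by apply: ucont_on_sub (ucont_onB (cu k) cUU).
  have I : \int[mu]_(t in `[x, y]) (u k t - U t) =
      \int[mu]_(t in `[x, y]) (u k t - w t) - \int[mu]_(t in `[x, y]) (U t - w t).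
    by rewrite -RintegralB//; [apply: eq_Rintegral => t _; ring|exact: ucont_on_integrable..].
  have B t : x <= t -> t <= y -> - (e / 3) <= u k t - U t <= e / 3.
    move=> t0 t1; rewrite -ler_norml; apply: HK1; [exact: leq_maxl|lin|lin].
  have := @Rint_ge _ (fun t => u k t - U t) x y (- (e / 3)) xy cd (fun t h h' => proj1 (andP (B t h h'))).
  have := @Rint_le _ (fun t => u k t - U t) x y (e / 3) xy cd (fun t h h' => proj2 (andP (B t h h'))).
  rewrite I -pE//; move: (\int[mu]_(_ in _) _) => J k1 k2.
  have := HK2 k (leq_maxr _ _) x x0 h1; have := HK2 k (leq_maxr _ _) y h0 y1.
  have k3 : e / 3 * (y - x) <= e / 3 by rewrite ger_pMr//; lin.
  rewrite mulNr in k2; move: k1 k2 k3; set M := e / 3 * (y - x).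
  rewrite !ler_norml /=; clear => ? ? ? /andP[? ?] /andP[? ?]; apply/andP; split; lin.
- apply: (@limit_up T T' w u p U P) => // j k x jk x0 x1.
  by have := D j k x jk x0 x1; rewrite ler_norml => /andP[? ?]; lin.
- move=> x y x0 xy y1 h; rewrite -lerN2.
  apply: (@limit_up T T' (fun x => - w x) (fun k x => - u k x) (fun k x => - p k x)
    (fun x => - U x) (fun x => - P x)) => //.
  + exact: ucont_onN.
  + exact: ucont_onN.
  + by move=> k; apply: sol_opp.
  + by move=> k; exact: ucont_onN.
  + move=> j k z jk z0 z1.
    by have := D j k z jk z0 z1; rewrite ler_norml => /andP[? ?]; lin.
  + move=> e e0; have [K HK] := cU _ e0; exists K => k Kk z z0 z1.
    by rewrite -opprD normrN; exact: HK.
  + move=> e e0; have [K HK] := cP _ e0; exists K => k Kk z z0 z1.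
    by rewrite -opprD normrN; exact: HK.
  + by move=> z z0 z1; rewrite ltrN2; exact: h.
Qed.

Definition asign (s : R) i : R := (-1) ^+ i * s.

Lemma asignS s i : asign s i.+1 = - asign s i.
Proof. by rewrite /asign exprS mulN1r mulNr. Qed.

Lemma asign1 s i : s = 1 \/ s = -1 -> asign s i = 1 \/ asign s i = -1.
Proof.
move=> s1; elim: i => [|i IH]; first by rewrite /asign expr0 mul1r.
by rewrite asignS; case: IH => ->; rewrite ?opprK; [right|left].
Qed.

(* On the [i]-th interval [w] is monotone in the direction of [asign s i]; the
   interior breakpoints are then the essential extrema. *)
Definition zigzag (n : nat) (t : nat -> R) (s : R) w :=
  [/\ s = 1 \/ s = -1, t 0%N = 0 /\ t n = 1,
    forall i, (i < n)%N -> t i < t i.+1,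
    forall i, (i < n)%N -> smono (asign s i) w (t i) (t i.+1)
  & (n = 1%N /\ s = 1) \/
    forall i, (i < n)%N -> asign s i * w (t i) < asign s i * w (t i.+1)].

Lemma smono_cat (s : R) w a b c : a <= b -> b <= c -> smono s w a b -> smono s w b c -> smono s w a c.
Proof.
move=> ab bc m1 m2 x y ax xy yc; have [yb|/ltW by_] := leP y b; first exact: m1.
have [bx|/ltW xb] := leP b x; first exact: m2.
by apply: le_trans (m1 x b ax xb _) (m2 b y _ by_ yc).
Qed.

(** The pieces are added one by one: a piece with equal end values or in the current direction is
    merged into the last interval, a piece in the opposite direction opens a new one, and an initial
    constant stretch joins the first piece that is not constant. *)
Lemma piecewise_zigzag n t s w : piecewise_smono n t s w ->
  exists n' t' s', zigzag n' t' s' w.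
Proof.
move=> pw; have [t0 tn ts] := pw.
suff H k : (k <= n)%N -> (forall x, 0 <= x -> x <= t k -> w x = w 0) \/
   exists m t' s', [/\ s' = 1 \/ s' = -1, t' 0%N = 0 /\ t' m.+1 = t k,
     forall i, (i <= m)%N -> t' i < t' i.+1,
     forall i, (i <= m)%N -> smono (asign s' i) w (t' i) (t' i.+1)
   & forall i, (i <= m)%N -> asign s' i * w (t' i) < asign s' i * w (t' i.+1)].
  have [h|] := H n (leqnn n); last first.
    move=> [m [t' [s' [h1 h2 h3 h4 h5]]]]; exists m.+1, t', s'.
    by split => //; [rewrite -tn|right].
  (* A constant function is represented by a single interval with sign 1, in agreement with the
     value 1 that [sgn_bar] takes for it. *)
  exists 1%N, (fun i => if i is 0%N then 0 else 1), 1; split.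
  - by left.
  - by [].
  - by case=> // _; exact: ltr01.
  - by case=> // _ x y /= h1 h2 h3; rewrite (h x) ?(h y)//; rewrite ?tn; lin.
  - by left.
elim: k => [|k IH] kn.
  by left => x x0; rewrite t0 => x0'; have -> : x = 0 by apply/eqP; rewrite eq_le x0' x0.
have [tk sk mk] := ts k kn.
have tk0 := piecewise_smono_ge0 pw (ltnW kn).
have [E|NE] := eqVneq (w (t k)) (w (t k.+1)).
  have const x : t k <= x -> x <= t k.+1 -> w x = w (t k).
    move=> h1 h2; have := mk _ _ (lexx _) h1 h2; have := mk _ _ h1 h2 (lexx _); rewrite E.
    by case: sk => ->; rewrite ?mul1r ?mulN1r => ? ?; lin.
  have [h|[m [t' [s' [h1 [h2 h2'] h3 h4 h5]]]]] := IH (ltnW kn).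
    left => x x0 xt; have [xk|/ltW kx] := leP x (t k); first exact: h.
    by rewrite const// h.
  right; exists m, (fun i => if (i <= m)%N then t' i else t k.+1), s'; split => //.
  + by rewrite ltnn leq0n.
  + move=> i im; rewrite im; case: (leqP i.+1 m) => [mi|mi]; first exact: h3.
    have im' : i = m by apply/eqP; rewrite eqn_leq im -ltnS.
    by apply: (lt_le_trans (h3 i im)); rewrite im' h2'.
  + move=> i im; rewrite im; case: (leqP i.+1 m) => [mi|mi]; first exact: h4.
    have im' : i = m by apply/eqP; rewrite eqn_leq im -ltnS.
    apply: (@smono_cat _ _ _ (t k)) => //.
    * by rewrite -h2' im'; apply/ltW/h3.
    * by rewrite -h2' -im'; apply: h4.
    * move=> x y k1 k2 k3; rewrite !const//; lin.
  + move=> i im; rewrite im; case: (leqP i.+1 m) => [mi|mi]; first exact: h5.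
    have im' : i = m by apply/eqP; rewrite eqn_leq im -ltnS.
    by rewrite -E -h2' -im'; exact: h5.
have NE' : s k * w (t k) < s k * w (t k.+1).
  rewrite lt_neqAle mk ?lexx// andbT; apply: contra_neq NE => /(congr1 ( *%R (s k))).
  by case: sk => ->; rewrite !mulrA ?mulrNN !mul1r.
have tk' : t k < t k.+1.
  by rewrite lt_neqAle tk andbT; apply/eqP => h; move: NE; rewrite h eqxx.
right; have [h|[m [t' [s' [h1 [h2 h2'] h3 h4 h5]]]]] := IH (ltnW kn).
  exists 0%N, (fun i => if i is 0%N then 0 else t k.+1), (s k); split => //.
  - by move=> [|//] _ /=; lin.
  - move=> [|//] _ /=; rewrite /asign expr0 mul1r; apply: (@smono_cat _ _ _ (t k)) => //.
    by move=> x y k1 k2 k3; rewrite !h//; lin.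
  - by move=> [|//] _ /=; rewrite /asign expr0 mul1r -(h (t k)).
have [E|E] : s k = asign s' m \/ s k = asign s' m.+1.
  by rewrite asignS; case: sk => ->; case: (asign1 m h1) => ->; rewrite ?opprK; [left|right|right|left].
  exists m, (fun i => if (i <= m)%N then t' i else t k.+1), s'; split => //.
  + by rewrite ltnn leq0n.
  + move=> i im; rewrite im; case: (leqP i.+1 m) => [mi|mi]; first exact: h3.
    have im' : i = m by apply/eqP; rewrite eqn_leq im -ltnS.
    by apply: (lt_le_trans (h3 i im)); rewrite im' h2'.
  + move=> i im; rewrite im; case: (leqP i.+1 m) => [mi|mi]; first exact: h4.
    have im' : i = m by apply/eqP; rewrite eqn_leq im -ltnS.
    apply: (@smono_cat _ _ _ (t k)) => //.
    * by rewrite -h2' im'; apply/ltW/h3.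
    * by rewrite -h2' -im'; apply: h4.
    * by rewrite im' -E.
  + move=> i im; rewrite im; case: (leqP i.+1 m) => [mi|mi]; first exact: h5.
    have im' : i = m by apply/eqP; rewrite eqn_leq im -ltnS.
    by apply: (lt_trans (h5 i im)); rewrite im' h2' -E.
exists m.+1, (fun i => if (i <= m.+1)%N then t' i else t k.+1), s'; split => //.
- by rewrite ltnn leq0n.
- move=> i im; rewrite im; case: (leqP i.+1 m.+1) => [mi|mi]; first exact: h3.
  have im' : i = m.+1 by apply/eqP; rewrite eqn_leq im -ltnS.
  by rewrite im' h2'.
- move=> i im; rewrite im; case: (leqP i.+1 m.+1) => [mi|mi]; first exact: h4.
  have im' : i = m.+1 by apply/eqP; rewrite eqn_leq im -ltnS.
  by rewrite im' h2' -E.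
- move=> i im; rewrite im; case: (leqP i.+1 m.+1) => [mi|mi]; first exact: h5.
  have im' : i = m.+1 by apply/eqP; rewrite eqn_leq im -ltnS.
  by rewrite im' h2' -E.
Qed.

End existence_all.

(** * Explicit solutions for small parameters, and existence for all *)

Section small_cut.
Context {R : realType}.
Notation mu := (@lebesgue_measure R).
Notation ucont := (ucont_on 0 1).
Implicit Types (f g w u v p q : R -> R) (a b c d x y z T : R).

Lemma ucont_on_ivt a b f (v : R) : a <= b -> ucont_on a b f -> f a <= v <= f b \/ f b <= v <= f a ->
  exists z, [/\ a <= z, z <= b & f z = v].
Proof.
move=> ab cf vab; have [|z zI zE] := @IVT R (f \o clamp a b) a b v ab
  (continuous_subspaceT (ucont_on_clamp ab cf)).
  rewrite /= !clamp_id//; case: vab => /andP[h1 h2]; rewrite minEle maxEle;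
  by case: ifPn; rewrite -?ltNge => *; apply/andP; split; lin.
move: zI; rewrite in_itv/= => /andP[h1 h2]; exists z; split => //.
by rewrite -zE /= clamp_id.
Qed.

Lemma zigzag_gt0 n t s w : zigzag n t s w -> (0 < n)%N.
Proof.
move=> [_ [t0 tn] _ _ _]; case: n tn => // tn.
by have := @oner_neq0 R; rewrite -tn t0 eqxx.
Qed.

Lemma zigzag_lt n t s w i j : zigzag n t s w -> (i < j)%N -> (j <= n)%N -> t i < t j.
Proof.
move=> [_ _ tt _ _]; elim: j => // j IH; rewrite ltnS leq_eqVlt => /predU1P[->|ij] jn; first exact: tt.
by apply: (lt_trans (IH ij (ltnW jn))); exact: tt.
Qed.

Lemma zigzag_le n t s w i j : zigzag n t s w -> (i <= j)%N -> (j <= n)%N -> t i <= t j.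
Proof.
move=> A; rewrite leq_eqVlt => /predU1P[->//|ij] jn; apply/ltW.
exact: zigzag_lt A ij jn.
Qed.

Lemma zigzag_ge0 n t s w i : zigzag n t s w -> (i <= n)%N -> 0 <= t i.
Proof. by move=> A ni; have [_ [<- _] _ _ _] := A; exact: zigzag_le A _ ni. Qed.

Lemma zigzag_le1 n t s w i : zigzag n t s w -> (i <= n)%N -> t i <= 1.
Proof. by move=> A ni; have [_ [_ <-] _ _ _] := A; exact: zigzag_le A ni _. Qed.

Lemma sol_join a c b T w u1 u2 p1 p2 : a <= c -> c <= b -> ucont_on a b w ->
  ucont_on a c u1 -> ucont_on c b u2 -> sol a c T w u1 p1 -> sol c b T w u2 p2 -> p1 c = p2 c ->
  let u := fun x => if x <= c then u1 x else u2 x in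
  let p := fun x => if x <= c then p1 x else p2 x in
  [/\ sol a b T w u p, ucont_on a b u, u c = u2 c & forall x, c <= x -> u x = u2 x /\ p x = p2 x].
Proof.
move=> ac cb cw cu1 cu2 S1 S2 pc u p.
have uc : u1 c = u2 c by have [[_ ->] _ _ _ _] := S1; have [[-> _] _ _ _ _] := S2.
have e1 x : a <= x -> x <= c -> u1 x = u x by move=> _ h; rewrite /u h.
have e2 x : c <= x -> x <= b -> u2 x = u x.
  move=> h _; rewrite /u; case: ifPn => // h'; have -> : x = c by apply/eqP; rewrite eq_le h h'.
  by rewrite uc.
have e3 x : a <= x -> x <= c -> p1 x = p x by move=> _ h; rewrite /p h.
have e4 x : c <= x -> x <= b -> p2 x = p x.
  move=> h _; rewrite /p; case: ifPn => // h'; have -> : x = c by apply/eqP; rewrite eq_le h h'.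
  by rewrite pc.
have cu : ucont_on a b u.
  by apply: (@ucont_on_glue _ a c b); [exact: eq_ucont_on cu1|exact: eq_ucont_on cu2].
split => //.
- have S1' := sol_ext e1 e3 ac S1.
  have S2' := sol_ext e2 e4 cb S2.
  have SS := sol_glue ac cb cw cu S1' S2'.
  exact: SS.
- by rewrite e2.
- move=> x h; rewrite /u /p; case: ifPn => // h'; have -> : x = c by apply/eqP; rewrite eq_le h h'.
  by rewrite uc pc.
Qed.

(** The points [z i] separate the cuts: the extremum at [t i.+1] is cut inside [[z i, z i.+1]].
    Values strictly between those at the breakpoints leave room for the cuts on both sides. The
    implication exempts the single interval on which [zigzag] admits a constant. *)
Definition mid_point n (t : nat -> R) s w (z : nat -> R) := forall i, (i < n)%N ->
  [/\ t i < z i, z i < t i.+1 & (forall j, (j < n)%N -> asign s j * w (t j) < asign s j * w (t j.+1)) ->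
      asign s i * w (t i) < asign s i * w (z i) < asign s i * w (t i.+1)].

Lemma mid_point_ex n t s w : ucont w -> zigzag n t s w -> exists z : nat -> R, mid_point n t s w z.
Proof.
move=> cw A; have [_ _ tt _ st] := A.
suff H i : exists z, (i < n)%N -> [/\ t i < z, z < t i.+1 &
    (forall j, (j < n)%N -> asign s j * w (t j) < asign s j * w (t j.+1)) ->
      asign s i * w (t i) < asign s i * w z < asign s i * w (t i.+1)].
  by have /choice[z Hz] := H; exists z.
have [ni|] := ltnP i n; last by exists 0.
have [S|NS] := pselect (forall j, (j < n)%N -> asign s j * w (t j) < asign s j * w (t j.+1)); last first.
  by exists ((t i + t i.+1) / 2) => _; split => //; have := tt i ni; lin.
have ti0 := zigzag_ge0 A (ltnW ni); have ti1 := zigzag_le1 A ni.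
have cf : ucont_on (t i) (t i.+1) (fun x => asign s i * w x).
  apply: (ucont_on_sub ti0 ti1); have [s1 _ _ _ _] := A; case: (asign1 i s1) => ->.
    by apply: eq_ucont_on cw => x _ _; rewrite mul1r.
  by apply: eq_ucont_on (ucont_onN cw) => x _ _; rewrite mulN1r.
have Si := S i ni.
(* The midpoint is taken among the values, since [w] may be constant near a breakpoint. *)
have [|z [h1 h2 h3]] := ucont_on_ivt (v := (asign s i * w (t i) + asign s i * w (t i.+1)) / 2)
  (ltW (tt i ni)) cf; first by left; apply/andP; split; lin.
exists z => _; split.
- by rewrite lt_neqAle h1 andbT; apply/eqP => E; move: h3; rewrite -E; lin.
- by rewrite lt_neqAle h2 andbT; apply/eqP => E; move: h3; rewrite E; lin.
- by move=> _; rewrite h3; apply/andP; split; lin.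
Qed.

Definition cut_at (T : R) (s : R) w u (z t : nat -> R) i c :=
  [/\ asign s i * w (z i) < c, asign s i * w (z i.+1) < c, c < asign s i * w (t i.+1),
    \int[mu]_(x in `[z i, z i.+1]) excess (fun y => asign s i * w y) c x = T + T
  & forall x, z i <= x -> x <= z i.+1 -> asign s i * u x = Num.min (asign s i * w x) c].

Lemma small_cut_prefix n t s w (z : nat -> R) k : ucont w -> zigzag n t s w -> mid_point n t s w z ->
  (k < n)%N ->
  exists2 T0 : R, 0 < T0 & forall T, 0 < T -> T <= T0 -> exists u p,
    [/\ sol 0 (z k) T w u p, ucont_on 0 (z k) u, p (z k) = asign s k * T,
      forall x, 0 <= x -> x <= z 0%N -> u x = w x
    & forall i, (i < k)%N -> exists c, cut_at T s w u z t i c].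
Proof.
move=> cw A Z; have [s1 [t0 tn] tt mt st] := A.
elim: k => [|k IH] kn.
  exists 1 => // T T0 _; exists w, (fun=> asign s 0 * T); have [z1 z2 _] := Z 0%N kn.
  have z3 := zigzag_le1 A kn; split => //; last by rewrite /ucont_on; apply: ucont_on_sub cw; lin.
  apply: sol_smono_id; [exact: asign1|exact: ltW|].
  move=> x y h1 h2 h3; apply: mt => //; [by rewrite t0|lin].
have kn' := ltnW kn.
have [T1 T10 H1] := IH kn'.
have S : forall j, (j < n)%N -> asign s j * w (t j) < asign s j * w (t j.+1).
  by case: st => // -[E _]; move: kn; rewrite E.
have [z1 z2 /(_ S)/andP[z3 z4]] := Z k kn'; have [z5 z6 /(_ S)/andP[z7 z8]] := Z k.+1 kn.
have tk0 := zigzag_ge0 A (ltnW kn'); have tk1 := zigzag_le1 A kn.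
have zk0 : 0 <= z k by lin.
have zk1 : z k.+1 <= 1 by lin.
have zz : z k < z k.+1 by lin.
have cwz : ucont_on (z k) (z k.+1) w by apply: ucont_on_sub cw.
move: (z7); rewrite asignS !mulNr ltrN2 => z9.
(* A level above both end values confines the cut to the interior of [[z k, z k.+1]]. *)
set c0 := Num.max (asign s k * w (z k)) (asign s k * w (z k.+1)).
have c01 : asign s k * w (z k) <= c0 by rewrite le_max lexx.
have c02 : asign s k * w (z k.+1) <= c0 by rewrite le_max lexx orbT.
have c03 : c0 < asign s k * w (t k.+1) by rewrite gt_max z4.
have m1 : smono (asign s k) w (z k) (t k.+1).
  by move=> x y h1 h2 h3; apply: mt => //; lin.
have m2 : smono (- asign s k) w (t k.+1) (z k.+1).
  by rewrite -asignS => x y h1 h2 h3; apply: mt => //; lin.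
have [T2 T20 H2] := sol_cut (asign1 k s1) zz (ltW z2) (ltW z5) cwz m1 m2 c01 c02 c03.
exists (Num.min T1 T2); first by rewrite lt_min T10.
move=> T T0; rewrite le_min => /andP[TT1 TT2].
have [u1 [p1 [S1 cu1 p1z uw1 cut1]]] := H1 T T0 TT1.
have [c [u2 [p2 [/andP[cc1 cc2] cI [S2 cu2] [p2z p2z'] ucut]]]] := H2 T T0 TT2.
have cwz' : ucont_on 0 (z k.+1) w by apply: ucont_on_sub cw.
have pE : p1 (z k) = p2 (z k) by rewrite p1z p2z.
have [SJ cuJ _ uJ] := sol_join zk0 (ltW zz) cwz' cu1 cu2 S1 S2 pE.
have zmono i j : (i <= j)%N -> (j < n)%N -> z i <= z j.
  move=> ij jn; elim: j ij jn => [|j IHj]; first by rewrite leqn0 => /eqP ->.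
  rewrite leq_eqVlt => /predU1P[->//|]; rewrite ltnS => ij jn.
  apply: (le_trans (IHj ij (ltnW jn))).
  have [_ k1 _] := Z j (ltnW jn); have [k2 _ _] := Z j.+1 jn; lin.
exists (fun x => if x <= z k then u1 x else u2 x), (fun x => if x <= z k then p1 x else p2 x); split => //.
- by have [_ ->] := uJ _ (ltW zz); rewrite p2z'.
- move=> x x0 xz; have xk : x <= z k by apply: (le_trans xz); exact: zmono.
  by rewrite xk; exact: uw1.
- move=> i; rewrite ltnS leq_eqVlt => /predU1P[->|ik].
    exists c; split => //; [lin|lin|].
    by move=> x h1 h2; have [-> _] := uJ x h1; exact: ucut.
  have [c' [d1 d2 d3 d4 d5]] := cut1 i ik; exists c'; split => //.
  move=> x h1 h2; have xk : x <= z k by apply: (le_trans h2); exact: zmono.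
  by rewrite xk; exact: d5.
Qed.

(** Every level stays beyond the values of [w] at the adjacent points [z i], so [u] alternates at
    the same breakpoints as [w]; this is what preserves the number of essential facets. The first
    and last stretches, which contain no interior extremum, remain unchanged. *)
Lemma small_cut n t s w (z : nat -> R) : ucont w -> zigzag n t s w -> mid_point n t s w z ->
  exists2 T0 : R, 0 < T0 & forall T, 0 < T -> T <= T0 -> exists u p,
    [/\ sol 0 1 T w u p /\ ucont u, zigzag n t s u,
      forall x, 0 <= x -> x <= z 0%N -> u x = w x,
      forall x, z n.-1 <= x -> x <= 1 -> u x = w x
    & forall i, (i.+1 < n)%N -> exists c, cut_at T s w u z t i c].
Proof.
move=> cw A Z; have [s1 [t0 tn] tt mt st] := A; have n0 := zigzag_gt0 A.
have [m nE] : exists m, n = m.+1 by case: (n) n0 => // m _; exists m.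
have mn : (m < n)%N by rewrite nE.
have [T0 T00 H] := small_cut_prefix cw A Z mn.
exists T0 => // T T1 T2; have [u1 [p1 [S1 cu1 p1z uw1 cut1]]] := H T T1 T2.
have [z1 z2 _] := Z m mn; have tm1 : t m.+1 = 1 by rewrite -nE tn.
rewrite tm1 in z2; have tm0 := zigzag_ge0 A (ltnW mn).
have zm0 : 0 <= z m by lin.
have cu2 : ucont_on (z m) 1 w by apply: ucont_on_sub cw.
have S2 : sol (z m) 1 T w w (fun=> asign s m * T).
  apply: sol_smono_id; [exact: asign1|exact: ltW|].
  by move=> x y h1 h2 h3; apply: mt => //; rewrite ?tm1//; lin.
have [SJ cuJ _ uJ] := sol_join zm0 (ltW z2) cw cu1 cu2 S1 S2 p1z.
have zmono i j : (i <= j)%N -> (j < n)%N -> z i <= z j.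
  move=> ij jn; elim: j ij jn => [|j IHj]; first by rewrite leqn0 => /eqP ->.
  rewrite leq_eqVlt => /predU1P[->//|]; rewrite ltnS => ij jn.
  apply: (le_trans (IHj ij (ltnW jn))).
  have [_ k1 _] := Z j (ltnW jn); have [k2 _ _] := Z j.+1 jn; lin.
set u := (fun x => _) in SJ cuJ uJ; set p := (fun x => _) in SJ uJ.
have uE x : x <= z m -> u x = u1 x by rewrite /u => ->.
have cut i : (i.+1 < n)%N -> exists c, cut_at T s w u z t i c.
  move=> ni; have im : (i < m)%N by move: ni; rewrite nE.
  have [c' [d1 d2 d3 d4 d5]] := cut1 i im; exists c'; split => //.
  move=> x h1 h2; rewrite uE; first exact: d5.
  by apply: (le_trans h2); exact: zmono.
exists u, p; split => //.
- split => //.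
    move=> i ni; apply: (sol_smono (asign1 i s1) cw cuJ SJ); last exact: mt.
      exact: zigzag_ge0 A (ltnW ni).
    exact: zigzag_le1 A ni.
  case: st => [h|st]; first by left.
  right => i ni; have [_ _ /(_ st)/andP[k1 k2]] := Z i ni.
  have [[u0 uu1] _ _ _ _] := SJ.
  apply: (@lt_trans _ _ (asign s i * w (z i))).
    case: i ni k1 k2 => [|i] ni k1 k2; first by rewrite t0 u0 -t0.
    have [c [d1 d2 d3 d4 d5]] := cut i ni.
    have [l1 l2 _] := Z i (ltnW ni); have [l3 l4 _] := Z i.+1 ni.
    have := d5 (t i.+1) (ltW l2) (ltW l3); rewrite (min_idPr (ltW d3)) => E.
    by rewrite asignS !mulNr ltrN2 E.
  have [l1 l2 _] := Z i ni.
  have [h|h] := ltnP i.+1 n; last first.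
    have E : i.+1 = n by apply/eqP; rewrite eqn_leq ni h.
    by rewrite E tn uu1 -tn -E.
  have [c [d1 d2 d3 d4 d5]] := cut i h; have [l3 l4 _] := Z i.+1 h.
  by rewrite (d5 (t i.+1) (ltW l2) (ltW l3)) (min_idPr (ltW d3)).
- by move=> x x0 xz; rewrite uE; [exact: uw1|apply: (le_trans xz); exact: zmono].
- by move=> x; rewrite nE /= => xz x1; have [k1 _] := uJ x xz; rewrite /u k1.
Qed.

Lemma sol_piecewise_smono n t s T w u p : ucont w -> ucont u -> sol 0 1 T w u p ->
  piecewise_smono n t s w -> piecewise_smono n t s u.
Proof.
move=> cw cu S pw; have [t0 tn ts] := pw; split => // i ni; have [h1 h2 h3] := ts i ni; split => //.
apply: (sol_smono h2 cw cu S) => //.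
  exact: piecewise_smono_ge0 pw (ltnW ni).
exact: piecewise_smono_le1 pw ni.
Qed.

Lemma sol_exists n t s T w : ucont w -> piecewise_smono n t s w -> 0 <= T ->
  exists u p, sol 0 1 T w u p /\ ucont u.
Proof.
move=> cw pw T0.
apply: (@interval_ind _ (fun T => exists u p, sol 0 1 T w u p /\ ucont u) 0 T T0 _ _ _ T T0 (lexx _)).
- exists w, (fun=> 0); split => //; split => //.
  + by move=> x _ _; rewrite normr0.
  + move=> x y _ xy _; rewrite subrr; transitivity (\int[mu]_(t in `[x, y]) (0 : R)).
      by rewrite Rint_cst// mul0r.
    by apply: eq_Rintegral => z _; rewrite subrr.
  + by move=> x y _ xy _ /(_ x (lexx _) xy); rewrite oppr0 ltxx.
  + by move=> x y _ xy _ /(_ x (lexx _) xy); rewrite ltxx.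
- move=> S S0 ST [u [p [Su cu]]].
  have [n' [t' [s' A]]] := piecewise_zigzag (sol_piecewise_smono cw cu Su pw).
  have [z Z] := mid_point_ex cu A; have [e e0 H] := small_cut cu A Z; exists e => // y Sy ye yT.
  move: Sy; rewrite le_eqVlt => /predU1P[<-|Sy]; first by exists u, p.
  have [u' [p' [[Su' cu'] _ _ _ _]]] := H (y - S) ltac:(lin) ltac:(lin).
  exists u', (fun x => p x + p' x); split => //.
  by have := sol_comp cw cu cu' Su Su'; rewrite (_ : S + (y - S) = y)//; ring.
- move=> S S0 ST H.
  pose Tk (k : nat) := S - S / k.+1%:R.
  have Tk0 k : 0 <= Tk k /\ Tk k < S.
    rewrite /Tk; have k0 : (0 : R) < k.+1%:R by rewrite ltr0n.
    have h1 : 0 < S / k.+1%:R by rewrite divr_gt0.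
    have h2 : S / k.+1%:R <= S by rewrite ler_pdivrMr// ler_peMr ?(ltW S0)// -[1](mulr1n 1) ler_nat.
    by rewrite subr_ge0 h2 ltrBlDr ltrDl h1.
  have /choice[up Hup] : forall k, exists up : (R -> R) * (R -> R), sol 0 1 (Tk k) w up.1 up.2 /\ ucont up.1.
    by move=> k; have [h1 h2] := Tk0 k; have [u [p h]] := H _ h1 h2; exists (u, p).
  apply: (@sol_limit _ Tk S w (fun k => (up k).1) (fun k => (up k).2)) => //.
  + by move=> k; have [] := Hup k.
  + by move=> k; have [] := Hup k.
  + move=> j k jk; rewrite /Tk lerD2l lerN2 ler_pM2l//.
    by rewrite lef_pV2 ?posrE ?ltr0n// ler_nat.
  + by move=> k; have [_ /ltW] := Tk0 k.
  + move=> e e0; have [K [HK _]] : exists K : nat, S / e < K%:R /\ True.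
      by exists (Num.truncn (S / e)).+1; split => //; apply: truncnS_gt.
    exists K => k Kk; rewrite /Tk opprB addrC subrK ler_pdivrMr ?ltr0n//.
    rewrite mulrC -ler_pdivrMr//; apply: (le_trans (ltW HK)).
    by rewrite ler_nat (leq_trans Kk).
Qed.

End small_cut.

(** * One-sided derivatives of primitives of BV functions *)

Section one_sided_derivatives.
Context {R : realType}.
Notation mu := (@lebesgue_measure R).
Implicit Types (f g phi psi : R -> R) (a b c d x y z V : R).

Notation ucont := (ucont_on 0 1).

Lemma right_derivative_affine f x (k e : R) : 0 < e ->
  (forall y, x <= y -> y < x + e -> f y = f x + k * (y - x)) -> right_derivative f x k.
Proof.
move=> e0 fE; apply: (@cvg_trans _ ((cst k : R -> R) @ 0^'+)); last exact: cvg_cst.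
apply: near_eq_cvg; near=> h.
have h0 : 0 < h by near: h; exact: nbhs_right_gt.
have he : h < e by near: h; exact: nbhs_right_lt.
rewrite fE; [|lin|lin].
have -> : f x + k * (x + h - x) - f x = h * k by ring.
by rewrite /= mulKf ?gt_eqF.
Unshelve. all: by end_near. Qed.

Lemma left_derivative_affine f x (k e : R) : 0 < e ->
  (forall y, y <= x -> x - e < y -> f y = f x + k * (y - x)) -> left_derivative f x k.
Proof.
move=> e0 fE; apply: (@cvg_trans _ ((cst k : R -> R) @ 0^'-)); last exact: cvg_cst.
apply: near_eq_cvg; near=> h.
have h0 : h < 0 by near: h; exact: nbhs_left_lt.
have he : - e < h by near: h; apply: nbhs_left_gt; lin.
rewrite fE; [|lin|lin].
have -> : f x + k * (x + h - x) - f x = h * k by ring.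
by rewrite /= mulKf ?lt_eqF.
Unshelve. all: by end_near. Qed.

Lemma right_derivative_eq f h x (k e : R) : 0 < e ->
  (forall y, x <= y -> y < x + e -> f y = h y) ->
  right_derivative f x k -> right_derivative h x k.
Proof.
move=> e0 fh; apply: cvg_trans; apply: near_eq_cvg; near=> r.
have r0 : 0 < r by near: r; exact: nbhs_right_gt.
have re : r < e by near: r; exact: nbhs_right_lt.
by rewrite !fh//; lin.
Unshelve. all: by end_near. Qed.

Lemma left_derivative_eq f h x (k e : R) : 0 < e ->
  (forall y, y <= x -> x - e < y -> f y = h y) ->
  left_derivative f x k -> left_derivative h x k.
Proof.
move=> e0 fh; apply: cvg_trans; apply: near_eq_cvg; near=> r.
have r0 : r < 0 by near: r; exact: nbhs_left_lt.
have re : - e < r by near: r; apply: nbhs_left_gt; lin.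
by rewrite !fh//; lin.
Unshelve. all: by end_near. Qed.

(** Closed on the left and open on the right, like the right derivative of a piecewise affine
    function. *)
Definition step p q (k : R) x := if (p <= x) && (x < q) then k else 0.

Lemma step_restrict g p q k : (fun x => g x * step p q k x) =
  (fun x => k * g x) \_ `[p, q[.
Proof.
apply/funext => x; rewrite patchE /step.
have -> : (x \in `[p, q[%classic) = (p <= x) && (x < q).
  by apply/idP/idP => [/set_mem|h]; [rewrite /= in_itv|apply/mem_set; rewrite /= in_itv].
by case: ifP => _; rewrite ?mulr0// mulrC.
Qed.

Lemma itv01I p q : 0 < p -> q <= 1 -> `]0, 1[ `&` `[p, q[ = `[p, q[%classic :> set R.
Proof.
move=> p0 q1; apply/seteqP; split => x; first by case.
rewrite /= !in_itv/= => /andP[px xq]; split; last exact/andP.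
by apply/andP; split; [exact: lt_le_trans px|exact: lt_le_trans q1].
Qed.

Lemma integrable_step g p q k : mu.-integrable `[0, 1] (EFin \o g) -> 0 <= p -> q <= 1 ->
  mu.-integrable `]0, 1[ (EFin \o (fun x => g x * step p q k x)).
Proof.
move=> ig p0 q1; rewrite step_restrict -restrict_EFin.
have igp : mu.-integrable `[p, q[ (EFin \o g).
  apply: integrableS ig => //; by apply: subset_itv; rewrite bnd_simp.
have := @integrableZl _ _ R mu `[p, q[%classic (measurable_itv _) k _ igp.
have [h _] := @integrable_mkcond _ _ R mu `[p, q[%classic (EFin \o (fun x => k * g x)) (measurable_itv _).
by move=> /h; apply: integrableS.
Qed.

Lemma Rintegral_step g p q k : mu.-integrable `[0, 1] (EFin \o g) -> 0 < p -> q <= 1 ->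
  \int[mu]_(x in `]0, 1[) (g x * step p q k x) = k * \int[mu]_(x in `[p, q]) g x.
Proof.
move=> ig p0 q1.
have igp : mu.-integrable `[p, q[ (EFin \o g).
  apply: integrableS ig => //; apply: subset_itv; rewrite bnd_simp//; exact: ltW.
rewrite step_restrict -Rintegral_mkcondr itv01I// RintegralZl//.
by rewrite Rintegral_itv_bndo_bndc.
Qed.

Lemma right_derivative_clamp p q x : p < q -> right_derivative (clamp p q) x (step p q 1 x).
Proof.
move=> pq; rewrite /step; case: (ltP x p) => xp /=.
  apply: (@right_derivative_affine _ _ _ (p - x)); first lin.
  by move=> y xy yx; rewrite /clamp ifT ?ifT//; lin.
case: (ltP x q) => xq /=.
  apply: (@right_derivative_affine _ _ _ (q - x)); first lin.
  by move=> y xy yx; rewrite !clamp_id; lin.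
apply: (@right_derivative_affine _ _ _ 1) => // y xy yx.
have H z : q <= z -> clamp p q z = q.
  by move=> qz; rewrite /clamp; case: ifPn => [|_]; [lin|case: ifPn; rewrite -?leNgt; lin].
by rewrite !H; lin.
Qed.

Lemma right_derivativeD f h x k l : right_derivative f x k -> right_derivative h x l ->
  right_derivative (f \+ h) x (k + l).
Proof.
move=> fk hl; apply: cvg_trans (cvgD fk hl); apply: near_eq_cvg.
by apply: nearW => r; rewrite !fctE /=; ring.
Qed.

Lemma right_derivativeZ f x k l : right_derivative f x k ->
  right_derivative (fun y => l * f y) x (l * k).
Proof.
move=> fk; apply: cvg_trans (cvgM (cvg_cst l) fk); apply: near_eq_cvg.
by apply: nearW => r; rewrite /=; ring.
Qed.

Definition slope f x y := (f y - f x) / (y - x).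

Lemma clamp_outl p q x : p <= q -> x <= p -> clamp p q x = p.
Proof. by move=> pq xp; rewrite /clamp; case: ifPn; rewrite -?leNgt => // ?; case: ifPn => // ?; lin. Qed.

Lemma clamp_outr p q x : p <= q -> q <= x -> clamp p q x = q.
Proof. by move=> pq qx; rewrite /clamp; case: ifPn => [?|_]; [lin|case: ifPn; rewrite -?leNgt; lin]. Qed.

(** The test function rises linearly from 0 to 1 on [[p, q]], stays 1 up to [r] and falls back to 0
    on [[r, s]]; integrating the derivative of [f] against its slopes gives the difference of the
    two chord slopes. *)
Lemma slope_variation f a b V p q r s : ftc_on f -> dvar_le a b (derive1 f) V ->
  0 <= a -> a < p -> p < q -> q <= r -> r < s -> s < b -> b <= 1 ->
  `|slope f p q - slope f r s| <= V.
Proof.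
move=> [ig F] gV a0 ap pq qr rs sb b1.
suff H e : e = 1 \/ e = -1 -> e * (slope f p q - slope f r s) <= V.
  rewrite ler_norml; apply/andP; split.
    by have := H (-1) (or_intror erefl); lin.
  by have := H 1 (or_introl erefl); rewrite mul1r.
move=> e1.
pose k1 := (q - p)^-1; pose k2 := (s - r)^-1.
have k10 : 0 < k1 by rewrite invr_gt0 subr_gt0.
have k20 : 0 < k2 by rewrite invr_gt0 subr_gt0.
have k1E : k1 * (q - p) = 1 by rewrite mulVf// subr_eq0 gt_eqF.
have k2E : k2 * (s - r) = 1 by rewrite mulVf// subr_eq0 gt_eqF.
pose phi x := e * (k1 * (clamp p q x - p)) + (- e) * (k2 * (clamp r s x - r)).
have en : `|e| = 1 by case: e1 => ->; rewrite ?normrN normr1.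
have phi01 x : 0 <= k1 * (clamp p q x - p) - k2 * (clamp r s x - r) <= 1.
  have unit k u v c : 0 < k -> k * (v - u) = 1 -> u <= c <= v -> 0 <= k * (c - u) <= 1.
    move=> k0 kE /andP[uc cv]; rewrite -kE pmulr_rge0// ler_pM2l//; apply/andP; split; lin.
  have /andP[A1 A2] := unit k1 p q (clamp p q x) k10 k1E (introT andP (conj (clamp_ge x (ltW pq)) (clamp_le x (ltW pq)))).
  have /andP[B1 B2] := unit k2 r s (clamp r s x) k20 k2E (introT andP (conj (clamp_ge x (ltW rs)) (clamp_le x (ltW rs)))).
  have [xq|qx] := leP x r.
    by move: B1 B2; rewrite (clamp_outl (ltW rs) xq) subrr mulr0 subr0 => _ _; apply/andP.
  have cq : clamp p q x = q by apply: clamp_outr; lin.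
  move: A1 A2; rewrite cq.
  by rewrite k1E => _ _; apply/andP; split; lin.
have Lphi : lipschitz_by (k1 + k2) phi.
  move=> x y.
  have -> : phi x - phi y = e * (k1 * (clamp p q x - clamp p q y) - k2 * (clamp r s x - clamp r s y)).
    by rewrite /phi; ring.
  rewrite normrM en mul1r mulrDl; apply: (le_trans (ler_normB _ _)).
  rewrite !normrM (gtr0_norm k10) (gtr0_norm k20).
  by apply: lerD; rewrite ler_pM2l//; apply: clamp_dist; lin.
have := @lipschitz_test R a b p s phi
  (fun x => step p q (e * k1) x + step r s (- e * k2) x) _ (derive1 f) V Lphi _ ap sb _ _ _ ig gV.
rewrite (_ : \int[mu]_(x in _) _ = e * (slope f p q - slope f r s)); last first.
  transitivity (\int[mu]_(x in `]0, 1[) (derive1 f x * step p q (e * k1) x + derive1 f x * step r s (- e * k2) x)).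
    by apply: eq_Rintegral => x _; rewrite mulrDr.
  rewrite RintegralD//; [|apply: integrable_step => //; lin..].
  rewrite !Rintegral_step//; [|lin..].
  rewrite !F; [|lin..].
  by rewrite /slope -/k1 -/k2; ring.
apply; first lin.
- move=> x; rewrite in_itv/= negb_and -!ltNge /phi => /orP[h|h].
    rewrite !clamp_outl; [|lin..]; ring.
  rewrite !clamp_outr; [|lin..]; rewrite k1E k2E; ring.
- move=> x; have -> : phi x = e * (k1 * (clamp p q x - p) - k2 * (clamp r s x - r)).
    by rewrite /phi; ring.
  by rewrite normrM en mul1r; have /andP[h1 h2] := phi01 x; rewrite ger0_norm.
- move=> x _.
  have stepM u v (k l : R) : step u v (l * k) x = (l * k) * step u v 1 x.
    by rewrite /step; case: ifP => _; rewrite ?mulr1 ?mulr0.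
  rewrite !stepM.
  have h1 := right_derivativeZ (l := e * k1) (@right_derivative_clamp p q x pq).
  have h2 := right_derivativeZ (l := - e * k2) (@right_derivative_clamp r s x rs).
  have := right_derivativeD h1 h2.
  apply: cvg_trans; apply: near_eq_cvg; apply: nearW => h /=; rewrite /phi; ring.
Qed.

(** Disjoint supports preserve the bound by 1, so that the variations over adjacent intervals add
    up. *)
Lemma test_inD a c b phi psi : a < c -> c < b -> test_in a c phi -> test_in c b psi ->
  test_in a b (phi \+ psi).
Proof.
move=> ac cb [dphi cphi [e [d [ae dc phi0]]] phi1] [dpsi cpsi [e' [d' [ae' dc' psi0]]] psi1].
have D x : derive1 (phi \+ psi) x = derive1 phi x + derive1 psi x.
  by rewrite !derive1E deriveD.
split.
- by move=> x; exact: derivableD.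
- rewrite (_ : derive1 _ = derive1 phi \+ derive1 psi); last exact/funext.
  by move=> x; apply: cvgD; [exact: cphi|exact: cpsi].
- exists (Num.min e e'), (Num.max d d'); split.
  + by rewrite lt_min ae; lin.
  + by rewrite gt_max dc'; lin.
  + move=> x; rewrite in_itv/= le_max ge_min negb_and !negb_or -!ltNge => h.
    rewrite /= phi0 ?psi0 ?addr0//; rewrite in_itv/= negb_and -!ltNge;
      by case/orP: h => /andP[h1 h2]; rewrite ?h1 ?h2 ?orbT.
- move=> x /=; have [xd|dx] := leP x d.
    rewrite (psi0 x) ?addr0// in_itv/= negb_and -!ltNge; apply/orP; left; lin.
  rewrite (phi0 x) ?add0r// in_itv/= negb_and -!ltNge; apply/orP; right; lin.
Qed.

Lemma test_in_shrinkl a b phi : a < b -> test_in a b phi ->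
  exists c, [/\ a < c, c < b & test_in c b phi].
Proof.
move=> ab [d1 d2 [e [d [ae db phi0]]] d3]; pose m := Num.min e b.
have am : a < m by rewrite lt_min ae.
have me : m <= e by rewrite ge_min lexx.
have mb : m <= b by rewrite ge_min lexx orbT.
exists ((a + m) / 2); split; [lin|lin|].
by split => //; exists e, d; split => //; lin.
Qed.

Lemma test_in_shrinkr a b phi : a < b -> test_in a b phi ->
  exists c, [/\ a < c, c < b & test_in a c phi].
Proof.
move=> ab [d1 d2 [e [d [ae db phi0]]] d3]; pose m := Num.max d a.
have am : m < b by rewrite gt_max db.
have me : d <= m by rewrite le_max lexx.
have mb : a <= m by rewrite le_max lexx orbT.
exists ((b + m) / 2); split; [lin|lin|].
by split => //; exists e, d; split => //; lin.
Qed.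

Lemma test_in_sub a b a' b' phi : a' <= a -> b <= b' -> test_in a b phi -> test_in a' b' phi.
Proof.
move=> aa bb [d1 d2 [e [d [ae db phi0]]] d3]; split => //.
by exists e, d; split => //; lin.
Qed.

Lemma test_in_integrable a b g phi : mu.-integrable `[0, 1] (EFin \o g) -> test_in a b phi ->
  mu.-integrable `]0, 1[ (EFin \o (fun x => g x * derive1 phi x)).
Proof.
move=> ig [dphi cphi _ _].
have {}ig : mu.-integrable `]0, 1[ (EFin \o g).
  by apply: integrableS ig => //; exact: subset_itv_oo_cc.
have [M [_ MM]] := @compact_bounded R R _ (@continuous_compact _ _ (derive1 phi) _ (continuous_subspaceT cphi) (@segment_compact R 0 1)).
pose K := `|M| + 1.
have KK x : `]0, 1[%classic x -> `|derive1 phi x| <= K.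
  move=> x01; apply: (MM K); first by rewrite /K ltr_pwDr// ler_norm.
  by exists x => //; exact: subset_itv_oo_cc x01.
have iag := integrable_norm ig.
have iKg := @integrableZl _ _ R mu `]0, 1[%classic (measurable_itv _) K _ iag.
apply: le_integrable iKg => //; last first.
  move=> x x01 /=; rewrite lee_fin normrM [leRHS]ger0_norm; last by rewrite mulr_ge0 ?addr_ge0.
  by rewrite mulrC ler_wpM2r// KK.
apply/measurable_EFinP; apply: measurable_funM.
  by apply/measurable_EFinP; exact: measurable_int ig.
by apply: measurable_funTS; exact: continuous_measurable_fun.
Qed.

Lemma Rintegral_testD g phi psi a b a' b' : mu.-integrable `[0, 1] (EFin \o g) ->
  test_in a b phi -> test_in a' b' psi ->
  \int[mu]_(x in `]0, 1[) (g x * derive1 (phi \+ psi) x) =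
  \int[mu]_(x in `]0, 1[) (g x * derive1 phi x) + \int[mu]_(x in `]0, 1[) (g x * derive1 psi x).
Proof.
move=> ig tphi tpsi.
rewrite -RintegralD//; [|exact: test_in_integrable tphi|exact: test_in_integrable tpsi].
apply: eq_Rintegral => x _; rewrite !derive1E deriveD ?mulrDr//.
  by have [] := tphi.
by have [] := tpsi.
Qed.

(** Otherwise every right neighbourhood of [x] carries a test with integral above [e]. Its support
    keeps a distance from [x], so the next test fits between; sums of such tests with disjoint
    supports exceed any bound [V]. *)
Lemma dvar_small_right g V x e : mu.-integrable `[0, 1] (EFin \o g) -> dvar_le 0 1 g V ->
  0 <= x -> x < 1 -> 0 < e -> exists2 d, 0 < d & x + d <= 1 /\ dvar_le x (x + d) g e.
Proof.
move=> ig gV x0 x1 e0; apply: contrapT => N.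
have step_ d : x < d -> d <= 1 -> exists2 phi, test_in x d phi &
    e < \int[mu]_(t in `]0, 1[) (g t * derive1 phi t).
  move=> d0 xd1; apply: contrapT => N'; apply: N; exists (d - x); first lin.
  rewrite addrC subrK; split => // phi tphi.
  by rewrite leNgt; apply/negP => h; apply: N'; exists phi.
have H (k : nat) : exists c phi, [/\ x < c, c < 1, test_in c 1 phi &
    k.+1%:R * e <= \int[mu]_(t in `]0, 1[) (g t * derive1 phi t)].
  elim: k => [|k [c [phi [xc c1 tphi phiV]]]].
    have [phi tphi phiV] := step_ 1 x1 (lexx _).
    have [c [xc c1 tc]] := test_in_shrinkl x1 tphi.
    by exists c, phi; split => //; rewrite mul1r ltW.
  have [psi tpsi psiV] := step_ c xc (ltW c1).
  have [c' [xc' cc' tc']] := test_in_shrinkl xc tpsi.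
  exists c', (psi \+ phi); split; [exact: xc'|exact: lt_trans cc' c1|exact: (test_inD cc' c1 tc' tphi)|].
  have -> : k.+2%:R * e = e + k.+1%:R * e by rewrite -natr1 mulrDl mul1r addrC.
  rewrite [leRHS](Rintegral_testD ig tc' tphi); exact: (lerD (ltW psiV) phiV).
have [k kV] : exists k : nat, V < k.+1%:R * e.
  exists (Num.bound (V / e)); rewrite -ltr_pdivrMr//.
  by apply: (lt_trans (ltr_bound _)); rewrite ltr_nat.
have [c [phi [xc c1 tphi phiV]]] := H k.
have h := gV phi (test_in_sub (ltW (le_lt_trans x0 xc)) (lexx _) tphi).
by have := lt_le_trans kV (le_trans phiV h); rewrite ltxx.
Qed.

Lemma dvar_small_left g V x e : mu.-integrable `[0, 1] (EFin \o g) -> dvar_le 0 1 g V ->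
  0 < x -> x <= 1 -> 0 < e -> exists2 d, 0 < d & 0 <= x - d /\ dvar_le (x - d) x g e.
Proof.
move=> ig gV x0 x1 e0; apply: contrapT => N.
have step_ d : d < x -> 0 <= d -> exists2 phi, test_in d x phi &
    e < \int[mu]_(t in `]0, 1[) (g t * derive1 phi t).
  move=> d0 xd1; apply: contrapT => N'; apply: N; exists (x - d); first lin.
  rewrite opprB addrC subrK; split => // phi tphi.
  by rewrite leNgt; apply/negP => h; apply: N'; exists phi.
have H (k : nat) : exists c phi, [/\ c < x, 0 < c, test_in 0 c phi &
    k.+1%:R * e <= \int[mu]_(t in `]0, 1[) (g t * derive1 phi t)].
  elim: k => [|k [c [phi [xc c1 tphi phiV]]]].
    have [phi tphi phiV] := step_ 0 x0 (lexx _).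
    have [c [xc c1 tc]] := test_in_shrinkr x0 tphi.
    by exists c, phi; split => //; rewrite mul1r ltW.
  have [psi tpsi psiV] := step_ c xc (ltW c1).
  have [c' [cc' xc' tc']] := test_in_shrinkr xc tpsi.
  exists c', (phi \+ psi); split; [exact: xc'|exact: lt_trans c1 cc'|exact: (test_inD c1 cc' tphi tc')|].
  have -> : k.+2%:R * e = k.+1%:R * e + e by rewrite -natr1 mulrDl mul1r.
  rewrite [leRHS](Rintegral_testD ig tphi tc'); exact: (lerD phiV (ltW psiV)).
have [k kV] : exists k : nat, V < k.+1%:R * e.
  exists (Num.bound (V / e)); rewrite -ltr_pdivrMr//.
  by apply: (lt_trans (ltr_bound _)); rewrite ltr_nat.
have [c [phi [xc c1 tphi phiV]]] := H k.
have h := gV phi (test_in_sub (lexx _) (ltW (lt_le_trans xc x1)) tphi).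
by have := lt_le_trans kV (le_trans phiV h); rewrite ltxx.
Qed.

(** The hypothesis concerns only chords strictly inside the interval. Shrinking the interval by [m]
    at both ends costs at most [eta] in total, by continuity of [f] and the smallness of
    [k * (m + m)]. *)
Lemma increment_bound f a b (k e : R) : ucont_on a b f -> a < b -> 0 <= e ->
  (forall x y, a < x -> x < y -> y < b -> `|slope f x y - k| <= e) ->
  `|f b - f a - k * (b - a)| <= e * (b - a).
Proof.
move=> cf ab e0 H; apply/ler_addgt0Pr => eta eta0.
have eta40 : 0 < eta / 4 by lin.
have [d d0 fd] := cf _ eta40.
have [K [K0 kK]] : exists K, 0 < K /\ `|k| <= K.
  by exists (`|k| + 1); have := normr_ge0 k; split; lin.
have [m [m0 mab md mK]] : exists m, [/\ 0 < m, m <= (b - a) / 3, m <= d / 2 & m <= eta / 4 / K].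
  exists (Num.min ((b - a) / 3) (Num.min (d / 2) (eta / 4 / K))).
  by rewrite !lt_min !ge_min !lexx !orbT !divr_gt0 ?subr_gt0.
rewrite ler_pdivlMr// in mK.
have fa : `|f (a + m) - f a| < eta / 4.
  by apply: fd; [lin|lin|lin|lin|rewrite ltr_norml; apply/andP; split; lin].
have fb : `|f b - f (b - m)| < eta / 4.
  by apply: fd; [lin|lin|lin|lin|rewrite ltr_norml; apply/andP; split; lin].
have L : f (b - m) - f (a + m) = slope f (a + m) (b - m) * (b - m - (a + m)).
  by rewrite /slope divfK// subr_eq0 gt_eqF//; lin.
have {}H : `|slope f (a + m) (b - m) - k| <= e by apply: H; lin.
have -> : f b - f a - k * (b - a) = (f b - f (b - m)) + (f (a + m) - f a)
    + (slope f (a + m) (b - m) - k) * (b - m - (a + m)) - k * (m + m).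
  by rewrite [(slope _ _ _ - k) * _]mulrBl -L; ring.
have e1 : `|(slope f (a + m) (b - m) - k) * (b - m - (a + m))| <= e * (b - a).
  rewrite normrM; have w0 : 0 <= b - m - (a + m) by lin.
  by rewrite (ger0_norm w0); apply: ler_pM => //; lin.
have e2 : `|k * (m + m)| <= eta / 4 + eta / 4.
  rewrite normrM (ger0_norm (_ : 0 <= m + m)); last lin.
  by apply: (@le_trans _ _ (K * (m + m))); [apply: ler_wpM2r => //; lin|rewrite mulrDr mulrC; lin].
apply: (le_trans (ler_normB _ _)); apply: (le_trans (lerD (ler_normD _ _) (lexx _))).
apply: (le_trans (lerD (lerD (ler_normD _ _) (lexx _)) (lexx _))).
lin.
Qed.

(** Cauchy criterion: on a right neighbourhood with variation at most [e / 2] all earlier chords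
    have slopes close to that of the fixed chord over [[r, s]], and so do the difference quotients
    at [x]. *)
Lemma ftc_right_derivative f V x : ucont f -> ftc_on f -> dvar_le 0 1 (derive1 f) V ->
  0 <= x -> x < 1 -> exists k, right_derivative f x k.
Proof.
move=> cf ftcf fV x0 x1.
apply/cvg_ex => /=; apply/cauchy_cvgP/cauchy_exP => e e0 /=.
have e20 : 0 < e / 2 by lin.
have [d d0 [xd1 dvd]] := dvar_small_right ftcf.1 fV x0 x1 e20.
have [r rE] : exists r, r = x + d / 2 by exists (x + d / 2).
have [s sE] : exists s, s = x + d * (3 / 4) by exists (x + d * (3 / 4)).
exists (slope f r s); rewrite /ball/=; near=> h.
have h0 : 0 < h by near: h; exact: nbhs_right_gt.
have hd : h < d / 2 by near: h; apply: nbhs_right_lt; lin.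
have key : `|f (x + h) - f x - slope f r s * (x + h - x)| <= e / 2 * (x + h - x).
  apply: increment_bound; [|lin|exact: ltW|].
    by move=> eta eta0; have [d' d'0 H] := cf _ eta0; exists d' => // *; apply: H => //; lin.
  by move=> p q xp pq qh; apply: (slope_variation ftcf dvd) => //; lin.
rewrite [x + h]addrC addrK in key.
change (`|slope f r s - h^-1 * (f (x + h) - f x)| < e).
have -> : slope f r s - h^-1 * (f (x + h) - f x) = - h^-1 * (f (h + x) - f x - slope f r s * h).
  by rewrite [h + x]addrC; field; rewrite gt_eqF.
rewrite normrM normrN normfV (gtr0_norm h0) ltr_pdivrMl//.
by apply: (le_lt_trans key); rewrite mulrC ltr_pM2l//; lin.
Unshelve. all: by end_near. Qed.

Lemma ftc_left_derivative f V x : ucont f -> ftc_on f -> dvar_le 0 1 (derive1 f) V ->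
  0 < x -> x <= 1 -> exists k, left_derivative f x k.
Proof.
move=> cf ftcf fV x0 x1.
apply/cvg_ex => /=; apply/cauchy_cvgP/cauchy_exP => e e0 /=.
have e20 : 0 < e / 2 by lin.
have [d d0 [xd1 dvd]] := dvar_small_left ftcf.1 fV x0 x1 e20.
have [r rE] : exists r, r = x - d / 2 by exists (x - d / 2).
have [s sE] : exists s, s = x - d * (3 / 4) by exists (x - d * (3 / 4)).
exists (slope f s r); rewrite /ball/=; near=> h.
have h0 : h < 0 by near: h; exact: nbhs_left_lt.
have hd : - (d / 2) < h by near: h; apply: nbhs_left_gt; lin.
have key : `|f x - f (x + h) - slope f s r * (x - (x + h))| <= e / 2 * (x - (x + h)).
  apply: increment_bound; [|lin|exact: ltW|].
    by move=> eta eta0; have [d' d'0 H] := cf _ eta0; exists d' => // *; apply: H => //; lin.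
  by move=> p q xp pq qh; rewrite distrC; apply: (slope_variation ftcf dvd) => //; lin.
have xh : x - (x + h) = - h by ring.
rewrite xh in key.
change (`|slope f s r - h^-1 * (f (x + h) - f x)| < e).
have -> : slope f s r - h^-1 * (f (x + h) - f x) = h^-1 * (f x - f (x + h) - slope f s r * - h).
  by field; rewrite lt_eqF.
rewrite normrM normfV (ltr0_norm h0) ltr_pdivrMl ?oppr_gt0//.
by apply: (le_lt_trans key); rewrite mulrC ltr_pM2l ?oppr_gt0//; lin.
Unshelve. all: by end_near. Qed.

End one_sided_derivatives.

(** * Flattening a function between two points of the same level *)

Section flat_on.
Context {R : realType}.
Notation mu := (@lebesgue_measure R).
Notation ucont := (ucont_on 0 1).
Implicit Types (f g w phi psi : R -> R) (a b c d x y z V al be : R).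

Lemma measurable_eq_off (D : set R) (s : seq R) f g : measurable D -> measurable_fun D g ->
  (forall x, D x -> x \notin s -> f x = g x) -> measurable_fun D f.
Proof.
move=> mD mg; elim: s f => [|a s IH] f fg.
  by apply: eq_measurable_fun mg => x /set_mem xD; rewrite fg.
pose h x := if x == a then g a else f x.
have mh : measurable_fun D h.
  apply: IH => x xD xs; rewrite /h; case: eqVneq => [->//|xa].
  by apply: fg => //; rewrite in_cons negb_or xa.
apply: (@eq_measurable_fun _ _ _ _ D (fun x => h x + (f a - h a) * \1_[set a] x)).
  move=> x _; rewrite /h indicE; case: (eqVneq x a) => [->|xa].
    by rewrite eqxx mem_set// mulr1 addrC subrK.
  by rewrite memNset ?mulr0 ?addr0//; exact/eqP.
by apply: measurable_funD => //; apply: measurable_funM => //; exact: measurable_funTS.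
Qed.

Lemma finite_negligible (s : seq R) : mu.-negligible [set x | x \in s].
Proof.
exists [set x | x \in s]; split => //.
  elim: s => [|a s IH]; first by rewrite (_ : [set x | _] = set0)//; apply/seteqP; split.
  rewrite (_ : [set x | _] = [set a] `|` [set x | x \in s]); first exact: measurableU.
  apply/seteqP; split => x /=; rewrite in_cons; first by case/predU1P; [left|right].
  by case=> [->|->]; rewrite ?eqxx ?orbT.
apply: countable_lebesgue_measure0; apply: finite_set_countable.
exact: finite_seq.
Qed.

Lemma ae_eq_off (D : set R) (s : seq R) (f g : R -> R) :
  (forall x, D x -> x \notin s -> f x = g x) -> ae_eq mu D (EFin \o f) (EFin \o g).
Proof.
move=> fg; apply: negligibleS (finite_negligible s) => x /= /not_implyP[Dx] fgx.
by apply: contrapT => /negP xs; apply: fgx; rewrite fg.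
Qed.

(** Meant for derivatives of functions with finitely many corners, where [derive1] takes
    uncontrolled or default values. *)
Lemma integrable_eq_off (D : set R) (s : seq R) f g : measurable D ->
  mu.-integrable D (EFin \o g) -> (forall x, D x -> x \notin s -> f x = g x) ->
  mu.-integrable D (EFin \o f) /\
  (\int[mu]_(x in D) (f x)%:E = \int[mu]_(x in D) (g x)%:E)%E.
Proof.
move=> mD ig fg.
have mg : measurable_fun D g by apply/measurable_EFinP; exact: measurable_int ig.
have mf : measurable_fun D f by exact: measurable_eq_off fg.
have E h k : measurable_fun D h -> measurable_fun D k ->
    (forall x, D x -> x \notin s -> h x = k x) ->
    (\int[mu]_(x in D) (h x)%:E = \int[mu]_(x in D) (k x)%:E)%E.
  move=> mh mk hk; apply: ae_eq_integral => //; try exact/measurable_EFinP.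
  exact: ae_eq_off hk.
split; last exact: E.
apply/integrableP; split; first exact/measurable_EFinP.
case/integrableP: ig => _; apply: le_lt_trans.
rewrite (_ : integral _ _ _ = \int[mu]_(x in D) (`|f x|)%:E)%E; last first.
  by apply: eq_integral => x _; rewrite abse_EFin.
rewrite (E (fun x => `|f x|) (fun x => `|g x|)) ?lexx//; try exact: measurableT_comp.
by move=> x Dx xs; rewrite fg.
Qed.

Definition flat_on w al be x := if (al <= x) && (x <= be) then w al else w x.

Lemma flat_on_in w al be x : al <= x -> x <= be -> flat_on w al be x = w al.
Proof. by move=> h1 h2; rewrite /flat_on h1 h2. Qed.

Lemma flat_on_le w al be x : x <= al -> flat_on w al be x = w x.
Proof. by move=> h; rewrite /flat_on; case: ifP => // /andP[h1 _]; congr w; lin. Qed.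

Lemma flat_on_ge w al be x : w al = w be -> be <= x -> flat_on w al be x = w x.
Proof. by move=> E h; rewrite /flat_on; case: ifP => // /andP[_ h1]; rewrite E; congr w; lin. Qed.

Lemma near_eq_derive1 f h x : (\forall y \near x, f y = h y) -> derive1 f x = derive1 h x.
Proof. by move=> fh; rewrite !derive1E; exact: near_eq_derive. Qed.

Lemma open_itv_derive1 f h x c d : c < x -> x < d ->
  (forall y, c < y -> y < d -> f y = h y) -> derive1 f x = derive1 h x.
Proof.
move=> cx xd fh; apply: near_eq_derive1; near=> y; apply: fh.
- by near: y; exact: lt_nbhsr.
- by near: y; exact: lt_nbhsl.
Unshelve. all: by end_near. Qed.

Lemma flat_on_derive1 w al be x : w al = w be -> x != al -> x != be ->
  derive1 (flat_on w al be) x = if (al < x) && (x < be) then 0 else derive1 w x.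
Proof.
move=> E xa xb; case: ifP => [/andP[ax xbe]|].
  rewrite (@open_itv_derive1 _ (cst (w al)) x al be)// ?derive1_cst//.
  by move=> y h1 h2; rewrite flat_on_in// ltW.
move=> /negbT; rewrite negb_and -!leNgt !le_eqVlt (negbTE xa) [be == x]eq_sym (negbTE xb) /=.
case/orP => h.
  by apply: (@open_itv_derive1 _ _ x (x - 1) al) => // [|y _ ya]; [lin|rewrite flat_on_le// ltW].
by apply: (@open_itv_derive1 _ _ x be (x + 1)) => // [|y ya _]; [lin|rewrite flat_on_ge// ltW].
Qed.

Definition one_sided f :=
  (forall x, 0 <= x -> x < 1 -> exists k, right_derivative f x k) /\
  (forall x, 0 < x -> x <= 1 -> exists k, left_derivative f x k).

Lemma flat_on_one_sided w al be : al < be -> w al = w be ->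
  one_sided w -> one_sided (flat_on w al be).
Proof.
move=> ab E [wr wl]; split => x x0 x1.
  have [k wk] := wr x x0 x1.
  have [xa|ax] := ltP x al.
    exists k; apply: (@right_derivative_eq _ w _ _ _ (al - x)) wk; first lin.
    by move=> y h1 h2; rewrite flat_on_le//; lin.
  have [xb|bx] := ltP x be.
    exists 0; apply: (@right_derivative_affine _ _ _ _ (be - x)); first lin.
    by move=> y h1 h2; rewrite !flat_on_in ?mul0r ?addr0//; lin.
  exists k; apply: (@right_derivative_eq _ w _ _ _ 1) wk; first lin.
  by move=> y h1 h2; rewrite flat_on_ge//; lin.
have [k wk] := wl x x0 x1.
have [xa|ax] := leP x al.
  exists k; apply: (@left_derivative_eq _ w _ _ _ 1) wk; first lin.
  by move=> y h1 h2; rewrite flat_on_le//; lin.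
have [xb|bx] := leP x be.
  exists 0; apply: (@left_derivative_affine _ _ _ _ (x - al)); first lin.
  by move=> y h1 h2; rewrite !flat_on_in ?mul0r ?addr0//; lin.
exists k; apply: (@left_derivative_eq _ w _ _ _ (x - be)) wk; first lin.
by move=> y h1 h2; rewrite flat_on_ge//; lin.
Qed.

Lemma ftc_glue (g f : R -> R) a c b : mu.-integrable `[a, b] (EFin \o g) ->
  (forall x y, a <= x -> x <= y -> y <= c -> \int[mu]_(t in `[x, y]) g t = f y - f x) ->
  (forall x y, c <= x -> x <= y -> y <= b -> \int[mu]_(t in `[x, y]) g t = f y - f x) ->
  forall x y, a <= x -> x <= y -> y <= b -> \int[mu]_(t in `[x, y]) g t = f y - f x.
Proof.
move=> ig h1 h2 x y ax xy yb.
have [yc|cy] := leP y c; first exact: h1.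
have [cx|xc] := leP c x; first exact: h2.
rewrite (@Rintegral_itvD _ _ x c y) ?ltW//; last by apply: integrable_sub ig.
by rewrite (h1 _ _ ax (ltW xc) (lexx c)) (h2 _ _ (lexx c) (ltW cy) yb); ring.
Qed.

Lemma eq_Rintegral_itv (f g : R -> R) x y : mu.-integrable `[x, y] (EFin \o f) ->
  mu.-integrable `[x, y] (EFin \o g) -> (forall t, x < t -> t < y -> f t = g t) ->
  \int[mu]_(t in `[x, y]) f t = \int[mu]_(t in `[x, y]) g t.
Proof.
move=> fi gi fg; rewrite /Rintegral; congr fine.
have sub : `]x, y[ `<=` `[x, y]%classic := @subset_itv_oo_cc _ _ x y.
apply: eq_integral_itv_bounded.
- by apply/measurable_EFinP; apply: measurable_funS (measurable_int mu fi).
- by apply/measurable_EFinP; apply: measurable_funS (measurable_int mu gi).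
- by move=> t; rewrite in_itv/= => /andP[h1 h2]; exact: fg.
Qed.

(** Off the two corners the derivative is that of [w], replaced by 0 on the plateau, which can only
    lower its L^1 norm. Equality of the end levels makes the increments on the three pieces fit
    together. *)
Lemma flat_on_ftc w al be : 0 <= al -> al < be -> be <= 1 -> w al = w be ->
  ftc_on w -> ftc_on (flat_on w al be) /\
  (\int[mu]_(x in `]0%R, 1%R[) (`|derive1 (flat_on w al be) x|)%:E <=
   \int[mu]_(x in `]0%R, 1%R[) (`|derive1 w x|)%:E)%E.
Proof.
move=> a0 ab b1 E [iw F].
pose g' x := derive1 w x - derive1 w x * step al be 1 x.
have iwo : mu.-integrable `]0, 1[ (EFin \o derive1 w).
  by apply: integrableS iw => //; exact: subset_itv_oo_cc.
have ig' : mu.-integrable `]0, 1[ (EFin \o g').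
  have := @integrableB _ _ R mu `]0, 1[%classic (measurable_itv _) _ _ iwo (integrable_step 1 iw a0 b1).
  by apply: eq_integrable.
have fg' x : `]0, 1[%classic x -> x \notin [:: al; be] ->
    derive1 (flat_on w al be) x = g' x.
  move=> _; rewrite !inE negb_or => /andP[xa xb].
  rewrite flat_on_derive1// /g' /step (_ : (al <= x) = (al < x)).
    by case: ifP => _; rewrite ?mulr1 ?mulr0 ?subrr ?subr0.
  by rewrite le_eqVlt eq_sym (negbTE xa).
have [ifl _] := @integrable_eq_off `]0, 1[%classic _ _ _ (measurable_itv _) ig' fg'.
split.
  have ifl' := integrable_oocc ifl.
  split => //; apply: (@ftc_glue _ _ 0 al 1) => //.
    move=> x y x0 xy ya; rewrite !flat_on_le//; last lin.
    have -> := esym (F x y x0 xy (le_trans ya (le_trans (ltW ab) b1))).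
    apply: eq_Rintegral_itv.
    - by apply: integrable_sub ifl'; lin.
    - by apply: integrable_sub iw; lin.
    - move=> t h1 h2; rewrite flat_on_derive1//; [|by apply/eqP; lin|by apply/eqP; lin].
      by rewrite ifF//; apply/negbTE; rewrite negb_and -!leNgt; apply/orP; left; lin.
  apply: (@ftc_glue _ _ al be 1) => //; first by apply: integrable_sub ifl'.
    move=> x y x0 xy ya; rewrite !flat_on_in//; [|lin|lin].
    rewrite subrr; transitivity (\int[mu]_(t in `[x, y]) (cst 0 : R -> R) t); last first.
      by rewrite Rintegral_cst// mul0r.
    apply: eq_Rintegral_itv.
    - by apply: integrable_sub ifl'; lin.
    - exact: integrable0.
    - move=> t h1 h2; rewrite flat_on_derive1//; [|by apply/eqP; lin|by apply/eqP; lin].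
      by rewrite ifT//; apply/andP; split; lin.
  move=> x y x0 xy ya; rewrite !flat_on_ge//; last lin.
  have -> := esym (F x y (le_trans a0 (le_trans (ltW ab) x0)) xy ya).
  apply: eq_Rintegral_itv.
  - by apply: integrable_sub ifl'; lin.
  - by apply: integrable_sub iw; lin.
  - move=> t h1 h2; rewrite flat_on_derive1//; [|by apply/eqP; lin|by apply/eqP; lin].
    by rewrite ifF//; apply/negbTE; rewrite negb_and -!leNgt; apply/orP; right; lin.
have ign' := integrable_norm ig'.
have [_ ->] := @integrable_eq_off _ [:: al; be] (fun x => `|derive1 (flat_on w al be) x|) _
  (measurable_itv _) ign' (fun x h1 h2 => congr1 Num.norm (fg' x h1 h2)).
apply: ge0_le_integral => //=.
- by have := measurable_int mu ign'.
- by have := measurable_int mu (integrable_norm iwo).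
- move=> x _; rewrite lee_fin /g' /step.
  by case: ifP => _; rewrite ?mulr1 ?mulr0 ?subrr ?subr0 ?normr0.
Qed.

Lemma lipschitz_glue (L : R) f c :
  (forall x y, x <= y -> y <= c -> `|f x - f y| <= L * `|x - y|) ->
  (forall x y, c <= x -> x <= y -> `|f x - f y| <= L * `|x - y|) -> lipschitz_by L f.
Proof.
move=> h1 h2 x y; wlog xy : x y / x <= y.
  by move=> h; case: (leP x y) => [/h//|/ltW/h]; rewrite distrC [X in _ <= _ * X]distrC.
have [yc|cy] := leP y c; first exact: h1.
have [cx|xc] := leP c x; first exact: h2.
have -> : f x - f y = (f x - f c) + (f c - f y) by ring.
apply: (le_trans (ler_normD _ _)).
apply: (le_trans (lerD (h1 x c (ltW xc) (lexx _)) (h2 c y (lexx _) (ltW cy)))).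
rewrite -mulrDr (ler0_norm (_ : x - c <= 0)) ?(ler0_norm (_ : c - y <= 0)) ?(ler0_norm (_ : x - y <= 0)); [|lin..].
by rewrite (_ : - (x - c) + - (c - y) = - (x - y)) //; ring.
Qed.

Lemma derivable_right_derivative f x : derivable f x 1 -> right_derivative f x (derive1 f x).
Proof.
rewrite derive1E => df; apply: cvg_trans (cvg_dnbhs_at_right df).
by apply: near_eq_cvg; apply: nearW => h; rewrite /= [h%:A]mulr1 [h + x]addrC.
Qed.

Lemma derivable_left_derivative f x : derivable f x 1 -> left_derivative f x (derive1 f x).
Proof.
rewrite derive1E => df; apply: cvg_trans (cvg_dnbhs_at_left df).
by apply: near_eq_cvg; apply: nearW => h; rewrite /= [h%:A]mulr1 [h + x]addrC.
Qed.

Lemma test_in_lipschitz a b phi : test_in a b phi -> exists L, 0 <= L /\ lipschitz_by L phi.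
Proof.
move=> [dphi cphi [c [d [ac db phi0]]] _].
have [M [_ MM]] := @compact_bounded R R _ (@continuous_compact _ _ (derive1 phi) _ (continuous_subspaceT cphi) (@segment_compact R c d)).
pose L := `|M| + 1; exists L; split; first by rewrite addr_ge0.
have dL x : `|derive1 phi x| <= L.
  have [xcd|xcd] := boolP (x \in `[c, d]).
    apply: (MM L); first by rewrite /L ltr_pwDr// ler_norm.
    by exists x.
  rewrite (_ : derive1 phi x = 0) ?normr0 ?addr_ge0//.
  rewrite -[RHS](@derive1_cst R R 0 x).
  move: xcd; rewrite in_itv/= negb_and -!ltNge => /orP[h|h].
    apply: (@open_itv_derive1 _ _ x (x - 1) c) => //; first lin.
    by move=> y _ yc; rewrite phi0// in_itv/= negb_and -!ltNge yc.
  apply: (@open_itv_derive1 _ _ x d (x + 1)) => //; first lin.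
  by move=> y yc _; rewrite phi0// in_itv/= negb_and -!ltNge yc orbT.
move=> x y; wlog xy : x y / x <= y.
  by move=> h; case: (leP x y) => [/h//|/ltW/h]; rewrite distrC [X in _ <= _ * X]distrC.
have [z _] := @MVT_segment R phi (derive1 phi) x y xy
  (fun z _ => DeriveDef (dphi z) (esym (derive1E phi z)))
  (derivable_within_continuous (fun z _ => dphi z)).
by rewrite distrC [in leRHS]distrC => ->; rewrite normrM ler_wpM2r.
Qed.

Lemma flat_on_ucont w al be : 0 <= al -> al <= be -> be <= 1 -> w al = w be ->
  ucont w -> ucont (flat_on w al be).
Proof.
move=> a0 ab b1 E cw e e0; have [d d0 wd] := cw _ (divr_gt0 e0 (ltr0n _ 2)).
exists d => // x y x0 x1 y0 y1.
wlog xy : x y x0 x1 y0 y1 / x <= y.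
  by move=> h; case: (leP x y) => [/h|/ltW/h]; [apply|rewrite distrC [X in _ -> X < _]distrC; apply].
rewrite distrC ger0_norm ?subr_ge0// => xyd.
have W u v : x <= u -> u <= v -> v <= y -> `|w u - w v| < e / 2.
  move=> h1 h2 h3; apply: wd; [lin|lin|lin|lin|].
  by rewrite distrC ger0_norm ?subr_ge0//; lin.
have [ya|ay] := leP y al.
  by rewrite !flat_on_le//; [have := W x y (lexx _) xy (lexx _); lin|lin].
have [bx|xb] := leP be x.
  by rewrite !flat_on_ge//; [have := W x y (lexx _) xy (lexx _); lin|lin].
have [xa|ax] := leP x al; have [yb|by_] := leP y be.
- rewrite flat_on_le// flat_on_in//; last lin.
  by have := W x al (lexx _) xa (ltW ay); lin.
- rewrite flat_on_le// flat_on_ge ?(ltW by_)//.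
  have -> : w x - w y = (w x - w al) + (w be - w y) by rewrite E; ring.
  apply: (le_lt_trans (ler_normD _ _)).
  have := W x al (lexx _) xa (ltW ay); have := W be y (ltW xb) (ltW by_) (lexx _); lin.
- by rewrite !flat_on_in ?subrr ?normr0//; lin.
- rewrite flat_on_in ?flat_on_ge ?(ltW by_)//; [|lin|lin].
  by rewrite E; have := W be y (ltW xb) (ltW by_) (lexx _); lin.
Qed.

(** [psi] is the right derivative of the function obtained from [phi] by inserting the chord over
    [[al, be]]; this function is Lipschitz, so [lipschitz_test] applies to it. *)
Lemma interpolated_test w V phi c d al be : ftc_on w -> dvar_le 0 1 (derive1 w) V ->
  test_in 0 1 phi -> 0 < c -> d < 1 -> (forall x, x \notin `[c, d] -> phi x = 0) ->
  0 < al -> al < be -> be < 1 ->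
  exists psi, [/\ (forall x, x < al -> psi x = derive1 phi x),
    (forall x, be <= x -> psi x = derive1 phi x),
    (forall x, al <= x -> x < be -> psi x = slope phi al be) &
    \int[mu]_(x in `]0, 1[) (derive1 w x * psi x) <= V].
Proof.
move=> [iw F] wV tphi c0 d1 phi0 a0 ab b1.
have [dphi cphi _ phi1] := tphi.
have [L [L0 Lphi]] := test_in_lipschitz tphi.
pose k := slope phi al be.
have kE : k * (be - al) = phi be - phi al by rewrite /k /slope divfK// subr_eq0 gt_eqF.
have kL : `|k| <= L.
  rewrite -(@ler_pM2r _ (be - al)) ?subr_gt0// -[X in _ * X <= _](@gtr0_norm _ (be - al)) ?subr_gt0//.
  rewrite -normrM kE; apply: (le_trans (Lphi _ _)).
  by rewrite gtr0_norm ?subr_gt0.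
pose f x := if (al <= x) && (x <= be) then phi al + k * (x - al) else phi x.
have f_in x : al <= x -> x <= be -> f x = phi al + k * (x - al) by move=> h1 h2; rewrite /f h1 h2.
have f_le x : x <= al -> f x = phi x.
  move=> h; rewrite /f; case: ifP => // /andP[h1 _].
  have -> : x = al by lin.
  by rewrite subrr mulr0 addr0.
have f_ge x : be <= x -> f x = phi x.
  move=> h; rewrite /f; case: ifP => // /andP[_ h1].
  have -> : x = be by lin.
  by rewrite kE addrC subrK.
have Lf : lipschitz_by L f.
  apply: (@lipschitz_glue _ _ al) => x y.
    by move=> xy ya; rewrite !f_le//; lin.
  move=> ax xy.
  suff : lipschitz_by L (fun x => f (Num.max al x)).
    by move=> /(_ x y); rewrite (max_idPr ax) (max_idPr (le_trans ax xy)).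
  apply: (@lipschitz_glue _ _ be) => {ax xy} u v.
    move=> uv vb.
    have [au av] : al <= Num.max al u /\ al <= Num.max al v by rewrite !le_max lexx.
    have [mu_ mv] : Num.max al u <= be /\ Num.max al v <= be by rewrite !ge_max; split; apply/andP; split; lin.
    rewrite !f_in//.
    have -> : phi al + k * (Num.max al u - al) - (phi al + k * (Num.max al v - al)) = k * (Num.max al u - Num.max al v) by ring.
    rewrite normrM; apply: ler_pM => //.
    by rewrite !maxEle; case: ifPn; case: ifPn; rewrite -?ltNge => h1 h2; rewrite ler_norml;
      rewrite (ler0_norm (_ : u - v <= 0)); try lin; apply/andP; split; lin.
  move=> bu uv; rewrite !(max_idPr _); [|lin|lin].
  by rewrite !f_ge//; lin.
pose psi x := if (al <= x) && (x < be) then k else derive1 phi x.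
exists psi; split.
- by move=> x h; rewrite /psi leNgt h.
- by move=> x h; rewrite /psi andbC ltNge h.
- by move=> x h1 h2; rewrite /psi h1 h2.
pose c' := Num.min c al; pose d' := Num.max d be.
have c'0 : 0 < c' by rewrite lt_min c0.
have d'1 : d' < 1 by rewrite gt_max d1.
apply: (@lipschitz_test R 0 1 c' d' f psi L (derive1 w) V Lf ltr01 c'0 d'1 _ _ _ iw wV).
- move=> x; rewrite in_itv/= negb_and -!ltNge lt_min gt_max => /orP[|] /andP[h1 h2].
    by rewrite f_le ?ltW// phi0// in_itv/= negb_and -!ltNge h1.
  by rewrite f_ge ?ltW// phi0// in_itv/= negb_and -!ltNge h1 orbT.
- move=> x; have [xa|ax] := leP x al; first by rewrite f_le.
  have [bx|xb] := leP be x; first by rewrite f_ge.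
  rewrite (f_in _ (ltW ax) (ltW xb)).
  have := phi1 al; have := phi1 be; rewrite !ler_norml => /andP[p1 p2] /andP[q1 q2].
  have T0 : 0 <= (x - al) / (be - al) by rewrite divr_ge0//; lin.
  have T1 : (x - al) / (be - al) <= 1 by rewrite ler_pdivrMr; lin.
  (* A convex combination of two values of [phi], hence bounded by 1. *)
  have -> : phi al + k * (x - al) = phi al * (1 - (x - al) / (be - al)) + phi be * ((x - al) / (be - al)).
    rewrite /k /slope; field; rewrite subr_eq0 gt_eqF//.
  move: T0 T1; set T := (x - al) / (be - al) => T0 T1.
  clear -p1 p2 q1 q2 T0 T1; apply/andP; split; nra.
- move=> x _; rewrite /psi; case: ifP => [/andP[h1 h2]|/negbT].
    apply: (@right_derivative_affine _ _ _ _ (be - x)); first lin.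
    by move=> y h3 h4; rewrite !f_in; [ring|lin..].
  rewrite negb_and -ltNge -leNgt => /orP[h|h].
    apply: (@right_derivative_eq _ phi _ _ _ (al - x)); first lin.
      by move=> y h1 h2; rewrite f_le//; lin.
    exact: derivable_right_derivative.
  apply: (@right_derivative_eq _ phi _ _ _ 1) => //.
    by move=> y h1 h2; rewrite f_ge//; lin.
  exact: derivable_right_derivative.
Qed.

Lemma derive1_out phi c d x : (forall x, x \notin `[c, d] -> phi x = 0) -> x < c \/ d < x ->
  derive1 phi x = 0.
Proof.
move=> phi0 h; rewrite -[RHS](@derive1_cst R R 0 x); case: h => h.
  apply: (@open_itv_derive1 _ _ x (x - 1) c) => //; first lin.
  by move=> y _ yc; rewrite phi0// in_itv/= negb_and -!ltNge yc.
apply: (@open_itv_derive1 _ _ x d (x + 1)) => //; first lin.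
by move=> y yc _; rewrite phi0// in_itv/= negb_and -!ltNge yc orbT.
Qed.

(** A plateau may touch 0 or 1, whereas the chord has to be inserted strictly inside []0, 1[]. The
    plateau is shortened accordingly; only points outside the support [[c, d]] are lost, and the end
    levels then differ by at most [e]. *)
Lemma inner_interval w al be c d (e : R) : ucont w -> 0 <= al -> al < be -> be <= 1 -> w al = w be ->
  0 < c -> d < 1 -> 0 < e -> exists al' be',
  [/\ [/\ 0 < al', al <= al', al' < be', be' <= be & be' < 1],
    forall x, al < x -> x < al' -> x < c, forall x, be' <= x -> x < be -> d < x
  & `|w be' - w al'| <= e].
Proof.
move=> cw a0 ab b1 E c0 d1 e0.
have [d0 d00 wd] := cw (e / 2) ltac:(by rewrite divr_gt0).
have [eta [eta0 etac etad etab etad0]] : exists eta, [/\ 0 < eta, eta < c, eta < 1 - d,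
    eta < (be - al) / 3 & eta < d0].
  have [m [m0 m1 m2 m3 m4]] : exists m, [/\ 0 < m, m <= c, m <= 1 - d, m <= (be - al) / 3 & m <= d0].
    exists (Num.min (Num.min c (1 - d)) (Num.min ((be - al) / 3) d0)).
    by rewrite !lt_min !ge_min !lexx !orbT d00 c0 !andbT; split => //; apply/andP; split; lin.
  by exists (m / 2); split; lin.
have [al' [aa ae al'c wal]] : exists al', [/\ al <= al', eta <= al' /\ al' <= al + eta,
    forall x, al < x -> x < al' -> x < c & `|w al - w al'| < e / 2].
  have [h|h] := leP eta al; first exists al.
    by split => //; [split; lin|move=> x h1 h2; lin|rewrite subrr normr0 divr_gt0].
  exists eta; split; [exact: ltW|split; lin|by move=> x _ h2; lin|].
  by apply: wd; [lin|lin|lin|lin|rewrite ltr_norml; apply/andP; split; lin].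
have [be' [bb bet be'd wbe]] : exists be', [/\ be' <= be, be' <= 1 - eta /\ be - eta <= be',
    forall x, be' <= x -> x < be -> d < x & `|w be' - w be| < e / 2].
  have [h|h] := leP be (1 - eta); first exists be.
    by split => //; [split; lin|move=> x h1 h2; lin|rewrite subrr normr0 divr_gt0].
  exists (1 - eta); split; [exact: ltW|split; lin|by move=> x h2 _; lin|].
  by apply: wd; [lin|lin|lin|lin|rewrite ltr_norml; apply/andP; split; lin].
have [ae1 ae2] := ae; have [be1 be2] := bet.
exists al', be'; split => //; first by split; lin.
have -> : w be' - w al' = (w be' - w be) + (w al - w al') by rewrite E; ring.
by apply: (le_trans (ler_normD _ _)); lin.
Qed.

(* Replacing [w'] by [0] on the plateau changes the integral against [phi'] by
   a term that the interpolation [psi] of [phi'] absorbs. *)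
Lemma flat_on_dvar w V al be : ucont w -> ftc_on w -> dvar_le 0 1 (derive1 w) V ->
  0 <= al -> al < be -> be <= 1 -> w al = w be ->
  dvar_le 0 1 (derive1 (flat_on w al be)) V.
Proof.
move=> cw ftcw wV a0 ab b1 E phi tphi.
have [iw F] := ftcw.
have [[ifl _] _] := flat_on_ftc a0 ab b1 E ftcw.
have [_ _ [c [d [c0 d1 phi0]]] _] := tphi.
apply/ler_addgt0Pr => e e0.
have [L [L0 Lphi]] := test_in_lipschitz tphi.
have L1 : 0 < L + 1 by lin.
have [al' [be' [[al'0 aa ab' bb be'1] al'c be'd dw]]] :=
  inner_interval cw a0 ab b1 E c0 d1 (divr_gt0 e0 L1).
have [psi [psi1 psi2 psi3 psiV]] := interpolated_test ftcw wV tphi c0 d1 phi0 al'0 ab' be'1.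
have [k kdef] : exists k, k = slope phi al' be' by exists (slope phi al' be').
rewrite -kdef in psi3.
have iflo := test_in_integrable ifl tphi.
have ist := integrable_step k iw (ltW al'0) (ltW be'1).
have eqoff x : `]0, 1[%classic x -> x \notin [:: al; be] -> derive1 w x * psi x =
    derive1 (flat_on w al be) x * derive1 phi x + derive1 w x * step al' be' k x.
  rewrite /= in_itv/= => /andP[x0 x1]; rewrite !inE negb_or => /andP[xa xb].
  rewrite flat_on_derive1//; rewrite /step; case: (ltP x al') => xal /=.
    rewrite mulr0 addr0 psi1//; case: ifP => // /andP[h1 h2].
    by rewrite (derive1_out phi0) ?mulr0//; left; exact: al'c.
  case: (ltP x be') => xbe.
    rewrite psi3// ifT ?mul0r ?add0r// (lt_le_trans xbe bb) andbT.
    by rewrite lt_neqAle eq_sym xa (le_trans aa).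
  rewrite mulr0 addr0 psi2//; case: ifP => // /andP[h1 h2].
  by rewrite (derive1_out phi0) ?mulr0//; right; exact: be'd.
have isum := @integrableD _ _ R mu `]0, 1[%classic (measurable_itv _) _ _ iflo ist.
have [_ Eint] := @integrable_eq_off `]0, 1[%classic _ _ _ (measurable_itv _) isum eqoff.
have : \int[mu]_(x in `]0, 1[) (derive1 w x * psi x) =
    \int[mu]_(x in `]0, 1[) (derive1 (flat_on w al be) x * derive1 phi x) +
    k * (w be' - w al').
  rewrite -(F _ _ (ltW al'0) (ltW ab') (ltW be'1)) -Rintegral_step//.
    by rewrite -RintegralD// /Rintegral Eint.
  exact: ltW.
move=> Eint'; rewrite Eint' in psiV.
have kL : `|k| <= L + 1.
  rewrite kdef /slope normrM normfV ler_pdivrMr ?normr_gt0 ?subr_eq0 ?gt_eqF//.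
  by apply: (le_trans (Lphi _ _)); rewrite ler_wpM2r// lerDl.
have : `|k * (w be' - w al')| <= e.
  rewrite normrM; apply: (le_trans (ler_pM _ _ kL dw)) => //.
  by rewrite mulrC divfK// gt_eqF.
rewrite ler_norml => /andP[h _]; move: psiV h.
by move: (\int[mu]_(_ in _) _) => I h1 h2; lin.
Qed.

Definition bv_primitive V f :=
  [/\ ucont f, ftc_on f, dvar_le 0 1 (derive1 f) V & one_sided f].

Lemma flat_on_bv_primitive w V al be : 0 <= al -> al <= be -> be <= 1 -> w al = w be ->
  bv_primitive V w -> bv_primitive V (flat_on w al be) /\
  (\int[mu]_(x in `]0%R, 1%R[) (`|derive1 (flat_on w al be) x|)%:E <=
   \int[mu]_(x in `]0%R, 1%R[) (`|derive1 w x|)%:E)%E.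
Proof.
move=> a0; rewrite le_eqVlt => /predU1P[<- b1 _ bvw|ab b1 E [cw fw dw ow]].
  have -> : flat_on w al al = w.
    apply/funext => x; rewrite /flat_on; case: ifP => // /andP[h1 h2].
    by congr w; apply/eqP; rewrite eq_le h1 h2.
  by split.
have [f1 f2] := flat_on_ftc a0 ab b1 E fw.
split; last exact: f2.
split; [|exact: f1| |].
- exact: flat_on_ucont (ltW ab) b1 E cw.
- exact: flat_on_dvar.
- exact: flat_on_one_sided.
Qed.

End flat_on.

(** * Facets and components *)

Section facets_of_zigzag.
Context {R : realType}.
Notation ucont := (ucont_on 0 1).
Implicit Types (f g w u v : R -> R) (a b c d x y z : R) (p q t : nat -> R).

Lemma ucont_on_reflect a b f : ucont_on a b f -> ucont_on a b (fun x => f (a + b - x)).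
Proof.
move=> cf e e0; have [d d0 fd] := cf e e0; exists d => // x y ax xb ay yb xy.
apply: fd; [lin..|].
by rewrite (_ : a + b - x - _ = - (x - y)) ?normrN//; ring.
Qed.

Lemma ucont_on_first_hit a b f : a <= b -> ucont_on a b f ->
  exists p : R, [/\ a <= p, p <= b, f p = f b & forall x, a <= x -> x < p -> f x != f b].
Proof.
move=> ab cf; pose S := [set x | a <= x <= b /\ f x = f b].
have Sb : S b by split => //; rewrite ab lexx.
have lS : lbound S a by move=> x [/andP[]].
have hS : has_lbound S by exists a.
have aS : a <= inf S by apply: lb_le_inf => //; exists b.
have Sle : inf S <= b by exact: (ge_inf hS).
exists (inf S); split => //.
  apply/eqP; rewrite -subr_eq0 -normr_eq0 eq_le normr_ge0 andbT leNgt; apply/negP => e0.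
  have [d d0 fd] := cf _ e0; have [|s [/andP[s1 s2] fs] sd] := inf_adherent d0 (E := S).
    by split => //; exists b.
  have is_ : inf S <= s by apply: (ge_inf hS); split => //; rewrite s1.
  have := fd (inf S) s aS Sle s1 s2; rewrite fs ltxx => H.
  suff : false by []. apply: H; rewrite distrC ger0_norm ?subr_ge0//; lin.
move=> x ax xS; apply/eqP => E.
have : inf S <= x by apply: (ge_inf hS); split => //; rewrite ax; lin.
lin.
Qed.

Lemma ucont_on_last_hit a b f : a <= b -> ucont_on a b f ->
  exists q : R, [/\ a <= q, q <= b, f q = f a & forall x, q < x -> x <= b -> f x != f a].
Proof.
move=> ab cf; have [p [h1 h2 h3 h4]] := ucont_on_first_hit ab (ucont_on_reflect cf).
have E : a + b - b = a by ring.
rewrite E in h3 h4; exists (a + b - p); split => //; [lin|lin|].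
move=> x h5 h6; have := h4 (a + b - x) ltac:(lin) ltac:(lin).
by rewrite (_ : a + b - (a + b - x) = x)//; ring.
Qed.

(* The [i]-th facet [[p i, q i]] is the level set of [u] around the interior
   breakpoint [t i.+1]. *)
Definition flats n t s u p q := forall i, (i.+1 < n)%N ->
  [/\ t i < p i /\ p i <= t i.+1, t i.+1 <= q i /\ q i < t i.+2,
    forall x, p i <= x -> x <= q i -> u x = u (t i.+1),
    forall x, t i <= x -> x < p i -> asign s i * u x < asign s i * u (t i.+1)
  & forall x, q i < x -> x <= t i.+2 -> asign s i * u x < asign s i * u (t i.+1)].

Lemma asign_inj (s : R) i : s = 1 \/ s = -1 -> injective ( *%R (asign s i)).
Proof.
by move=> s1 x y; case: (asign1 i s1) => ->; rewrite ?mul1r ?mulN1r// => /oppr_inj.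
Qed.

Lemma zigzag_strict n t s u i : zigzag n t s u -> (i.+1 < n)%N ->
  forall j, (j < n)%N -> asign s j * u (t j) < asign s j * u (t j.+1).
Proof. by move=> [_ _ _ _ [[-> _]|//]]. Qed.

Lemma flats_ex n t s u : ucont u -> zigzag n t s u -> exists p q, flats n t s u p q.
Proof.
move=> cu A; have [s1 _ tt mt _] := A.
suff H i : exists pq : R * R, (i.+1 < n)%N ->
    [/\ t i < pq.1 /\ pq.1 <= t i.+1, t i.+1 <= pq.2 /\ pq.2 < t i.+2,
    forall x, pq.1 <= x -> x <= pq.2 -> u x = u (t i.+1),
    forall x, t i <= x -> x < pq.1 -> asign s i * u x < asign s i * u (t i.+1)
  & forall x, pq.2 < x -> x <= t i.+2 -> asign s i * u x < asign s i * u (t i.+1)].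
  by have /choice[pq Hpq] := H; exists (fun i => (pq i).1), (fun i => (pq i).2) => i; exact: Hpq.
have [ni|] := ltnP i.+1 n; last by exists (0, 0).
have S := zigzag_strict A ni.
have ti0 := zigzag_ge0 A (ltnW (ltnW ni)); have ti1 := zigzag_le1 A ni.
have tt1 := tt i (ltnW ni); have tt2 := tt i.+1 ni.
have m1 := mt i (ltnW ni); have m2 := mt i.+1 ni.
have [|p [p1 p2 p3 p4]] := ucont_on_first_hit (ltW tt1) (f := u); first by apply: ucont_on_sub cu; lin.
have [|q [q1 q2 q3 q4]] := ucont_on_last_hit (ltW tt2) (f := u); first by apply: ucont_on_sub cu; lin.
have s2 := S i (ltnW ni); have s3 := S i.+1 ni.
rewrite asignS in s3 m2; rewrite !mulNr ltrN2 in s3.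
have m2' x y : t i.+1 <= x -> x <= y -> y <= t i.+2 -> asign s i * u y <= asign s i * u x.
  by move=> h1 h2 h3; have := m2 x y h1 h2 h3; rewrite !mulNr lerN2.
exists (p, q) => _ /=; split.
- split => //; rewrite lt_neqAle p1 andbT; apply/eqP => E; move: s2; rewrite E p3; lin.
- split => //; rewrite lt_neqAle q2 andbT; apply/eqP => E; move: s3; rewrite -E q3; lin.
- move=> x h1 h2; apply: (asign_inj s1 (i := i)) => /=; apply/eqP; rewrite eq_le.
  have [xt|/ltW tx] := leP x (t i.+1).
    by rewrite m1//= ?(le_trans p1 h1)// -p3 m1.
  by rewrite m2'//= ?(le_trans h2 q2)// -q3 m2'.
- move=> x h1 h2; rewrite lt_neqAle m1// ?(le_trans (ltW h2) p2)// andbT.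
  by apply: contra (p4 x h1 h2) => /eqP/(asign_inj s1)/eqP.
- move=> x h1 h2; rewrite lt_neqAle m2'// ?(le_trans q1 (ltW h1))// andbT.
  by apply: contra (q4 x h1 h2) => /eqP/(asign_inj s1)/eqP.
Qed.

Lemma flats_gap n t s u p q i : zigzag n t s u -> flats n t s u p q -> (i.+2 < n)%N -> q i < p i.+1.
Proof.
move=> A F ni; have [_ [k1 k2] k3 _ _] := F i (ltnW ni); have [[k4 k5] [k6 k7] k8 _ _] := F i.+1 ni.
rewrite ltNge; apply/negP => h.
have [[_ k9] _ _ _ _] := F i (ltnW ni); have pi : p i <= p i.+1 by lin.
have := k3 (p i.+1) pi h; rewrite (k8 (p i.+1) (lexx _)); last lin.
move=> E; have := zigzag_strict A (ltnW ni) (ltnW ni); rewrite E.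
by rewrite ltxx.
Qed.

Definition ordered_itvs m p q := (forall i, (i < m)%N -> p i <= q i) /\
  (forall i, (i.+1 < m)%N -> q i < p i.+1).

Definition itvs m p q : set R := [set x | exists2 i, (i < m)%N & p i <= x <= q i].

Lemma ordered_itvs_lt m p q i j : ordered_itvs m p q -> (i < j)%N -> (j < m)%N -> q i < p j.
Proof.
move=> [h1 h2]; elim: j => // j IH; rewrite ltnS leq_eqVlt => /predU1P[->|ij] jm; first exact: h2.
apply: (lt_trans (IH ij (ltnW jm))); apply: (le_lt_trans (h1 _ (ltnW jm))); exact: h2.
Qed.

Lemma ordered_itvs_inj m p q i j x : ordered_itvs m p q -> (i < m)%N -> (j < m)%N ->
  p i <= x <= q i -> p j <= x <= q j -> i = j.
Proof.
move=> O im jm /andP[h1 h2] /andP[h3 h4]; have [ij|ji|//] := ltngtP i j.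
  by exfalso; have := ordered_itvs_lt O ij jm; lin.
by exfalso; have := ordered_itvs_lt O ji im; lin.
Qed.

(** Such points keep a connected subset of the union from leaving the [i]-th interval on the
    right. *)
Lemma ordered_itvs_gapr m p q i y : ordered_itvs m p q -> (i < m)%N -> q i < y ->
  exists z, [/\ q i < z, z <= y & ~ itvs m p q z].
Proof.
move=> O im qy.
have [z [z1 z2 z3]] : exists z, [/\ q i < z, z <= y & (i.+1 < m)%N -> z < p i.+1].
  have [h|h] := ltnP i.+1 m; last by exists y.
  have h1 := (proj2 O) i h; have [h2|h2] := leP y ((q i + p i.+1) / 2).
    by exists y; split => // _; lin.
  by exists ((q i + p i.+1) / 2); split => // *; lin.
exists z; split => // -[j jm /andP[h1 h2]]; have [ij|ji|ij] := ltngtP i j.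
- have [jE|jE] := eqVneq j i.+1; first by rewrite jE in jm h1; have := z3 jm; lin.
  have ij1 : (i.+1 < j)%N by rewrite ltn_neqAle eq_sym jE.
  have := ordered_itvs_lt O ij1 jm; have im1 := leq_ltn_trans ij jm.
  by have := z3 im1; have := (proj1 O) _ im1; lin.
- by have := ordered_itvs_lt O ji im; have := (proj1 O) i im; lin.
- by move: h1 h2; rewrite -ij; lin.
Qed.

Lemma ordered_itvs_gapl m p q i y : ordered_itvs m p q -> (i < m)%N -> y < p i ->
  exists z, [/\ z < p i, y <= z & ~ itvs m p q z].
Proof.
move=> O im qy.
have [z [z1 z2 z3]] : exists z, [/\ z < p i, y <= z & (0 < i)%N -> q i.-1 < z].
  case: i im qy => [|i] im qy; first by exists y.
  have h1 := (proj2 O) i im; have [h2|h2] := leP ((q i + p i.+1) / 2) y.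
    by exists y; split => //= _; lin.
  by exists ((q i + p i.+1) / 2); split => //= *; lin.
exists z; split => // -[j jm /andP[h1 h2]]; have [ij|ji|ij] := ltngtP i j.
- by have := ordered_itvs_lt O ij jm; have := (proj1 O) i im; lin.
- have i0 : (0 < i)%N := leq_ltn_trans (leq0n _) ji.
  have h3 := z3 i0; have im1 : (i.-1 < m)%N by rewrite (leq_ltn_trans (leq_pred _)).
  have [jE|jE] := eqVneq j i.-1; first by rewrite -jE in h3; lin.
  have ij1 : (j < i.-1)%N by rewrite ltn_neqAle jE -ltnS prednK.
  by have := ordered_itvs_lt O ij1 im1; have := (proj1 O) _ im1; lin.
- by move: h1 h2; rewrite -ij; lin.
Qed.

Lemma connected_component_itvs m p q i x : ordered_itvs m p q -> (i < m)%N -> p i <= x <= q i ->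
  connected_component (itvs m p q) x = `[p i, q i]%classic.
Proof.
move=> O im /andP[px xq].
apply/seteqP; split.
  have C := @component_connected _ (itvs m p q) x.
  move/connected_intervalP: C => C; have S := @connected_component_sub _ (itvs m p q) x.
  have Cx : connected_component (itvs m p q) x x.
    by apply: connected_component_refl; exists i => //; rewrite px.
  move=> y Cy; rewrite /= in_itv/=; apply/andP; split; rewrite leNgt; apply/negP => h.
    have [z [z1 z2 z3]] := ordered_itvs_gapl O im h; apply: z3; apply: S.
    by apply: (C y x) => //; apply/andP; split; lin.
  have [z [z1 z2 z3]] := ordered_itvs_gapr O im h; apply: z3; apply: S.
  by apply: (C x y) => //; apply/andP; split; lin.
apply: connected_component_max; last exact: segment_connected.
  by rewrite /= in_itv/= px.
by move=> y; rewrite /= in_itv/= => h; exists i.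
Qed.

(** Treats concave ([r = 1]) and convex ([r = -1]) facets at once. *)
Definition facet_sgn (r : R) u a b := facet u a b /\
  exists e : R, [/\ 0 < e, 0 <= a - e & b + e <= 1] /\
    [/\ forall x y, a - e < x -> x <= y -> y < a -> r * u x <= r * u y,
        forall x, a - e < x -> x < a -> r * u x < r * u a,
        forall x y, b < x -> x <= y -> y < b + e -> r * u y <= r * u x
      & forall x, b < x -> x < b + e -> r * u x < r * u b].

Lemma concave_facetE u a b : concave_facet u a b <-> facet_sgn 1 u a b.
Proof.
split=> -[F [e [h [h1 h2 h3 h4]]]]; split => //; exists e; split => //; split.
- move=> x y xa xy yb; rewrite !mul1r; apply: h1 => //; rewrite inE/= in_itv/=; apply/andP; split; lin.
- by move=> x xa xb; rewrite !mul1r; apply: h2; rewrite in_itv/= xa.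
- move=> x y xa xy yb; rewrite !mul1r; apply: h3 => //; rewrite inE/= in_itv/=; apply/andP; split; lin.
- by move=> x xa xb; rewrite !mul1r; apply: h4; rewrite in_itv/= xa.
- move=> x y; rewrite !inE/= !in_itv/= => /andP[? ?] /andP[? ?] xy.
  by have := h1 x y; rewrite !mul1r; apply.
- by move=> x; rewrite in_itv/= => /andP[? ?]; have := h2 x; rewrite !mul1r; apply.
- move=> x y; rewrite !inE/= !in_itv/= => /andP[? ?] /andP[? ?] xy.
  by have := h3 x y; rewrite !mul1r; apply.
- by move=> x; rewrite in_itv/= => /andP[? ?]; have := h4 x; rewrite !mul1r; apply.
Qed.

Lemma convex_facetE u a b : convex_facet u a b <-> facet_sgn (-1) u a b.
Proof.
split=> -[F [e [h [h1 h2 h3 h4]]]]; split => //; exists e; split => //; split.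
- move=> x y xa xy yb; rewrite !mulN1r lerN2; apply: h1 => //; rewrite inE/= in_itv/=; apply/andP; split; lin.
- by move=> x xa xb; rewrite !mulN1r ltrN2; apply: h2; rewrite in_itv/= xa.
- move=> x y xa xy yb; rewrite !mulN1r lerN2; apply: h3 => //; rewrite inE/= in_itv/=; apply/andP; split; lin.
- by move=> x xa xb; rewrite !mulN1r ltrN2; apply: h4; rewrite in_itv/= xa.
- move=> x y; rewrite !inE/= !in_itv/= => /andP[? ?] /andP[? ?] xy.
  by have := h1 x y; rewrite !mulN1r lerN2; apply.
- by move=> x; rewrite in_itv/= => /andP[? ?]; have := h2 x; rewrite !mulN1r ltrN2; apply.
- move=> x y; rewrite !inE/= !in_itv/= => /andP[? ?] /andP[? ?] xy.
  by have := h3 x y; rewrite !mulN1r lerN2; apply.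
- by move=> x; rewrite in_itv/= => /andP[? ?]; have := h4 x; rewrite !mulN1r ltrN2; apply.
Qed.

Lemma essential_facetE u a b : essential_facet u a b <-> exists2 r, r = 1 \/ r = -1 & facet_sgn r u a b.
Proof.
split=> [[/convex_facetE F|/concave_facetE F]|[r [->|->] F]].
- by exists (-1) => //; right.
- by exists 1 => //; left.
- by right; apply/concave_facetE.
- by left; apply/convex_facetE.
Qed.

Lemma flats_facet n t s u p q i : zigzag n t s u -> flats n t s u p q ->
  (i.+1 < n)%N -> facet_sgn (asign s i) u (p i) (q i).
Proof.
move=> A F ni; have [[f1 f2] [f3 f4] f5 f6 f7] := F i ni; have [s1 _ tt mt _] := A.
have ti0 := zigzag_ge0 A (ltnW (ltnW ni)); have ti1 := zigzag_le1 A ni.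
have pu : u (p i) = u (t i.+1) by apply: f5; lin.
have qu : u (q i) = u (t i.+1) by apply: f5; lin.
split.
  split; [lin|lin|lin| |].
    by move=> x y; rewrite !inE/= !in_itv/= => /andP[? ?] /andP[? ?]; rewrite !f5.
  move=> a' b' a0 ap qb b1 C.
  have Cx x : a' <= x -> x <= b' -> u x = u (t i.+1).
    move=> h1 h2; rewrite -pu; apply: C; rewrite inE/= in_itv/=; apply/andP; split; lin.
  split; apply/eqP.
    rewrite eq_le ap /= leNgt; apply/negP => h.
    have [h1|h1] := leP (t i) a'.
      by have := f6 a' h1 h; rewrite Cx//; lin.
    by have := f6 (t i) (lexx _) f1; rewrite Cx//; lin.
  rewrite eq_le qb andbT leNgt; apply/negP => h.
  have [h1|h1] := leP b' (t i.+2).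
    by have := f7 b' h h1; rewrite Cx//; lin.
  by have := f7 (t i.+2) f4 (lexx _); rewrite Cx//; lin.
exists (Num.min (p i - t i) (t i.+2 - q i)).
set e := Num.min _ _.
have e1 : e <= p i - t i by rewrite ge_min lexx.
have e2 : e <= t i.+2 - q i by rewrite ge_min lexx orbT.
split; first by split; [rewrite lt_min; apply/andP; split; lin|lin|lin].
split.
- by move=> x y h1 h2 h3; apply: (mt i (ltnW ni)); lin.
- by move=> x h1 h2; rewrite pu; apply: f6; lin.
- move=> x y h1 h2 h3; have := mt i.+1 ni x y ltac:(lin) h2 ltac:(lin).
  by rewrite asignS !mulNr lerN2.
- by move=> x h1 h2; rewrite qu; apply: f7; lin.
Qed.

Lemma zigzag_cover n t s u x : zigzag n t s u -> 0 < x -> x <= 1 -> exists j, [/\ (j < n)%N, t j < x & x <= t j.+1].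
Proof.
move=> A; have [_ [t0 tn] _ _ _] := A; move=> x0; rewrite -tn.
suff H k : (k <= n)%N -> x <= t k -> exists j, [/\ (j < n)%N, t j < x & x <= t j.+1] by exact: H.
elim: k => [|k IH] kn xk; first by rewrite t0 in xk; lin.
by have [h|h] := leP x (t k); [exact: IH (ltnW kn) h|exists k].
Qed.

(** To the left of [a] the function [r * u] lies below its value at [a], which forces [r] to be the
    direction on the interval []t j, t j.+1]] containing [a]. To the right of [b] it lies below
    again, so [t j.+1] belongs to [[a, b]], and comparison with the level set around [t j.+1]
    identifies the end points. *)
Lemma facet_flats n t s u p q (r : R) a b : zigzag n t s u -> flats n t s u p q ->
  r = 1 \/ r = -1 -> facet_sgn r u a b ->
  exists i, [/\ (i.+1 < n)%N, a = p i, b = q i & r = asign s i].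
Proof.
move=> A F r1 [[a0 ab b1 C _] [e [[e0 ae be] [g1 g2 g3 g4]]]].
have [s1 [t0 tn] tt mt st] := A.
have a00 : 0 < a by lin.
have [j [jn tja ajt]] := zigzag_cover A a00 (le_trans ab b1).
have tj0 := zigzag_ge0 A (ltnW jn); have tj1 := zigzag_le1 A jn.
have rE : r = asign s j.
  pose x := Num.max (a - e / 2) ((t j + a) / 2).
  have [x1 [x2 x3]] : a - e < x /\ t j < x /\ x < a.
    by rewrite /x !lt_max gt_max; split; [|split]; [apply/orP; left; lin|apply/orP; right; lin|apply/andP; split; lin].
  have := g2 x x1 x3; have := mt j jn x a (ltW x2) (ltW x3) ajt.
  by case: r1 => ->; case: (asign1 j s1) => -> //; rewrite ?mul1r ?mulN1r; lin.
have cst x : a <= x -> x <= b -> u x = u a.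
  move=> h1 h2; apply: C; rewrite inE/= in_itv/=; apply/andP; split; lin.
have tb : t j.+1 <= b.
  rewrite leNgt; apply/negP => h.
  pose y := Num.min (b + e / 2) (t j.+1).
  have [y1 [y2 y3]] : b < y /\ y <= t j.+1 /\ y < b + e.
    by rewrite /y lt_min gt_min ge_min lexx orbT; split; [apply/andP; split; lin|split => //; apply/orP; left; lin].
  have := g4 y y1 y3; have := mt j jn b y ltac:(lin) (ltW y1) y2; rewrite rE; lin.
have jn1 : (j.+1 < n)%N.
  rewrite ltn_neqAle jn andbT; apply/eqP => E; move: tb; rewrite E tn; lin.
have [[f1 f2] [f3 f4] f5 f6 f7] := F j jn1.
have ta : u (t j.+1) = u a by exact: cst.
exists j; split => //; apply/eqP; rewrite eq_le; apply/andP; split; rewrite leNgt; apply/negP => h.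
- pose x := Num.max (a - e / 2) (p j).
  have [x1 [x2 x3]] : a - e < x /\ p j <= x /\ x < a.
    by rewrite /x lt_max le_max gt_max lexx orbT; split; [apply/orP; left; lin|split => //; apply/andP; split; lin].
  by have := g2 x x1 x3; rewrite f5// ?ta ?ltxx//; lin.
- by have := f6 a (ltW tja) h; rewrite ta ltxx.
- pose y := Num.min b (t j.+2).
  have [y1 [y2 y3]] : q j < y /\ y <= t j.+2 /\ y <= b.
    by rewrite /y lt_min !ge_min !lexx orbT h f4.
  have := f7 y y1 y2; rewrite cst// ?ta ?ltxx//; lin.
- pose y := Num.min (b + e / 2) (q j).
  have [y1 [y2 y3]] : b < y /\ y <= q j /\ y < b + e.
    by rewrite /y lt_min gt_min ge_min lexx orbT; split; [apply/andP; split; lin|split => //; apply/orP; left; lin].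
  have := g4 y y1 y3; rewrite f5// ?ta; last lin.
  by rewrite (cst b)// ltxx.
Qed.

Section flats.
Variables (n : nat) (t : nat -> R) (s : R) (u : R -> R) (p q : nat -> R).
Hypotheses (A : zigzag n t s u) (F : flats n t s u p q).

Lemma ltn_pred_S i : (i < n.-1)%N -> (i.+1 < n)%N.
Proof. by have := zigzag_gt0 A; case: (n). Qed.

Lemma flats_ordered : ordered_itvs n.-1 p q.
Proof.
split=> i /ltn_pred_S ni; last exact: (flats_gap A F).
by have [[_ h1] [h2 _] _ _ _] := F ni; lra.
Qed.

Lemma essential_flats a b : essential_facet u a b <->
  exists i, [/\ (i < n.-1)%N, a = p i & b = q i].
Proof.
rewrite essential_facetE; split => [[r r1 /(facet_flats A F r1)[i [ni -> -> _]]]|[i [ni -> ->]]].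
  by exists i; split => //; case: (n) ni.
exists (asign s i); first by have [s1 _ _ _ _] := A; exact: asign1.
exact: (flats_facet A F (ltn_pred_S ni)).
Qed.

Lemma Xi_ess_flats : Xi_ess u = itvs n.-1 p q.
Proof.
apply/seteqP; split => x.
  by move=> [a [b [/essential_flats[i [ni -> ->]] h]]]; exists i.
by move=> [i ni h]; exists (p i), (q i); split => //; apply/essential_flats; exists i.
Qed.

Lemma K_ess_flats : K_ess u = (n.-1)%:R%:E.
Proof.
have O := flats_ordered.
have E : [set ab : R * R | essential_facet u ab.1 ab.2] = (fun i => (p i, q i)) @` `I_n.-1.
  apply/seteqP; split => [[a b] /= /essential_flats[i [ni -> ->]]|_ /= [i ni <-]].
    by exists i.
  by apply/essential_flats; exists i.
have C : ([set ab : R * R | essential_facet u ab.1 ab.2] #= `I_n.-1)%card.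
  rewrite E; apply: inj_card_eq => i j; rewrite !inE/= => ni nj [pp qq].
  apply: (@ordered_itvs_inj n.-1 p q i j (p i)) => //.
    by rewrite lexx (proj1 O).
  by rewrite pp lexx (proj1 O).
rewrite /K_ess /counting asboolT; last by apply/finite_setP; exists n.-1.
by rewrite (card_fset_set C).
Qed.

Lemma components_flats C : components (Xi_ess u) C <->
  exists2 i, (i < n.-1)%N & C = `[p i, q i]%classic.
Proof.
rewrite Xi_ess_flats; have O := flats_ordered; split.
  by move=> [x [i ni h] <-]; exists i => //; exact: connected_component_itvs.
move=> [i ni ->]; have pq := (proj1 O) i ni.
exists (p i); first by exists i => //; rewrite lexx.
by apply: connected_component_itvs => //; rewrite lexx.
Qed.

Lemma J_regular_flats : BV (derive1 u) -> J_regular u.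
Proof.
have [s1 [t0 tn] tt mt st] := A.
move=> bv; split => //.
- apply: (@sub_finite_set _ _ ((fun i => `[p i, q i]%classic) @` `I_n.-1)).
    by move=> C /components_flats[i ni ->]; exists i.
  exact: finite_image (finite_II _).
- move=> C /components_flats[i ni ->]; exists (p i), (q i); split => //.
  by apply/essential_flats; exists i.
- exists n, t; split => // i ni; split; first exact/ltW/tt.
  have := mt i ni; case: (asign1 i s1) => -> m; [left|right] => x y.
    rewrite !inE/= !in_itv/= => /andP[? ?] /andP[? ?] xy.
    by have := m x y; rewrite !mul1r; apply.
  rewrite !inE/= !in_itv/= => /andP[? ?] /andP[? ?] xy.
  by have := m x y; rewrite !mulN1r lerN2; apply.
Qed.

Lemma L_ess_flats : (0 < L_ess u)%E -> forall i, (i < n.-1)%N -> p i < q i.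
Proof.
move=> L0 i ni; have O := flats_ordered; rewrite lt_neqAle (proj1 O)// andbT; apply/eqP => E.
move: L0; rewrite ltNge => /negP; apply; apply: ereal_inf_lbound.
exists (p i), (q i); split; [by rewrite E|by apply/components_flats; exists i|by rewrite E subrr].
Qed.

End flats.

End facets_of_zigzag.

(** * The composition with the sign graph *)

Section sgn_bar_of_zigzag.
Context {R : realType}.
Notation mu := (@lebesgue_measure R).
Notation ucont := (ucont_on 0 1).
Implicit Types (f g w u v : R -> R) (a b c d x y z : R) (p q t : nat -> R).

Lemma open_itv_derive1_affine f (a k : R) x c d : c < x -> x < d ->
  (forall y, c < y -> y < d -> f y = a + k * y) -> derive1 f x = k.
Proof.
move=> cx xd fE; rewrite (open_itv_derive1 cx xd fE).
rewrite (_ : (fun y : R => _) = cst a + k *: id); last by apply/funext.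
by rewrite derive1E deriveD// derive_cst add0r deriveZ// derive_id [LHS]mulr1.
Qed.

Lemma lipschitz_abs_continuous (L : R) f :
  (forall x y, 0 <= x -> x <= y -> y <= 1 -> `|f y - f x| <= L * (y - x)) -> abs_continuous f.
Proof.
move=> fL e e0; have L0 : 0 < `|L| + 1 by rewrite ltr_wpDl.
exists (e / (`|L| + 1)); first by rewrite divr_gt0.
move=> n s t st _; rewrite ltr_pdivlMr// => h; apply: le_lt_trans h.
rewrite mulr_suml; apply: ler_sum => i _; have [s0 [stl t1]] := st i.
apply: (le_trans (fL _ _ s0 stl t1)); rewrite mulrC ler_wpM2l ?subr_ge0//.
by rewrite (le_trans (ler_norm _))// lerDl.
Qed.

Definition ramp (p q x : R) := clamp 0 1 ((x - p) / (q - p)).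

(** Closed form of [sgn_bar] on [[0, 1]]: it starts at [s] and passes linearly from [asign s i] to
    [- asign s i] across the [i]-th facet. *)
Fixpoint stair (s : R) p q m x : R := if m is m'.+1
  then stair s p q m' x - 2 * asign s m' * ramp (p m') (q m') x else s.

(** The derivative of [stair] off the corners, written as a finite sum of indicators so that
    measurability is immediate. *)
Fixpoint stair_slope (s : R) p q m x : R := if m is m'.+1
  then stair_slope s p q m' x -
    2 * asign s m' / (q m' - p m') * \1_(`]p m', q m'[%classic : set R) x else 0.

Section stair.
Variables (s : R) (p q : nat -> R) (N : nat).
Hypothesis s1 : s = 1 \/ s = -1.
Hypothesis O : ordered_itvs N p q.
Hypothesis pq : forall i, (i < N)%N -> p i < q i.

Lemma ramp_ge1 i x : (i < N)%N -> q i <= x -> ramp (p i) (q i) x = 1.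
Proof.
move=> iN qx; have h := pq iN; rewrite /ramp /clamp.
have k : 1 <= (x - p i) / (q i - p i) by rewrite ler_pdivlMr ?subr_gt0// mul1r; lra.
case: ifPn => [|_]; first lra.
by case: ifPn => //; rewrite -leNgt => k'; apply/eqP; rewrite eq_le k k'.
Qed.

Lemma ramp_le0 i x : (i < N)%N -> x <= p i -> ramp (p i) (q i) x = 0.
Proof.
move=> iN qx; have h := pq iN; rewrite /ramp /clamp.
have k : (x - p i) / (q i - p i) <= 0 by rewrite ler_pdivrMr ?subr_gt0// mul0r; lra.
case: ifPn => //; rewrite -leNgt => k'.
by rewrite ltNge (le_trans k)//=; apply/eqP; rewrite eq_le k k'.
Qed.

Lemma ramp_in i x : (i < N)%N -> p i <= x -> x <= q i -> ramp (p i) (q i) x = (x - p i) / (q i - p i).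
Proof.
move=> iN px xq; have h := pq iN; rewrite /ramp clamp_id//.
  by rewrite divr_ge0// subr_ge0 // ltW.
by rewrite ler_pdivrMr ?subr_gt0// mul1r; lra.
Qed.

Lemma stair_right m x : (m <= N)%N -> (forall j, (j < m)%N -> q j <= x) -> stair s p q m x = asign s m.
Proof.
elim: m => [|m IH] mN h; first by rewrite /asign expr0 mul1r.
rewrite /= ramp_ge1//; last exact: h.
rewrite (IH (ltnW mN)); first by rewrite asignS; ring.
by move=> j jm; apply: h; exact: ltnW.
Qed.

Lemma stair_left m k x : (k <= m)%N -> (m <= N)%N -> (forall j, (k <= j)%N -> (j < m)%N -> x <= p j) ->
  stair s p q m x = stair s p q k x.
Proof.
elim: m => [|m IH] km mN h; first by move: km; rewrite leqn0 => /eqP ->.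
move: km; rewrite leq_eqVlt => /predU1P[->//|km].
rewrite /= ramp_le0// ?mulr0 ?subr0; last by apply: h.
by apply: IH => //; [exact: ltnW|move=> j kj jm; apply: h => //; exact: ltnW].
Qed.

Lemma stair_in i x : (i < N)%N -> p i <= x -> x <= q i ->
  stair s p q N x = asign s i - 2 * asign s i * ((x - p i) / (q i - p i)).
Proof.
move=> iN px xq; rewrite (@stair_left N i.+1)//; last first.
  move=> j ij jN; apply/ltW/(le_lt_trans xq); exact: (ordered_itvs_lt O).
rewrite /= ramp_in// stair_right//; first exact: ltnW.
move=> j ji; apply: ltW; apply: lt_le_trans px; exact: (ordered_itvs_lt O).
Qed.

Lemma ramp_lip i x y : (i < N)%N -> x <= y ->
  `|ramp (p i) (q i) y - ramp (p i) (q i) x| <= (q i - p i)^-1 * (y - x).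
Proof.
move=> iN xy; apply: (le_trans (clamp_dist _ _ ler01)).
have h := pq iN; rewrite -mulrBl (_ : y - p i - (x - p i) = y - x); last by ring.
by rewrite mulrC ger0_norm// mulr_ge0 ?subr_ge0// invr_ge0 subr_ge0 ltW.
Qed.

Lemma stair_lip m : (m <= N)%N -> exists L, forall x y, x <= y ->
  `|stair s p q m y - stair s p q m x| <= L * (y - x).
Proof.
elim: m => [|m IH] mN; first by exists 0 => x y _; rewrite /= subrr normr0 mul0r.
have [L HL] := IH (ltnW mN).
exists (L + 2 * (q m - p m)^-1) => x y xy /=.
set r := ramp _ _; have -> : stair s p q m y - 2 * asign s m * r y - (stair s p q m x - 2 * asign s m * r x)
  = (stair s p q m y - stair s p q m x) - 2 * asign s m * (r y - r x) by ring.
apply: (le_trans (ler_normB _ _)); rewrite [leRHS]mulrDl; apply: lerD; first exact: HL.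
have -> : `|2 * asign s m * (r y - r x)| = 2 * `|r y - r x|.
  by rewrite normrM; case: (asign1 m s1) => ->; rewrite ?mulrN mulr1 ?normrN (ger0_norm (ler0n R 2)).
by rewrite -mulrA ler_pM2l//; exact: ramp_lip.
Qed.

Lemma stair_slope_out m x : (m <= N)%N -> (forall j, (j < m)%N -> ~ (p j < x < q j)) ->
  stair_slope s p q m x = 0.
Proof.
elim: m => [//|m IH] mN h /=; rewrite (IH (ltnW mN)); last by move=> j jm; apply: h; exact: ltnW.
by rewrite indicE memNset ?mulr0 ?subr0// /= in_itv/=; exact: h.
Qed.

Lemma stair_slope_in i x : (i < N)%N -> p i < x -> x < q i ->
  stair_slope s p q N x = - (2 * asign s i / (q i - p i)).
Proof.
move=> iN px xq.
have dis j : (j < N)%N -> j != i -> ~ (p j < x < q j).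
  move=> jN ji /andP[h1 h2]; move/eqP: ji; apply.
  by apply: (@ordered_itvs_inj _ N p q j i x) => //; apply/andP; split; apply/ltW.
suff H m : (i < m)%N -> (m <= N)%N -> stair_slope s p q m x = - (2 * asign s i / (q i - p i)) by exact: H.
elim: m => [//|m IH]; rewrite ltnS leq_eqVlt => /predU1P[<-|im] mN /=.
  rewrite (stair_slope_out (ltnW mN)); last first.
    by move=> j ji; apply: dis; [exact: ltn_trans ji iN|rewrite ltn_eqF].
  by rewrite indicE mem_set ?mulr1 ?sub0r//= in_itv/= px.
rewrite IH ?(ltnW mN)// indicE memNset ?mulr0 ?subr0//= in_itv/=; apply: dis => //.
by rewrite gtn_eqF.
Qed.

Lemma stair_slope_measurable m : measurable_fun setT (stair_slope s p q m).
Proof.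
elim: m => [|m IH]; first exact: measurable_cst.
by apply: measurable_funB => //; apply: measurable_funM => //; exact: measurable_indic.
Qed.

End stair.

Section sgn_bar.
Variables (n : nat) (t : nat -> R) (s : R) (u : R -> R) (p q : nat -> R).
Hypotheses (cu : ucont u) (A : zigzag n t s u) (F : flats n t s u p q).
Hypothesis pq : forall i, (i < n.-1)%N -> p i < q i.

Let O := flats_ordered A F.

Let pred_lt i : (i < n.-1)%N -> (i.+1 < n)%N := @ltn_pred_S _ _ _ _ _ A i.

Let lt_pred i : (i.+1 < n)%N -> (i < n.-1)%N.
Proof. by case: (n). Qed.

(** The part of the [i]-th interval between its adjacent facets; the guards account for the missing
    neighbour of the first and of the last interval. *)
Definition in_gap i x := [/\ t i <= x, x <= t i.+1, (0 < i)%N -> q i.-1 < x & (i.+1 < n)%N -> x < p i].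

Lemma flats_cover x : 0 <= x -> x <= 1 ->
  (exists2 i, (i < n.-1)%N & p i <= x <= q i) \/ (exists2 i, (i < n)%N & in_gap i x).
Proof.
have [_ [t0 tn] tt _ _] := A.
rewrite le_eqVlt => /predU1P[<-|x0] x1.
  right; exists 0%N; first exact: zigzag_gt0 A.
  split => //; [by rewrite t0|by rewrite -t0 ltW// tt// (zigzag_gt0 A)|].
  by move=> n1; have [[h _] _ _ _ _] := F n1; rewrite -t0.
have [j [jn tj xt]] := zigzag_cover A x0 x1.
have [[j0 h]|h1] := pselect ((0 < j)%N /\ x <= q j.-1).
  left; exists j.-1; first by move: jn j0; case: (j) => // k kn _; exact: lt_pred.
  case: j jn j0 tj xt h => // j jn _ /= tj xt h; have [[_ h1] _ _ _ _] := F jn.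
  by rewrite h andbT; lra.
have [[j0 h]|h2] := pselect ((j.+1 < n)%N /\ p j <= x).
  left; exists j; first exact: lt_pred.
  by have [_ [h2 _] _ _ _] := F j0; rewrite h /=; lra.
right; exists j => //; split; [exact: ltW|exact: xt| |].
- by move=> j0; rewrite ltNge; apply/negP => h; exact: h1.
- by move=> j0; rewrite ltNge; apply/negP => h; exact: h2.
Qed.

Lemma gap_notin i x : (i < n)%N -> in_gap i x -> ~ Xi_ess u x.
Proof.
move=> ni [g1 g2 g3 g4]; rewrite (Xi_ess_flats A F) => -[j jn /andP[h1 h2]].
have [ji|ij] := ltnP j i.
  have i0 : (0 < i)%N := leq_ltn_trans (leq0n _) ji.
  have : q j <= q i.-1.
    have [->//|ne] := eqVneq j i.-1.
    have ji1 : (j < i.-1)%N by rewrite ltn_neqAle ne -ltnS prednK.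
    have i1n : (i.-1 < n.-1)%N by rewrite -ltnS !prednK// (zigzag_gt0 A).
    exact: (ltW (lt_trans (ordered_itvs_lt O ji1 i1n) (pq i1n))).
  by have := g3 i0; lra.
have i1n := leq_ltn_trans ij jn; have := g4 (pred_lt i1n).
have : p i <= p j.
  move: ij; rewrite leq_eqVlt => /predU1P[->//|ij].
  exact: (ltW (lt_trans (pq i1n) (ordered_itvs_lt O ij jn))).
lra.
Qed.

Lemma gap_convex i x y z : in_gap i x -> in_gap i y -> x <= z -> z <= y -> in_gap i z.
Proof.
move=> [a1 a2 a3 a4] [b1 b2 b3 b4] xz zy; split; [lra|lra| |].
- by move=> /a3; lra.
- by move=> /b4; lra.
Qed.

Lemma in_gap01 i x : (i < n)%N -> in_gap i x -> 0 <= x <= 1.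
Proof.
move=> ni [a1 a2 _ _]; have := zigzag_ge0 A (ltnW ni); have := zigzag_le1 A ni.
by move=> *; apply/andP; split; lra.
Qed.

Lemma gap_component i x : (i < n)%N -> in_gap i x ->
  connected_component (`[0, 1]%classic `\` Xi_ess u) x = [set y | in_gap i y].
Proof.
move=> ni gx; have [a1 a2 a3 a4] := gx.
have [_ [t0 tn] _ _ _] := A.
have Xx : (`[0, 1]%classic `\` Xi_ess u) x.
  by split; [rewrite /= in_itv/= (in_gap01 ni gx)|exact: gap_notin gx].
apply/seteqP; split.
  have /connected_intervalP C := @component_connected _ (`[0, 1]%classic `\` Xi_ess u) x.
  have S := @connected_component_sub _ (`[0, 1]%classic `\` Xi_ess u) x.
  have Cx := connected_component_refl Xx.
  have Xi j : (j.+1 < n)%N -> Xi_ess u (p j) /\ Xi_ess u (q j).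
    move=> jn; rewrite (Xi_ess_flats A F); have := pq (lt_pred jn) => h.
    by split; exists j; rewrite ?lexx ?ltW//; exact: lt_pred.
  move=> y Cy; have [] := S y Cy; rewrite /= in_itv/= => /andP[y0 y1] _.
  have G1 : (0 < i)%N -> q i.-1 < y.
    move=> i0; rewrite ltNge; apply/negP => h.
    have i1 : (i.-1.+1 < n)%N by rewrite prednK.
    have Cq := C y x Cy Cx (q i.-1) ltac:(by rewrite h ltW// a3).
    by have [_] := S _ Cq; apply; exact: (proj2 (Xi _ i1)).
  have G2 : (i.+1 < n)%N -> y < p i.
    move=> i1; rewrite ltNge; apply/negP => h.
    have Cp := C x y Cx Cy (p i) ltac:(by rewrite h ltW// a4).
    by have [_] := S _ Cp; apply; exact: (proj1 (Xi _ i1)).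
  split => //.
  - case: i ni gx a1 a2 a3 a4 G1 G2 => [|i] ni gx a1 a2 a3 a4 G1 G2; first by rewrite t0.
    by have := G1 isT => /=; have [_ [h _] _ _ _] := F ni; lra.
  - have [h|h] := ltnP i.+1 n; first by have [[_ h'] _ _ _ _] := F h; have := G2 h; lra.
    by have -> : i.+1 = n; [apply/eqP; rewrite eqn_leq ni|rewrite tn].
apply: connected_component_max => //.
  by move=> y gy; split; [rewrite /= in_itv/= (in_gap01 ni gy)|exact: gap_notin gy].
by apply/connected_intervalP => y z gy gz c /andP[yc cz]; exact: gap_convex gy gz yc cz.
Qed.

(** [sgn_bar] gives precedence to the value 1, so [u] must not be constant on a decreasing gap. If
    it were, continuity would fail at an adjacent facet, whose level is different; with a single
    interval, [zigzag] admits a constant only for [s = 1]. *)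
Lemma gap_not_increasing i x : (i < n)%N -> in_gap i x -> asign s i = -1 ->
  ~ increasing_on [set y | in_gap i y] u.
Proof.
move=> ni gx si inc; have [s1 [t0 tn] tt mt st] := A; have [a1 a2 a3 a4] := gx.
have cst y : in_gap i y -> u y = u x.
  have H y' z : in_gap i y' -> in_gap i z -> y' <= z -> u y' = u z.
    move=> gy gz yz; apply/eqP; rewrite eq_le inc ?inE//=.
    have [b1 b2 _ _] := gy; have [c1 c2 _ _] := gz.
    by have := mt i ni y' z b1 yz c2; rewrite si !mulN1r lerN2.
  by move=> gy; case: (leP x y) => [/H|/ltW/H] H'; [rewrite H'|exact: H'].
have cN : ucont (fun y => - u y) := ucont_onN cu.
have [h|h] := ltnP i.+1 n.
  have [[f1 f2] [f3 f4] f5 f6 f7] := F h.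
  have ti0 := zigzag_ge0 A (ltnW ni); have ti1 := zigzag_le1 A ni.
  have xp := a4 h; have := f6 x a1 xp; rewrite -(f5 (p i)) ?lexx//; last lra.
  rewrite si !mulN1r => ux.
  have [e e0 E] := @ucont_on_local _ 0 1 _ (p i) (- u x) cN ltac:(lra) ltac:(lra) ux.
  pose y := Num.max x (p i - e).
  have [y1 [y2 y3]] : x <= y /\ p i - e <= y /\ y < p i.
    by rewrite /y !le_max !lexx orbT gt_max xp; split => //; split => //=; lra.
  have gy : in_gap i y.
    by split; [lra|lra|move=> i0; apply: lt_le_trans y1; exact: a3|].
  have := E y ltac:(lra) ltac:(lra) ltac:(rewrite ler_norml; apply/andP; split; lra).
  by rewrite (cst _ gy) ltxx.
have nE : i.+1 = n by apply/eqP; rewrite eqn_leq ni h.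
case: i ni gx si inc a1 a2 a3 a4 cst h nE => [|i] ni gx si inc a1 a2 a3 a4 cst h nE.
  case: st => [[_ sE]|st].
    by move: si; rewrite /asign expr0 mul1r sE => /eqP; rewrite -subr_eq0 opprK; have := @ltr0Sn R 1; rewrite mulr2n => /gt_eqF ->.
  have := st 0%N ni; rewrite si !mulN1r nE t0 tn.
  have t1 : t 1%N = 1 by rewrite nE.
  rewrite (cst 0) ?(cst 1) ?ltxx//; split=> //; rewrite ?t0 ?t1 ?nE ?ltnn ?lexx ?ler01//.
have [[f1 f2] [f3 f4] f5 f6 f7] := F ni.
have ti0 := zigzag_ge0 A (ltnW (ltnW ni)); have ti1 := zigzag_le1 A ni.
have xp := a3 isT; have := f7 x xp a2; rewrite /= -(f5 (q i)) ?lexx//; last lra.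
have si' : asign s i = 1 by move: si; rewrite asignS => /oppr_inj.
rewrite si' !mul1r => ux.
have [e e0 E] := @ucont_on_local _ 0 1 _ (q i) (u x) cu ltac:(lra) ltac:(lra) ux.
pose y := Num.min x (q i + e).
have [y1 [y2 y3]] : y <= x /\ y <= q i + e /\ q i < y.
  by rewrite /y !ge_min !lexx orbT lt_min xp; split => //; split => //=; lra.
have gy : in_gap i.+1 y by split; [lra|lra|by []|rewrite nE ltnn].
have := E y ltac:(lra) ltac:(lra) ltac:(rewrite ler_norml; apply/andP; split; lra).
by rewrite (cst _ gy) ltxx.
Qed.

Lemma sgn_bar_gap i x : (i < n)%N -> in_gap i x -> sgn_bar u x = asign s i.
Proof.
move=> ni gx; have [s1 [t0 tn] tt mt st] := A; have C := gap_component ni gx.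
have nX := gap_notin ni gx.
have G y : sgn_bar_graph u x y -> y = asign s i.
  case.
  - move=> [a [b [cf ab xab _]]]; exfalso; apply: nX; exists a, b; split => //; by left.
  - move=> [a [b [cf ab xab _]]]; exfalso; apply: nX; exists a, b; split => //; by right.
  - move=> [_ [[x0 Xx0 <-] xC]].
    rewrite (same_connected_component xC) C => -[[inc ->]|[dec ninc ->]].
      case: (asign1 i s1) => // si; exfalso; exact: (gap_not_increasing ni gx si).
    case: (asign1 i s1) => // si; exfalso; apply: ninc => y' z; rewrite !inE => gy gz yz.
    have [b1 b2 _ _] := gy; have [c1 c2 _ _] := gz.
    by have := mt i ni y' z b1 yz c2; rewrite si !mul1r.
have H : sgn_bar_graph u x (asign s i).
  apply: Or33; exists [set y | in_gap i y]; split => //.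
    rewrite -C; exists x => //; split => //.
    by rewrite /= in_itv/= (in_gap01 ni gx).
  case: (asign1 i s1) => si; rewrite si; [left|right]; split => //.
  - move=> y z; rewrite !inE => gy gz yz.
    have [b1 b2 _ _] := gy; have [c1 c2 _ _] := gz.
    by have := mt i ni y z b1 yz c2; rewrite si !mul1r.
  - move=> y z; rewrite !inE => gy gz yz.
    have [b1 b2 _ _] := gy; have [c1 c2 _ _] := gz.
    by have := mt i ni y z b1 yz c2; rewrite si !mulN1r lerN2.
  - exact: gap_not_increasing gx si.
by rewrite /sgn_bar; apply: G; exact: (@xgetPex _ 0 [set y | sgn_bar_graph u x y]) (ex_intro _ _ H).
Qed.

Lemma sgn_bar_flat i x : (i < n.-1)%N -> p i <= x -> x <= q i ->
  sgn_bar u x = asign s i - 2 * asign s i * ((x - p i) / (q i - p i)).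
Proof.
move=> ni px xq; have [s1 [t0 tn] tt mt st] := A.
have pqi := pq ni; have qp0 : q i - p i != 0 by lra.
have Fi := flats_facet A F (pred_lt ni).
have X : Xi_ess u x by rewrite (Xi_ess_flats A F); exists i => //; rewrite px.
have G y : sgn_bar_graph u x y -> y = asign s i - 2 * asign s i * ((x - p i) / (q i - p i)).
  case.
  - move=> [a [b [/convex_facetE cf ab xab ->]]].
    have [|j [jn aE bE sE]] := facet_flats A F _ cf; first by right.
    have ji : j = i.
      by apply: (@ordered_itvs_inj _ n.-1 p q j i x) => //; [exact: lt_pred|rewrite -aE -bE|rewrite px].
    rewrite aE bE ji in sE *; rewrite -sE; field; exact: qp0.
  - move=> [a [b [/concave_facetE cf ab xab ->]]].
    have [|j [jn aE bE sE]] := facet_flats A F _ cf; first by left.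
    have ji : j = i.
      by apply: (@ordered_itvs_inj _ n.-1 p q j i x) => //; [exact: lt_pred|rewrite -aE -bE|rewrite px].
    rewrite aE bE ji in sE *; rewrite -sE; field; exact: qp0.
  - by move=> [_ [[x0 Xx0 <-] /connected_component_sub[]]].
have H : exists y, sgn_bar_graph u x y.
  case: (asign1 i s1) => si; rewrite si in Fi.
    exists (- (2 / (q i - p i)) * x + 2 * p i / (q i - p i) + 1); apply: Or32; exists (p i), (q i).
    by split => //; [exact/concave_facetE|rewrite px].
  exists (2 / (q i - p i) * x - 2 * p i / (q i - p i) - 1); apply: Or31; exists (p i), (q i).
  by split => //; [exact/convex_facetE|rewrite px].
by rewrite /sgn_bar; apply: G; exact: (@xgetPex _ 0 [set y | sgn_bar_graph u x y]).
Qed.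

Lemma sgn_bar_stair x : 0 <= x -> x <= 1 -> sgn_bar u x = stair s p q n.-1 x.
Proof.
move=> x0 x1; have [s1 _ _ _ _] := A.
have [[i ni /andP[px xq]]|[i ni gx]] := flats_cover x0 x1.
  by rewrite (sgn_bar_flat ni px xq) (stair_in s O pq ni px xq).
rewrite (sgn_bar_gap ni gx); have [a1 a2 a3 a4] := gx.
have iN : (i <= n.-1)%N by rewrite -ltnS prednK// (zigzag_gt0 A).
rewrite (@stair_left s p q n.-1 pq n.-1 i)//.
  rewrite (stair_right s pq)// => j ji.
  have i0 : (0 < i)%N := leq_ltn_trans (leq0n _) ji.
  apply: ltW; apply: le_lt_trans (a3 i0).
  have [->//|ne] := eqVneq j i.-1.
  have ji1 : (j < i.-1)%N by rewrite ltn_neqAle ne -ltnS prednK.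
  have i1n : (i.-1 < n.-1)%N by rewrite prednK.
  exact: (ltW (lt_trans (ordered_itvs_lt O ji1 i1n) (pq i1n))).
move=> j ij jn; have i1n := leq_ltn_trans ij jn; apply: ltW; apply: (lt_le_trans (a4 (pred_lt i1n))).
move: ij; rewrite leq_eqVlt => /predU1P[->//|ij].
exact: (ltW (lt_trans (pq i1n) (ordered_itvs_lt O ij jn))).
Qed.

Lemma sgn_bar_abs_continuous : abs_continuous (sgn_bar u).
Proof.
have [s1 _ _ _ _] := A; have [L HL] := stair_lip s1 pq (leqnn n.-1).
apply: (@lipschitz_abs_continuous L) => x y x0 xy y1.
rewrite !sgn_bar_stair//; [exact: HL|lra..].
Qed.

Lemma derive1_sgn_bar_flat i x : (i < n.-1)%N -> p i < x -> x < q i ->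
  derive1 (sgn_bar u) x = - (2 * asign s i / (q i - p i)).
Proof.
move=> ni px xq.
apply: (@open_itv_derive1_affine (sgn_bar u)
  (asign s i + 2 * asign s i / (q i - p i) * p i) _ x (p i) (q i)) => // y py yq.
rewrite (sgn_bar_flat ni (ltW py) (ltW yq)); ring.
Qed.

Lemma derive1_sgn_bar_gap i x : (i < n)%N -> in_gap i x -> 0 < x -> x < 1 ->
  derive1 (sgn_bar u) x = 0.
Proof.
move=> ni [a1 a2 a3 a4] x0 x1; have [s1 [t0 tn] tt mt st] := A.
pose c := if (0 < i)%N then q i.-1 else 0.
pose d := if (i.+1 < n)%N then p i else 1.
have cx : c < x by rewrite /c; case: ifPn.
have xd : x < d by rewrite /d; case: ifPn.
apply: (@open_itv_derive1_affine (sgn_bar u) (asign s i) _ x c d) => // y cy yd.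
rewrite mul0r addr0; apply: sgn_bar_gap => //; split.
- move: cy; rewrite /c; case: (i) ni => [|j] jn; first by rewrite t0 => /ltW.
  by have [_ [h _] _ _ _] := F jn => /= /ltW; exact: le_trans.
- move: yd; rewrite /d; case: ifPn => h.
    by have [[_ h'] _ _ _ _] := F h => /ltW/le_trans; apply.
  have -> : i.+1 = n by apply/eqP; rewrite eqn_leq ni leqNgt.
  by rewrite tn => /ltW.
- by move=> i0; move: cy; rewrite /c i0.
- by move=> i0; move: yd; rewrite /d i0.
Qed.

Definition flat_ends : seq R := [seq p i | i <- iota 0 n.-1] ++ [seq q i | i <- iota 0 n.-1].

Lemma notin_flat_ends x i : x \notin flat_ends -> (i < n.-1)%N -> x != p i /\ x != q i.
Proof.
rewrite /flat_ends mem_cat negb_or => /andP[h1 h2] ni; split.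
  by apply: contra h1 => /eqP ->; apply: map_f; rewrite mem_iota.
by apply: contra h2 => /eqP ->; apply: map_f; rewrite mem_iota.
Qed.

Lemma derive1_sgn_bar x : 0 < x -> x < 1 -> x \notin flat_ends ->
  derive1 (sgn_bar u) x = stair_slope s p q n.-1 x.
Proof.
move=> x0 x1 xE; have [s1 [t0 tn] tt mt st] := A.
have [[i ni /andP[px xq]]|[i ni gx]] := flats_cover (ltW x0) (ltW x1).
  have [h1 h2] := notin_flat_ends xE ni.
  have px' : p i < x by rewrite lt_neqAle eq_sym h1.
  have xq' : x < q i by rewrite lt_neqAle h2.
  by rewrite (derive1_sgn_bar_flat ni px' xq') (stair_slope_in s O ni px' xq').
rewrite (derive1_sgn_bar_gap ni gx)// (@stair_slope_out s p q n.-1)// => j jn /andP[h1 h2].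
by apply: (gap_notin ni gx); rewrite (Xi_ess_flats A F); exists j => //; rewrite !ltW.
Qed.

End sgn_bar.

(* At a degenerate extremum the dual variable of a solution would have to equal
   both [T] and [- T]. *)
Lemma sol_facet_nondegenerate T w u (p : R -> R) (r : R) a b : 0 < T -> ucont w -> ucont u ->
  sol 0 1 T w u p -> r = 1 \/ r = -1 -> facet_sgn r u a b -> a < b.
Proof.
move=> T0 cw cu S r1 [[a0 ab b1 _ _] [e [[e0 ae be] [_ g2 _ g4]]]].
rewrite lt_neqAle ab andbT; apply/eqP => E; rewrite -E in g4 b1 be.
have H v w' (p' : R -> R) : ucont w' -> ucont v -> sol 0 1 T w' v p' ->
   (forall x, a < x -> x < a + e -> v x < v a) -> p' a = - T.
  move=> cw' cv S' h; have [_ pT _ _ _] := S'; have := pT a a0 b1.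
  rewrite ler_norml => /andP[k1 k2]; apply/eqP; rewrite eq_le k1 andbT leNgt; apply/negP => k3.
  have [d d0 D] := sol_right_local cw' cv S' a0 b1 k3.
  pose y := Num.min (a + d) (a + e / 2).
  have [y1 [y2 y3]] : y <= a + d /\ y < a + e /\ a < y.
    by rewrite /y ge_min lexx gt_min lt_min; split => //; split; [apply/orP; right; lin|apply/andP; split; lin].
  by have := D a y a0 (ltW y3) ltac:(lin) ltac:(lin) y1; have := h y y3 y2; lin.
have H' v w' (p' : R -> R) : ucont w' -> ucont v -> sol 0 1 T w' v p' ->
   (forall x, a - e < x -> x < a -> v x < v a) -> p' a = T.
  move=> cw' cv S' h; have [_ pT _ _ _] := S'; have := pT a a0 b1.
  rewrite ler_norml => /andP[k1 k2]; apply/eqP; rewrite eq_le k2 /= leNgt; apply/negP => k3.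
  have k4 : - T < - p' a by rewrite ltrN2.
  have [d d0 D] := sol_right_local (ucont_onN cw') (ucont_onN cv) (sol_opp cw' cv S') a0 b1 k4.
  pose y := Num.max (a - d) (a - e / 2).
  have [y1 [y2 y3]] : a - d <= y /\ a - e < y /\ y < a.
    by rewrite /y le_max lexx lt_max gt_max; split => //; split; [apply/orP; right; lin|apply/andP; split; lin].
  by have := D y a ltac:(lin) (ltW y3) b1 ltac:(lin) ltac:(lin); have := h y y2 y3; lin.
case: r1 => rE; rewrite rE in g2 g4.
  have h1 := H u w p cw cu S; have h2 := H' u w p cw cu S.
  suff : T = - T by lin.
  rewrite -{1}h2 ?h1// => x x1 x2; [have := g4 x x1 x2|have := g2 x x1 x2]; by rewrite !mul1r.
have S' := sol_opp cw cu S.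
have h1 := H _ _ _ (ucont_onN cw) (ucont_onN cu) S'; have h2 := H' _ _ _ (ucont_onN cw) (ucont_onN cu) S'.
suff : T = - T by lin.
rewrite -{1}h2 ?h1// => x x1 x2; [have := g4 x x1 x2|have := g2 x x1 x2]; by rewrite !mulN1r.
Qed.

End sgn_bar_of_zigzag.

(** * Mild solutions *)

Section mild_solutions.
Context {R : realType}.
Notation mu := (@lebesgue_measure R).
Notation ucont := (ucont_on 0 1).
Implicit Types (f g w u v p q : R -> R) (a b c d x y z T V : R).

Definition abs_int f : \bar R := (\int[mu]_(x in `]0%R, 1%R[) (`|derive1 f x|)%:E)%E.

Lemma AF_bv_primitive (ab ae : R) w : AF ab ae w ->
  exists V, Dvariation (derive1 w) = V%:E /\ bv_primitive V w.
Proof.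
move=> [acw Jw _ _]; have [[w'i wV] _ _ _] := Jw.
have [n [t [s pw]]] := J_regular_piecewise Jw.
have ftcw : ftc_on w := abs_continuous_ftc acw pw (integrable_oocc w'i).
have cw : ucont w by exact: abs_continuous_dist.
have sup phi : test_function phi ->
    ((\int[mu]_(x in `]0, 1[) (derive1 w x * derive1 phi x))%:E <= Dvariation (derive1 w))%E.
  by move=> tphi; apply: ereal_sup_ubound; exists phi.
have D0 : (0%:E <= Dvariation (derive1 w))%E.
  have tz : test_function (cst 0 : R -> R).
    split.
    - by move=> x; exact: derivable_cst.
    - rewrite (_ : derive1 _ = cst 0); first by move=> x; exact: cvg_cst.
      by apply/funext => x; rewrite derive1_cst.
    - by exists (1 / 3), (2 / 3); split => //; lin.
    - by move=> x; rewrite normr0.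
  apply: le_trans (sup _ tz); rewrite lee_fin.
  rewrite (_ : (fun x => _) = cst 0) ?Rintegral_cst ?mul0r//.
  by apply/funext => x /=; rewrite derive1_cst mulr0.
have Dfin : Dvariation (derive1 w) \is a fin_num by rewrite ge0_fin_numE.
exists (fine (Dvariation (derive1 w))); split; first by rewrite fineK.
have dv : dvar_le 0 1 (derive1 w) (fine (Dvariation (derive1 w))).
  by move=> phi tphi; rewrite -lee_fin [leRHS]fineK//; exact: (sup phi tphi).
split => //; split => x x0 x1; first exact: (ftc_right_derivative cw ftcw dv).
exact: (ftc_left_derivative cw ftcw dv).
Qed.

Lemma bv_primitive_BV V f : bv_primitive V f ->
  BV (derive1 f) /\ (Dvariation (derive1 f) <= V%:E)%E.
Proof.
move=> [_ [fi _] dv _].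
have D : (Dvariation (derive1 f) <= V%:E)%E.
  by apply: ge_ereal_sup => _ [phi tphi <-]; rewrite lee_fin; exact: dv.
split => //; split; last exact: le_lt_trans D (ltry _).
by apply: integrableS fi => //; exact: subset_itv_oo_cc.
Qed.

Section flat_on_sol.
Variables (w u p : R -> R) (T : R).
Hypotheses (cw : ucont w) (cu : ucont u) (S : sol 0 1 T w u p).

(** [pv i] and [nx i] are the nearest contact points on either side of [t i]. As [u] agrees with [w]
    there, [w] has equal levels at both and may be flattened in between. *)
Lemma sol_breakpoints (t : nat -> R) n : (forall i, (i <= n)%N -> 0 <= t i <= 1) ->
  exists pv nx : nat -> R, forall i, (i <= n)%N ->
   [/\ 0 <= pv i /\ nx i <= 1, pv i <= t i /\ t i <= nx i,
     contact 0 1 T p (pv i) /\ contact 0 1 T p (nx i),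
     forall y, pv i < y -> y < nx i -> ~ contact 0 1 T p y \/ y = t i
   & forall y, pv i <= y -> y <= nx i -> u y = u (t i)].
Proof.
move=> t01.
suff H i : exists ab : R * R, (i <= n)%N ->
   [/\ 0 <= ab.1 /\ ab.2 <= 1, ab.1 <= t i /\ t i <= ab.2,
     contact 0 1 T p ab.1 /\ contact 0 1 T p ab.2,
     forall y, ab.1 < y -> y < ab.2 -> ~ contact 0 1 T p y \/ y = t i
   & forall y, ab.1 <= y -> y <= ab.2 -> u y = u (t i)].
  by have /choice[ab Hab] := H; exists (fun i => (ab i).1), (fun i => (ab i).2) => i; exact: Hab.
have [ni|] := leqP i n; last by exists (0, 0).
have /andP[t0 t1] := t01 i ni.
have [a [a1 a2 a3 a4 a5]] := sol_prev cw cu S t0 t1.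
have [b [b1 b2 b3 b4 b5]] := sol_next cw cu S t0 t1.
exists (a, b) => _ /=; split => //.
  move=> y ay yb; have [ty|yt|->] := ltgtP y (t i); last by right.
    by left; apply: a4 => //; exact: ltW.
  by left; apply: b4 => //; exact: ltW.
by move=> y ay yb; have [ty|/ltW yt] := leP y (t i); [exact: a5|exact: b5].
Qed.

Fixpoint flattens (pv nx : nat -> R) m : R -> R :=
  if m is m'.+1 then flat_on (flattens pv nx m') (pv m') (nx m') else w.

(** The intervals may overlap, but each flattening sets the value of [u] on its interval and leaves
    the contact points at the common value of [u] and [w], so later flattenings do no harm. *)
Lemma flattensE (t pv nx : nat -> R) n m x : (m <= n.+1)%N ->
  (forall i, (i <= n)%N ->
   [/\ 0 <= pv i /\ nx i <= 1, pv i <= t i /\ t i <= nx i,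
     contact 0 1 T p (pv i) /\ contact 0 1 T p (nx i),
     forall y, pv i < y -> y < nx i -> ~ contact 0 1 T p y \/ y = t i
   & forall y, pv i <= y -> y <= nx i -> u y = u (t i)]) ->
  ((exists2 i, (i < m)%N & pv i <= x <= nx i) -> flattens pv nx m x = u x) /\
  (~ (exists2 i, (i < m)%N & pv i <= x <= nx i) -> flattens pv nx m x = w x).
Proof.
move=> + H; elim: m x => [|m IH] x mn; first by split => // -[].
have [h1 [h2 h3] [h4 h5] h6 h7] := H m mn.
have pv1 : pv m <= 1 by lra.
have upv : u (pv m) = w (pv m) by apply: (sol_contactP cw cu S) => //; lra.
have fpv : flattens pv nx m (pv m) = u (pv m).
  have [i1 i2] := IH (pv m) (ltnW mn).
  by have [/i1//|/i2 ->] := pselect (exists2 i, (i < m)%N & pv i <= pv m <= nx i).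
split => [[i]|N].
  rewrite ltnS leq_eqVlt => /predU1P[->|im] h /=.
    move: h => /andP[k1 k2]; rewrite flat_on_in// fpv (h7 (pv m)) ?(h7 x)//; lra.
  rewrite /flat_on; case: ifPn => [/andP[k1 k2]|_].
    by rewrite fpv (h7 (pv m)) ?(h7 x)//; lra.
  by apply: (proj1 (IH x (ltnW mn))); exists i.
rewrite /= /flat_on ifF; last by apply/negP => k; apply: N; exists m.
by apply: (proj2 (IH x (ltnW mn))) => -[i im k]; apply: N; exists i => //; exact: ltnW.
Qed.

(* A solution is obtained from the datum by finitely many flattenings, one
   around each breakpoint of monotonicity of the datum. *)
Lemma sol_flattening V n t s : piecewise_smono n t s w -> bv_primitive V w ->
  exists v, [/\ forall x, 0 <= x -> x <= 1 -> u x = v x, bv_primitive V v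
    & (abs_int v <= abs_int w)%E].
Proof.
move=> pw bw; have [t0 tn ts] := pw.
have t01 i : (i <= n)%N -> 0 <= t i <= 1.
  by move=> ni; rewrite (piecewise_smono_ge0 pw)//= (piecewise_smono_le1 pw).
have [pv [nx H]] := sol_breakpoints t01.
have B m : (m <= n.+1)%N -> bv_primitive V (flattens pv nx m) /\
    (abs_int (flattens pv nx m) <= abs_int w)%E.
  elim: m => [//|m IH] mn; have [IH1 IH2] := IH (ltnW mn).
  have [[h1 h1'] [h2 h3] [h4 h5] h6 h7] := H m mn.
  have E x : contact 0 1 T p x -> 0 <= x -> x <= 1 -> flattens pv nx m x = u x.
    move=> cx x0 x1; have [e1 e2] := flattensE x (ltnW mn) H.
    have [/e1//|/e2 ->] := pselect (exists2 i, (i < m)%N & pv i <= x <= nx i).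
    by rewrite (sol_contactP cw cu S).
  have EE : flattens pv nx m (pv m) = flattens pv nx m (nx m).
    rewrite !E//; [|lra|lra]; rewrite h7 ?(h7 (nx m))//; lra.
  have [|k1 k2] := flat_on_bv_primitive h1 _ h1' EE IH1; first lra.
  by split; [exact: k1|exact: le_trans k2 IH2].
have [b1 b2] := B n.+1 (leqnn _); exists (flattens pv nx n.+1); split => //.
move=> x x0 x1; have [e1 e2] := flattensE x (leqnn _) H.
have [/e1//|N] := pselect (exists2 i, (i < n.+1)%N & pv i <= x <= nx i).
rewrite (e2 N).
have [C|NC] := pselect (contact 0 1 T p x); first by rewrite (sol_contactP cw cu S).
(* Off the contact set and off the flattened intervals, the nearest contact points [a] and [b] lie
   in the same monotone piece as [x]. Since [w] takes the value [u x] at both, it takes it at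
   [x]. *)
have [a [a1 a2 a3 a4 a5]] := sol_prev cw cu S x0 x1.
have [b [c1 c2 c3 c4 c5]] := sol_next cw cu S x0 x1.
have [k [kn tk kt]] : exists k, [/\ (k < n)%N, t k <= x & x <= t k.+1].
  suff K k : (k <= n)%N -> x <= t k -> exists j, [/\ (j < n)%N, t j <= x & x <= t j.+1].
    by apply: (K n) => //; rewrite tn.
  elim: k => [|k IH] kn xk.
    exfalso; apply: N; exists 0%N => //; have [_ [h2 h3] _ _ _] := H 0%N isT.
    by rewrite t0 in xk h2 h3; apply/andP; split; lra.
  by have [h|/ltW h] := leP x (t k); [exact: IH (ltnW kn) h|exists k].
have [_ [g1 g2] [g3 g4] _ _] := H k (ltnW kn).
have [_ [g1' g2'] [g3' g4'] _ _] := H k.+1 kn.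
have nxa : nx k <= a.
  rewrite leNgt; apply/negP => h; apply: (a4 (nx k)) => //.
  rewrite leNgt; apply/negP => h'; apply: N; exists k; first exact: ltnW.
  by apply/andP; split; lra.
have bpv : b <= pv k.+1.
  rewrite leNgt; apply/negP => h; apply: (c4 (pv k.+1)) => //.
  rewrite leNgt; apply/negP => h'; apply: N; exists k.+1 => //.
  by apply/andP; split; lra.
have wa : w a = u x by rewrite -(sol_contactP cw cu S a2 _ a3) ?(a5 a)//; lra.
have wb : w b = u x by rewrite -(sol_contactP cw cu S _ c2 c3) ?(c5 b)//; lra.
have [_ s1 mk] := ts k kn.
have ax : a <= x by lra.
have := mk a x ltac:(lra) a1 kt; have := mk x b tk c1 ltac:(lra).
rewrite wa wb; case: s1 => ->; rewrite ?mul1r ?mulN1r ?lerN2 => h1 h2; apply/eqP; rewrite eq_le;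
by rewrite h1 h2.
Qed.

End flat_on_sol.

Lemma right_derivative_ge0 f x d e : 0 < e -> right_derivative f x d ->
  (forall y, x <= y -> y <= x + e -> f x <= f y) -> 0 <= d.
Proof.
move=> e0 fd fx; apply: (cvgr_to_ge fd); near=> h.
have h0 : 0 < h by near: h; exact: nbhs_right_gt.
have he : h < e by near: h; exact: nbhs_right_lt.
by apply: mulr_ge0; [rewrite invr_ge0 ltW|rewrite subr_ge0; apply: fx; lin].
Unshelve. all: by end_near. Qed.

Lemma left_derivative_ge0 f x d e : 0 < e -> left_derivative f x d ->
  (forall y, y <= x -> x - e <= y -> f y <= f x) -> 0 <= d.
Proof.
move=> e0 fd fx; apply: (cvgr_to_ge fd); near=> h.
have h0 : h < 0 by near: h; exact: nbhs_left_lt.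
have he : - e < h by near: h; apply: nbhs_left_gt; lin.
by apply: mulr_le0; [rewrite invr_le0 ltW|rewrite subr_le0; apply: fx; lin].
Unshelve. all: by end_near. Qed.

Lemma right_derivativeN f x d : right_derivative f x d -> right_derivative (fun y => - f y) x (- d).
Proof.
move=> fd; rewrite /right_derivative (_ : (fun h => _) = (fun h => - (h^-1 * (f (x + h) - f x)))).
  exact: cvgN.
by apply/funext => h; ring.
Qed.

Lemma left_derivativeN f x d : left_derivative f x d -> left_derivative (fun y => - f y) x (- d).
Proof.
move=> fd; rewrite /left_derivative (_ : (fun h => _) = (fun h => - (h^-1 * (f (x + h) - f x)))).
  exact: cvgN.
by apply/funext => h; ring.
Qed.

Lemma sol_right_derivative T w u p x d : ucont w -> ucont u -> sol 0 1 T w u p ->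
  0 <= x -> x < 1 -> right_derivative u x d -> (- T < p x -> 0 <= d) /\ (p x < T -> d <= 0).
Proof.
have H w' u' p' d' : ucont w' -> ucont u' -> sol 0 1 T w' u' p' ->
    0 <= x -> x < 1 -> right_derivative u' x d' -> - T < p' x -> 0 <= d'.
  move=> cw cu S x0 x1 ud px.
  have [e e0 E] := sol_right_local cw cu S x0 (ltW x1) px.
  have [m1 m2] : Num.min e (1 - x) <= e /\ Num.min e (1 - x) <= 1 - x.
    by rewrite !ge_min !lexx orbT.
  apply: (@right_derivative_ge0 u' x d' (Num.min e (1 - x))) => //.
    by rewrite lt_min e0 subr_gt0.
  by move=> y h1 h2; apply: E; lin.
move=> cw cu S x0 x1 ud; split; first exact: (H w u p d).
move=> px; rewrite -oppr_ge0; apply: (H _ _ _ _ (ucont_onN cw) (ucont_onN cu) (sol_opp cw cu S)) => //.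
  exact: right_derivativeN.
by rewrite ltrN2.
Qed.

Lemma sol_left_derivative T w u p x d : ucont w -> ucont u -> sol 0 1 T w u p ->
  0 < x -> x <= 1 -> left_derivative u x d -> (- T < p x -> 0 <= d) /\ (p x < T -> d <= 0).
Proof.
have H w' u' p' d' : ucont w' -> ucont u' -> sol 0 1 T w' u' p' ->
    0 < x -> x <= 1 -> left_derivative u' x d' -> - T < p' x -> 0 <= d'.
  move=> cw cu S x0 x1 ud px.
  have [e e0 E] := sol_right_local cw cu S (ltW x0) x1 px.
  have [m1 m2] : Num.min e x <= e /\ Num.min e x <= x.
    by rewrite !ge_min !lexx orbT.
  apply: (@left_derivative_ge0 u' x d' (Num.min e x)) => //.
    by rewrite lt_min e0.
  by move=> y h1 h2; apply: E; lin.
move=> cw cu S x0 x1 ud; split; first exact: (H w u p d).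
move=> px; rewrite -oppr_ge0; apply: (H _ _ _ _ (ucont_onN cw) (ucont_onN cu) (sol_opp cw cu S)) => //.
  exact: left_derivativeN.
by rewrite ltrN2.
Qed.

(** A one-sided derivative is nonnegative where [p x > - T] and nonpositive where [p x < T]. Hence a
    positive one forces [p x = T], a negative one [p x = - T], and 0 admits every value in
    between. *)
Lemma sol_clarke T w u p x : 0 < T -> ucont w -> ucont u -> sol 0 1 T w u p -> one_sided u ->
  0 <= x -> x <= 1 -> sgn_set (clarke u x) (p x / T).
Proof.
move=> T0 cw cu S [ur ul] x0 x1; have [_ pT _ _ _] := S.
suff [d ud [d1 d2]] : exists2 d, clarke u x d & (- T < p x -> 0 <= d) /\ (p x < T -> d <= 0).
  exists d => //; have := pT x x0 x1; rewrite ler_norml => /andP[p1 p2].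
  have [dn|dp|->] := ltgtP d 0; last first.
  - apply: Or33; split => //; rewrite ler_pdivlMr// ler_pdivrMr// mul1r mulN1r p1 p2//.
  - apply: Or31; split => //; have -> : p x = T.
      by apply/eqP; rewrite eq_le p2 /= leNgt; apply/negP => /d2; lin.
    by rewrite divff// gt_eqF.
  - apply: Or32; split => //; have -> : p x = - T.
      by apply/eqP; rewrite eq_le p1 andbT leNgt; apply/negP => /d1; lin.
    by rewrite mulNr divff// gt_eqF.
have [xe|xn] := eqVneq x 0.
  have [|d ud] := ur x x0; first by rewrite xe.
  exists d; first by apply: Or31.
  by apply: sol_right_derivative S _ _ ud => //; rewrite xe.
have xp : 0 < x by rewrite lt_neqAle eq_sym xn.
have [d ud] := ul x xp x1; exists d; last exact: sol_left_derivative S xp x1 ud.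
have [xe|xn1] := eqVneq x 1; first by apply: Or32.
have x1' : x < 1 by rewrite lt_neqAle xn1.
have [d' ud'] := ur x x0 x1'.
apply: Or33; split; first by rewrite xp.
(* The weight [tau = 1] selects the left derivative. *)
exists d, d', 1; split => //; first by rewrite ler01 lexx.
by rewrite mul1r subrr mul0r addr0.
Qed.

Lemma clarke_derivable u x d : 0 < x < 1 -> derivable u x 1 -> clarke u x d -> d = derive1 u x.
Proof.
move=> /andP[x0 x1] ud [[xe]|[xe]|[_ [dl [dr [tau [ul ur _ ->]]]]]]; [lin|lin|].
have -> : dl = derive1 u x.
  exact: (cvg_unique (@norm_hausdorff _ _) ul (derivable_left_derivative ud)).
have -> : dr = derive1 u x.
  exact: (cvg_unique (@norm_hausdorff _ _) ur (derivable_right_derivative ud)).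
ring.
Qed.

(** With this default value, the weak sign conditions on [derive1] hold trivially where [u] is not
    derivable. *)
Lemma not_derivable_derive1 u x : ~ derivable u x 1 -> derive1 u x = 0.
Proof. by move=> nd; rewrite derive1E /derive; exact: dvgP. Qed.

Lemma ftc_monotone u x y : ftc_on u -> 0 <= x -> x <= y -> y <= 1 ->
  (forall z, x < z -> z < y -> 0 <= derive1 u z) -> u x <= u y.
Proof.
move=> [ui uE] x0 xy y1 H; rewrite -subr_ge0 -uE//.
have ui' : mu.-integrable `[x, y] (EFin \o derive1 u) by exact: integrable_sub ui.
pose g z := if (x < z) && (z < y) then derive1 u z else 0.
have gE z : `[x, y]%classic z -> z \notin [:: x; y] -> g z = derive1 u z.
  rewrite /= in_itv/= !inE negb_or => /andP[h1 h2] /andP[n1 n2].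
  by rewrite /g lt_neqAle eq_sym n1 h1 lt_neqAle n2 h2.
have [gi _] := integrable_eq_off (measurable_itv _) ui' gE.
rewrite (@eq_Rintegral_itv R _ g)//; last by move=> z h1 h2; rewrite /g h1 h2.
apply: Rintegral_ge0 => z _; rewrite /g; case: ifPn => // /andP[h1 h2]; exact: H.
Qed.

(** The dual variable is [sg / lambda]. Where [sg > -1], the selected slopes are nonnegative; so is
    [derive1 v], being such a slope or 0 by default, and [v] is nondecreasing by the fundamental
    theorem of calculus. The case [sg < 1] is symmetric. *)
Lemma mild_sol (lambda : R) (ab ae : R) w v : 0 < lambda -> AF ab ae w -> mild_solution lambda w v ->
  ucont v /\ exists p, sol 0 1 lambda^-1 w v p.
Proof.
move=> l0 AFw [AFv [sg [sgn_ sgI]]].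
have [acv _ v0 v1] := AFv; have [acw _ w0 w1] := AFw.
have cw : ucont w by exact: abs_continuous_dist.
have cv : ucont v by exact: abs_continuous_dist.
split => //.
have [V [_ [_ fv _ _]]] := AF_bv_primitive AFv.
have li : 0 < lambda^-1 by rewrite invr_gt0.
have sgP x : 0 <= x -> x <= 1 -> exists2 d, clarke v x d & sgn_graph d (sg x).
  move=> x0 x1; have [|d d1 d2] := sgn_ x; first by rewrite in_itv/= x0.
  by exists d.
have sg1 x : 0 <= x -> x <= 1 -> - 1 <= sg x <= 1.
  by move=> x0 x1; have [d _ [[_ ->]|[_ ->]|[_ ->//]]] := sgP x x0 x1; apply/andP; split; lin.
have mono (r : R) x y : r = 1 \/ r = -1 -> 0 <= x -> x <= y -> y <= 1 ->
    (forall z, x <= z -> z <= y -> - 1 < r * sg z) -> forall z, x < z -> z < y -> 0 <= r * derive1 v z.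
  move=> r1 x0 xy y1 H z xz zy.
  have z0 : 0 < z by lin.
  have z1 : z < 1 by lin.
  have [dv|ndv] := pselect (derivable v z 1); last by rewrite not_derivable_derive1// mulr0.
  have [d cd sgd] := sgP z (ltW z0) (ltW z1).
  rewrite -(@clarke_derivable v z d)//; last by rewrite z0.
  have := H z (ltW xz) (ltW zy).
  by case: r1 => ->; case: sgd => [[? ->]|[? ->]|[-> _]]; lin.
exists (fun x => lambda^-1 * sg x); split => //.
- move=> x x0 x1; rewrite normrM (gtr0_norm li) ger_pMr// ler_norml.
  exact: sg1.
- have I x : 0 <= x -> x <= 1 -> \int[mu]_(y in `[0, x]) (v y - w y) = lambda^-1 * (sg x - sg 0).
    by move=> x0 x1; apply/eqP; rewrite -subr_eq0 sgI// in_itv/= x0.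
  move=> x y x0 xy y1.
  have h := I x x0 (le_trans xy y1); have := I y (le_trans x0 xy) y1.
  rewrite (@Rintegral_itvD _ _ 0 x y)//; first by rewrite h => k; lin.
  by apply: ucont_on_integrable; apply: ucont_on_sub (ucont_onB cv cw).
- move=> x y x0 xy y1 H; apply: (ftc_monotone fv) => // z xz zy.
  rewrite -[derive1 v z]mul1r; apply: (mono 1 x y) => //; first by left.
  move=> z' h1 h2; have := H z' h1 h2.
  by rewrite -[- _]mulrN1 ltr_pM2l// mul1r.
- move=> x y x0 xy y1 H; have [_ fE] := fv; rewrite -subr_le0 -fE// -oppr_ge0.
  have fi : mu.-integrable `[x, y] (EFin \o derive1 v).
    by have [fi _] := fv; exact: integrable_sub fi.
  pose g z := if (x < z) && (z < y) then derive1 v z else 0.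
  have gE z : `[x, y]%classic z -> z \notin [:: x; y] -> g z = derive1 v z.
    rewrite /= in_itv/= !inE negb_or => /andP[h1 h2] /andP[n1 n2].
    by rewrite /g lt_neqAle eq_sym n1 h1 lt_neqAle n2 h2.
  have [gi _] := integrable_eq_off (measurable_itv _) fi gE.
  rewrite (@eq_Rintegral_itv R _ g)//; last by move=> z h1 h2; rewrite /g h1 h2.
  rewrite -[leRHS]mulN1r -RintegralZl//.
  apply: Rintegral_ge0 => z _; rewrite /g; case: ifPn => [/andP[h1 h2]|_]; last by rewrite mulr0.
  apply: (mono (-1) x y) => //; first by right.
  move=> z' k1 k2; have := H z' k1 k2.
  by rewrite -[ltRHS]mulr1 ltr_pM2l// mulN1r ltrN2.
Qed.

Lemma sol_mild (lambda : R) (ab ae : R) w u p V : 0 < lambda -> AF ab ae w ->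
  ucont u -> sol 0 1 lambda^-1 w u p -> bv_primitive V u -> mild_solution lambda w u.
Proof.
move=> l0 AFw cu S bu.
have [acw Jw w0 w1] := AFw.
have cw : ucont w by exact: abs_continuous_dist.
have li : 0 < lambda^-1 by rewrite invr_gt0.
have [[u0 u1] _ pE _ _] := S; have [_ _ _ os] := bu.
split.
  split => //; first exact: sol_abs_continuous S acw.
  have [n [t [s pw]]] := J_regular_piecewise Jw.
  have [n' [t' [s' A]]] := piecewise_zigzag (sol_piecewise_smono cw cu S pw).
  have [p' [q' F]] := flats_ex cu A.
  by apply: (J_regular_flats A F); have [] := bv_primitive_BV bu.
exists (fun x => p x / lambda^-1); split => x; rewrite in_itv/= => /andP[x0 x1].
  exact: sol_clarke S os x0 x1.
rewrite -pE// -mulrBl mulrCA divff ?gt_eqF// mulr1 subrr//.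
Qed.

Lemma mild_exists (lambda : R) (ab ae : R) w : 0 < lambda -> AF ab ae w ->
  exists u, [/\ mild_solution lambda w u, ucont u /\ exists p, sol 0 1 lambda^-1 w u p
    & (BV_norm (derive1 u) <= BV_norm (derive1 w))%E].
Proof.
move=> l0 AFw.
have [acw Jw w0 w1] := AFw.
have cw : ucont w by exact: abs_continuous_dist.
have li : 0 < lambda^-1 by rewrite invr_gt0.
have [n [t [s pw]]] := J_regular_piecewise Jw.
have [V [VE bw]] := AF_bv_primitive AFw.
have [u [p [S cu]]] := sol_exists cw pw (ltW li).
have [v [uv bv Lv]] := sol_flattening cw cu S pw bw.
have cv : ucont v by exact: eq_ucont_on cu.
have Sv : sol 0 1 lambda^-1 w v p by apply: sol_ext S.
exists v; split; [exact: (sol_mild l0 AFw cv Sv bv)|by split => //; exists p|].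
rewrite /BV_norm VE; apply: leeD => //.
by have [] := bv_primitive_BV bv.
Qed.

Lemma mild_unique (lambda : R) (ab ae : R) w u v : 0 < lambda -> AF ab ae w ->
  mild_solution lambda w u -> mild_solution lambda w v -> forall x, 0 <= x -> x <= 1 -> u x = v x.
Proof.
move=> l0 AFw mu_ mv; have [acw _ _ _] := AFw.
have [cu [p S]] := mild_sol l0 AFw mu_; have [cv [q S']] := mild_sol l0 AFw mv.
exact: (sol_unique ler01 (abs_continuous_dist acw) cu cv S S').
Qed.

End mild_solutions.

(** * The limit of large lambda *)

Section Lq_limits.
Context {R : realType}.
Notation mu := (@lebesgue_measure R).
Notation O01 := (`]0, 1[%classic : set R).
Implicit Types (f g h : R -> R) (q B : R).

Lemma measurable_norm_powR (D : set R) f q : measurable_fun D f -> measurable_fun D (fun x => `|f x| `^ q).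
Proof.
move=> mf; have mn : measurable_fun D (fun x => `|f x|) := measurableT_comp (@normr_measurable R setT) mf.
exact: (measurableT_comp (measurable_powR q) mn).
Qed.

Lemma integrable_cst_O01 (k : R) : mu.-integrable O01 (EFin \o cst k).
Proof.
apply: (@integrableS _ _ _ mu `[0, 1]%classic) => //; first exact: subset_itv_oo_cc.
by apply: (@within_continuous_integrable R (cst k)); exact: continuous_subspaceT (@cst_continuous _ _ k).
Qed.

Lemma Lnorm_restrict q g : 1 <= q ->
  Lnorm mu q%:E (EFin \o (g \_ O01)) = ((\int[mu]_(x in O01) (`|g x| `^ q)%:E) `^ q^-1)%E.
Proof.
move=> q1.
have E : (\int[mu]_(x in O01) (`|g x| `^ q)%:E = \int[mu]_x (`|(EFin \o (g \_ O01)) x| `^ q))%E.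
  rewrite integral_mkcond; apply: eq_integral => x _; rewrite /= patchE /patch.
  case: ifPn => _ //.
  by rewrite normr0 powR0// gt_eqF//; lin.
by rewrite E unlock.
Qed.

Lemma Lq_member q B g h (s : seq R) : 1 <= q -> measurable_fun O01 h ->
  (forall x, O01 x -> `|h x| <= B) -> (forall x, O01 x -> x \notin s -> g x = h x) ->
  g \_ O01 \in Lfun mu q%:E.
Proof.
move=> q1 mh hB gh.
have mg : measurable_fun O01 g by apply: (measurable_eq_off _ mh gh).
rewrite inE; apply/andP; split; rewrite inE/=.
  exact: (measurable_restrictT g (measurable_itv _)).1 mg.
rewrite /finite_norm Lnorm_restrict//; apply: poweR_lty.
have mhq : measurable_fun O01 (fun x => `|h x| `^ q) by exact: measurable_norm_powR.
have B0 : 0 <= B.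
  by apply: le_trans (hB (1 / 2) _); rewrite //= in_itv/=; apply/andP; split; lin.
have hi : mu.-integrable O01 (EFin \o (fun x => `|h x| `^ q)).
  apply: (@le_integrable _ _ _ mu O01 _ (EFin \o (fun x => `|h x| `^ q)) (EFin \o cst (B `^ q))) => //.
  - exact/measurable_EFinP.
  - move=> x Ox; rewrite lee_fin /= !(ger0_norm (powR_ge0 _ _)).
    by apply: ge0_ler_powR; rewrite ?nnegrE//; [lin|exact: hB].
  - exact: integrable_cst_O01.
have [gi _] := integrable_eq_off (f := fun x => `|g x| `^ q) (measurable_itv _) hi
  (fun x Ox xs => congr1 (fun y => `|y| `^ q) (gh x Ox xs)).
have /integrableP[_] := gi; apply: le_lt_trans.
rewrite le_eqVlt; apply/orP; left; apply/eqP; apply: eq_integral => x _.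
by rewrite /= (ger0_norm (powR_ge0 _ _)).
Qed.

Lemma Lq_dominated q B (h : nat -> R -> R) (s : seq R) : 1 <= q ->
  (forall n, measurable_fun O01 (h n)) -> (forall n x, O01 x -> `|h n x| <= B) ->
  (forall x, O01 x -> x \notin s -> forall e, 0 < e -> exists N, forall n, (N <= n)%N -> `|h n x| <= e) ->
  (\int[mu]_(x in O01) (`|h n x| `^ q)%:E @[n --> \oo] --> 0)%E.
Proof.
move=> q1 mh hB h0.
have B0 : 0 <= B.
  by apply: le_trans (hB 0%N (1 / 2) _); rewrite //= in_itv/=; apply/andP; split; lin.
have := @dominated_convergence _ _ _ mu O01 (measurable_itv _)
  (fun n x => (`|h n x| `^ q)%:E) (cst 0%E) (EFin \o cst (B `^ q)).
rewrite integral_cst// mul0e => -[].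
- move=> n; apply/measurable_EFinP.
  exact: (measurable_norm_powR q (mh n)).
- exact: measurable_cst.
- have [N [mN N0 sN]] := finite_negligible s; exists N; split => // x nx; apply: sN.
  apply: contrapT => /= xs; apply: nx => Ox.
  have {}xs : x \notin s by apply/negP.
  apply/fine_cvgP; split; first exact: nearW.
  apply/cvgrPdist_le => e e0.
  (* Below 1 the power with exponent [q >= 1] does not exceed its base. *)
  have [|K HK] := h0 x Ox xs (Num.min e 1); first by rewrite lt_min e0 ltr01.
  exists K => // n /= Kn; have := HK n Kn; rewrite le_min => /andP[h1 h2].
  rewrite sub0r normrN (ger0_norm (powR_ge0 _ _)).
  have [->|nz] := eqVneq `|h n x| 0; first by rewrite powR0 ?ltW// gt_eqF//; lin.
  by apply: le_trans h1; apply: ge1r_powR => //; rewrite h2 lt_neqAle eq_sym nz normr_ge0.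
- exact: integrable_cst_O01.
- apply: (@aeW _ (measurableTypeR R)) => x n Ox; rewrite lee_fin ger0_norm ?powR_ge0//.
  by apply: ge0_ler_powR; rewrite ?nnegrE//; [lin|exact: hB].
- by move=> _ _.
Qed.

(** [F] and [f] may contain derivatives with arbitrary values at finitely many corners; they are
    replaced by bounded measurable functions that agree off finite sets, which for [F] may vary with
    the parameter. *)
Lemma cvg_Lq_off q B l0 (F : R -> R -> R) f (h : R -> R -> R) f' (s : seq R) : 1 <= q ->
  (forall l, l0 < l -> [/\ measurable_fun O01 (h l), forall x, O01 x -> `|h l x| <= B &
     exists s', forall x, O01 x -> x \notin (s' : seq R) -> F l x = h l x]) ->
  measurable_fun O01 f' -> (forall x, O01 x -> `|f' x| <= B) ->
  (forall x, O01 x -> x \notin s -> f x = f' x) ->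
  (forall x, O01 x -> x \notin s -> forall e, 0 < e -> exists l1, forall l, l0 < l -> l1 < l ->
     `|h l x - f' x| <= e) ->
  cvg_Lq q F f.
Proof.
move=> q1 Hh mf' fB ff' lim.
split.
- exact: Lq_member mf' fB ff'.
- exists l0; split; first exact: num_real.
  move=> l l0l; have [mh hB [s' Fh]] := Hh l l0l.
  exact: (Lq_member q1 mh hB Fh).
have small e : 0 < e -> exists l1, forall l, l0 < l -> l1 < l ->
    ((\int[mu]_(x in O01) (`|h l x - f' x| `^ q)%:E) <= e%:E)%E.
  move=> e0; apply: contrapT => /forallNP N.
  (* Dominated convergence is available along sequences: if the integrals did not become small, a
     sequence of parameters tending to infinity would contradict it. *)
  have /choice[l Hl] : forall n : nat, exists l, [/\ l0 < l, n%:R < l &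
      (e%:E < \int[mu]_(x in O01) (`|h l x - f' x| `^ q)%:E)%E].
    move=> n; apply: contrapT => /forallNP M; apply: (N n%:R) => l h1 h2.
    by rewrite leNgt; apply/negP => h3; apply: (M l).
  have C : (\int[mu]_(x in O01) (`|h (l n) x - f' x| `^ q)%:E @[n --> \oo] --> 0)%E.
    apply: (@Lq_dominated q (B + B) (fun n x => h (l n) x - f' x) s q1).
    - by move=> n; have [k _ _] := Hl n; have [mh _ _] := Hh _ k; exact: measurable_funB.
    - move=> n x Ox; have [k _ _] := Hl n; have [_ hB _] := Hh _ k.
      by apply: (le_trans (ler_normB _ _)); apply: lerD; [exact: hB|exact: fB].
    - move=> x Ox xs d d0; have [l1 Hl1] := lim x Ox xs d d0.
      exists (Num.truncn `|l1|).+1 => n Nn; have [k1 k2 _] := Hl n; apply: Hl1 => //.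
      apply: le_lt_trans k2; apply: (le_trans (ler_norm _)).
      by apply: (le_trans (ltW (truncnS_gt _))); rewrite ler_nat.
  have /fine_cvgP[Cf /cvgrPdist_lt/(_ e e0)[K2 _ HK2]] := C; have [K1 _ HK1] := Cf.
  pose n := maxn K1 K2; have := HK2 n (leq_maxr _ _); have := HK1 n (leq_maxl _ _) => /= fn.
  have [_ _] := Hl n; rewrite -[ltRHS]fineK// lte_fin => h1.
  by rewrite sub0r normrN => h2; have := lt_le_trans h2 (le_trans (ltW h1) (ler_norm _)); rewrite ltxx.
apply/fine_cvgP.
have bound e : 0 < e -> exists l1, forall l, l0 < l -> l1 < l ->
    (Lnorm mu q%:E (EFin \o ((F l \- f)%R \_ O01)) <= e%:E)%E.
  move=> e0; have eq0 : 0 < e `^ q by rewrite powR_gt0.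
  have [l1 Hl1] := small _ eq0; exists l1 => l h1 h2.
  have [mh hB [s' Fh]] := Hh l h1.
  rewrite Lnorm_restrict//.
  have qq : q * q^-1 = 1 by rewrite divff// gt_eqF//; lin.
  have -> : e%:E = ((e `^ q)%:E `^ q^-1)%E.
    by rewrite poweR_EFin -powRrM qq powRr1// ltW.
  have mhf : measurable_fun O01 (fun x => `|h l x - f' x| `^ q).
    by apply: measurable_norm_powR; exact: measurable_funB.
  have hi : mu.-integrable O01 (EFin \o (fun x => `|h l x - f' x| `^ q)).
    apply/integrableP; split; first exact/measurable_EFinP.
    apply: le_lt_trans (ltry (e `^ q)); apply: le_trans (Hl1 l h1 h2).
    apply: ge0_le_integral => //.
    - by apply: measurableT_comp => //; exact/measurable_EFinP.
    - exact/measurable_EFinP.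
    - by move=> x _; rewrite /= ger0_norm ?powR_ge0.
  have Eq x : O01 x -> x \notin s' ++ s -> `|(F l \- f) x| `^ q = `|h l x - f' x| `^ q.
    by move=> Ox; rewrite mem_cat negb_or => /andP[k1 k2]; rewrite /= Fh// ff'.
  have [_ ->] := integrable_eq_off (measurable_itv _) hi Eq.
  apply: gt0_ler_poweR; last exact: Hl1.
  - by rewrite invr_ge0; lin.
  - by rewrite in_itv/= leey andbT; apply: integral_ge0 => x _; rewrite lee_fin powR_ge0.
  - by rewrite in_itv/= leey andbT lee_fin powR_ge0.
have fin l e : (Lnorm mu q%:E (EFin \o ((F l \- f)%R \_ O01)) <= e%:E)%E ->
    Lnorm mu q%:E (EFin \o ((F l \- f)%R \_ O01)) \is a fin_num.
  by move=> h1; rewrite ge0_fin_numE ?Lnorm_ge0//; exact: le_lt_trans h1 (ltry _).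
split.
  have [l1 H] := bound 1 ltr01; exists (Num.max l0 l1); split; first exact: num_real.
  by move=> l; rewrite gt_max => /andP[h1 h2]; exact: fin (H l h1 h2).
apply/cvgrPdist_le => e e0; have [l1 H] := bound e e0.
exists (Num.max l0 l1); split; first exact: num_real.
move=> l; rewrite gt_max => /andP[h1 h2]; have k := H l h1 h2; have kf := fin l e k.
rewrite sub0r normrN /= ger0_norm ?fine_ge0 ?Lnorm_ge0//.
by rewrite -lee_fin fineK.
Qed.

End Lq_limits.

(** * Asymptotics of the cuts as the parameter tends to 0 *)

Section small_parameter.
Context {R : realType}.
Notation mu := (@lebesgue_measure R).
Notation ucont := (ucont_on 0 1).
Implicit Types (f g w u v : R -> R) (a b c d x y T : R) (p q t z : nat -> R).

Lemma finite_min (m : nat) (P : nat -> R -> Prop) :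
  (forall i, (i < m)%N -> exists2 T1 : R, 0 < T1 & forall T, T <= T1 -> P i T) ->
  exists2 T1 : R, 0 < T1 & forall i, (i < m)%N -> forall T, T <= T1 -> P i T.
Proof.
elim: m => [|m IH] H; first by exists 1.
have [|T1 T10 H1] := IH; first by move=> i im; apply: H; exact: ltnW.
have [T2 T20 H2] := H m (ltnSn m).
exists (Num.min T1 T2); first by rewrite lt_min T10.
move=> i; rewrite ltnS leq_eqVlt => /predU1P[->|im] T; rewrite le_min => /andP[h1 h2].
  exact: H2.
exact: H1.
Qed.

Lemma finite_max (m : nat) (f : nat -> R) : exists2 B, 0 <= B & forall i, (i < m)%N -> f i <= B.
Proof.
elim: m => [|m [B B0 H]]; first by exists 0.
exists (Num.max B (f m)); first by rewrite le_max B0.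
move=> i; rewrite ltnS leq_eqVlt => /predU1P[->|im]; first by rewrite le_max lexx orbT.
by rewrite le_max H.
Qed.

Definition solves T w u := ucont u /\ exists v, sol 0 1 T w u v.

Definition cut_by n (t : nat -> R) (s : R) w z T u := [/\ zigzag n t s u,
  forall x, 0 <= x -> x <= z 0%N -> u x = w x,
  forall x, z n.-1 <= x -> x <= 1 -> u x = w x
  & forall i, (i.+1 < n)%N -> exists c, cut_at T s w u z t i c].

Lemma zigzag_ext n t s u v : (forall x, 0 <= x -> x <= 1 -> u x = v x) -> zigzag n t s u -> zigzag n t s v.
Proof.
move=> uv A; have [s1 t01 tt mt st] := A.
have E i : (i <= n)%N -> u (t i) = v (t i).
  by move=> ni; apply: uv; [exact: zigzag_ge0 A ni|exact: zigzag_le1 A ni].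
split => //.
  move=> i ni x y h1 h2 h3.
  have t0 := zigzag_ge0 A (ltnW ni); have t1 := zigzag_le1 A ni.
  by rewrite -!uv; [exact: mt|lin..].
case: st => [h|st]; [by left|right => i ni].
by rewrite -!E//; [exact: st|exact: ltnW].
Qed.

(** By uniqueness every solution at a small parameter is the explicit cut. *)
Lemma small_cut_sol n t s w z : ucont w -> zigzag n t s w -> mid_point n t s w z ->
  exists2 T0 : R, 0 < T0 & forall T u, 0 < T -> T <= T0 -> solves T w u -> cut_by n t s w z T u.
Proof.
move=> cw A Z; have [T0 T00 H] := small_cut cw A Z; exists T0 => // T u T1 T2 [cu [v S]].
have [u' [p' [[S' cu'] A' l r C]]] := H T T1 T2.
have E := sol_unique ler01 cw cu' cu S' S.
have n0 := zigzag_gt0 A.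
have z01 i : (i < n)%N -> 0 <= z i <= 1.
  move=> ni; have [h1 h2 _] := Z i ni.
  by have := zigzag_ge0 A (ltnW ni); have := zigzag_le1 A ni => *; apply/andP; split; lin.
split.
- exact: zigzag_ext A'.
- by move=> x x0 xz; have /andP[_ h] := z01 0%N n0; rewrite -E ?l//; lin.
- move=> x xz x1; have /andP[h _] := z01 n.-1 ltac:(by rewrite prednK).
  by rewrite -E ?r//; lin.
- move=> i ni; have [c [h1 h2 h3 h4 h5]] := C i ni; exists c; split => //.
  move=> x xz zx; have /andP[k1 _] := z01 i (ltnW ni); have /andP[_ k2] := z01 i.+1 ni.
  by rewrite -E ?h5//; lin.
Qed.

Lemma quotient_le (a d T : R) : 0 < T -> 0 < d -> a * d <= T + T -> T^-1 * a <= 2 / d.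
Proof. by move=> T0 d0 h; rewrite ler_pdivlMr// -mulrA mulrC ler_pdivrMr//; lin. Qed.

Lemma quotient_ge (a d T : R) : 0 < T -> 0 < d -> T + T <= a * d -> 2 / d <= T^-1 * a.
Proof. by move=> T0 d0 h; rewrite ler_pdivrMr// -mulrA mulrC ler_pdivlMr//; lin. Qed.

(** [[P i, Q i]] is the plateau of [u] over the facet [[p i, q i]] of [w]. The last clause compares
    the removed area [T + T] with the rectangles over these two intervals whose height is the depth
    of the cut. *)
Definition peak T (s : R) w u (t z p q P Q : nat -> R) i c :=
  [/\ [/\ z i < P i, P i <= p i, q i <= Q i & Q i < z i.+1],
    forall x, z i <= x -> x <= z i.+1 -> asign s i * u x = Num.min (asign s i * w x) c,
    forall x, P i <= x -> x <= Q i -> asign s i * u x = c /\ c <= asign s i * w x <= asign s i * w (t i.+1),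
    forall x, z i <= x -> x <= z i.+1 -> ~ (P i <= x <= Q i) -> u x = w x
  & (asign s i * w (t i.+1) - c) * (q i - p i) <= T + T <= (asign s i * w (t i.+1) - c) * (Q i - P i)].

(** The region between the level [c] and the graph contains a rectangle of height [M - c] over
    [[p, q]] and lies inside the one over [[P, Q]]. *)
Lemma excess_integral_bounds f (a b p q P Q M c : R) : ucont_on a b f ->
  a <= P -> P <= p -> p <= q -> q <= Q -> Q <= b ->
  (forall x, p <= x -> x <= q -> M <= f x) ->
  (forall x, P <= x -> x <= Q -> f x <= M) ->
  (forall x, a <= x -> x <= b -> ~ (P <= x <= Q) -> f x <= c) ->
  (M - c) * (q - p) <= \int[mu]_(x in `[a, b]) excess f c x <= (M - c) * (Q - P) \/ M < c.
Proof.
move=> cf aP Pp pq qQ Qb fpq fPQ fout.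
have [cM|Mc] := leP c M; [left|by right].
have ce := ucont_on_excess c cf.
have fi x y : a <= x -> y <= b -> mu.-integrable `[x, y] (EFin \o excess f c).
  by move=> h1 h2; apply: ucont_on_integrable; apply: ucont_on_sub ce.
have split3 x y : a <= x -> x <= y -> y <= b -> \int[mu]_(v in `[a, b]) excess f c v =
    \int[mu]_(v in `[a, x]) excess f c v +
    (\int[mu]_(v in `[x, y]) excess f c v + \int[mu]_(v in `[y, b]) excess f c v).
  move=> h1 h2 h3; rewrite (@Rintegral_itvD _ _ a x)//; [|exact: le_trans h3|exact: fi].
  by rewrite (@Rintegral_itvD _ _ x y)//; exact: fi.
have I0 (x y : R) : 0 <= \int[mu]_(v in `[x, y]) excess f c v.
  by apply: Rintegral_ge0 => v _; exact: excess_ge0.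
have ap := le_trans aP Pp; have qb := le_trans qQ Qb.
apply/andP; split.
  rewrite (split3 p q)// -[leLHS]add0r -[_ * _]addr0.
  apply: lerD => //; apply: lerD => //; apply: Rint_ge => //; first by apply: ucont_on_sub ce.
  by move=> v h1 h2; rewrite /excess le_max; apply/orP; left; rewrite lerD2r; exact: fpq.
have J0 (x y : R) : a <= x -> x <= y -> y <= b -> (forall v : R, x < v -> v < y -> ~ (P <= v <= Q)) ->
    \int[mu]_(v in `[x, y]) excess f c v = 0.
  move=> h1 h2 h3 h4; rewrite (@eq_Rintegral_itv _ _ (cst 0)).
  - by rewrite Rint_cst// mul0r.
  - exact: fi.
  - by apply: ucont_on_integrable => e e0; exists 1 => // *; rewrite subrr normr0.
  - move=> v k1 k2; rewrite /excess; apply/max_idPr; rewrite subr_le0.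
    by apply: fout; [exact: le_trans (ltW k1)|exact: le_trans (ltW k2) h3|exact: h4].
have PQ : P <= Q := le_trans Pp (le_trans pq qQ).
rewrite (split3 P Q)// (J0 a P)// ?(J0 Q b)//.
- rewrite add0r addr0; apply: Rint_le => //; first by apply: ucont_on_sub ce.
  move=> v h1 h2; rewrite /excess ge_max subr_ge0 cM andbT lerD2r; exact: fPQ.
- exact: le_trans aP PQ.
- by move=> v h1 _ /andP[_ h3]; move: h3; rewrite leNgt h1.
- exact: le_trans PQ Qb.
- by move=> v _ h2 /andP[h3 _]; move: h3; rewrite leNgt h2.
Qed.

Lemma flats_mid_point n t s w z p q i : zigzag n t s w -> mid_point n t s w z ->
  flats n t s w p q -> (i.+1 < n)%N -> z i < p i /\ q i < z i.+1.
Proof.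
move=> A Z F ni; have Sw := zigzag_strict A ni.
have [z1 z2 /(_ Sw)/andP[z3 z4]] := Z i (ltnW ni); have [z5 z6 /(_ Sw)/andP[z7 z8]] := Z i.+1 ni.
move: z7; rewrite asignS !mulNr ltrN2 => z9.
have [[f1 f2] [f3 f4] f5 f6 f7] := F i ni; split.
  by rewrite ltNge; apply/negP => h; move: z4; rewrite f5 ?ltxx// (le_trans (ltW z2)).
by rewrite ltNge; apply/negP => h; move: z9; rewrite f5 ?ltxx// (le_trans _ (ltW z5)).
Qed.

Lemma cut_peak_at n t s w z p q T u P Q i c : ucont w -> zigzag n t s w -> mid_point n t s w z ->
  flats n t s w p q -> flats n t s u P Q -> (i.+1 < n)%N -> cut_at T s w u z t i c ->
  peak T s w u t z p q P Q i c.
Proof.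
move=> cw A Z F FU ni [c1 c2 c3 cI cu].
have [s1 _ _ mt _] := A.
have [z1 z2 _] := Z i (ltnW ni); have [z5 z6 _] := Z i.+1 ni.
have [zp qz] := flats_mid_point A Z F ni.
have [[f1 f2] [f3 f4] f5 f6 f7] := F i ni; have [[g1 g2] [g3 g4] g5 g6 g7] := FU i ni.
have cuM x : z i <= x -> x <= z i.+1 -> u x = u (t i.+1) -> c <= asign s i * w x.
  have ut : asign s i * u (t i.+1) = c.
    by rewrite (cu _ (ltW z2) (ltW z5)) (min_idPr (ltW c3)).
  by move=> h1 h2 e1; move: (cu x h1 h2); rewrite e1 ut => /esym/min_idPr.
have ut : asign s i * u (t i.+1) = c.
  by rewrite (cu _ (ltW z2) (ltW z5)) (min_idPr (ltW c3)).
have zt := le_trans (ltW z2) (ltW z5).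
have zP : z i < P i.
  rewrite ltNge; apply/negP => h; have := cuM (z i) (lexx _) zt (g5 _ h (le_trans (ltW z2) g3)).
  by rewrite leNgt c1.
have Qz : Q i < z i.+1.
  rewrite ltNge; apply/negP => h; have := cuM (z i.+1) zt (lexx _) (g5 _ (le_trans g2 (ltW z5)) h).
  by rewrite leNgt c2.
have flatu x : p i <= x -> x <= q i -> asign s i * u x = c.
  move=> h1 h2; rewrite cu ?f5 ?(min_idPr (ltW c3))//.
    exact: le_trans (ltW zp) h1.
  exact: le_trans h2 (ltW qz).
have Pp : P i <= p i.
  rewrite leNgt; apply/negP => h; have := g6 (p i) (ltW f1) h.
  by rewrite flatu ?ut ?ltxx// (le_trans f2).
have qQ : q i <= Q i.
  rewrite leNgt; apply/negP => h; have := g7 (q i) h (ltW f4).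
  by rewrite flatu ?ut ?ltxx// (le_trans f2).
have wM x : z i <= x -> x <= z i.+1 -> asign s i * w x <= asign s i * w (t i.+1).
  move=> h1 h2; have [h|/ltW h] := leP x (t i.+1).
    exact: (mt i (ltnW ni) x _ (le_trans (ltW z1) h1) h).
  by have := mt i.+1 ni _ _ (lexx _) h (le_trans h2 (ltW z6)); rewrite asignS !mulNr lerN2.
have inPQ x : P i <= x -> x <= Q i -> asign s i * u x = c /\ c <= asign s i * w x <= asign s i * w (t i.+1).
  move=> h1 h2; have e1 : u x = u (t i.+1) by exact: g5.
  have h3 := le_trans (ltW zP) h1; have h4 := le_trans h2 (ltW Qz).
  by split; [rewrite e1|rewrite wM// cuM].
have outPQ x : z i <= x -> x <= z i.+1 -> ~ (P i <= x <= Q i) -> u x = w x /\ asign s i * w x <= c.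
  move=> h1 h2 h3; have lt : asign s i * u x < c.
    have [h4|h4] := ltP x (P i); first by rewrite -ut; apply: g6 => //; exact: le_trans (ltW z1) h1.
    have [h5|h5] := ltP (Q i) x; last by case: h3; rewrite h4.
    by rewrite -ut; apply: g7 => //; exact: le_trans h2 (ltW z6).
  have : asign s i * u x = asign s i * w x.
    by move: lt; rewrite cu// minEle; case: ifPn => // _; rewrite ltxx.
  by move=> e1; split; [exact: (asign_inj s1 e1)|rewrite -e1 ltW].
split => //; first by move=> x h1 h2 h3; have [] := outPQ x h1 h2 h3.
have cw' : ucont_on (z i) (z i.+1) w.
  apply: ucont_on_sub cw; first exact: le_trans (zigzag_ge0 A (ltnW (ltnW ni))) (ltW z1).
  exact: le_trans (ltW z6) (zigzag_le1 A ni).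
have cwz : ucont_on (z i) (z i.+1) (fun y => asign s i * w y).
  case: (asign1 i s1) => ->; first by apply: eq_ucont_on cw' => x _ _; rewrite mul1r.
  by apply: eq_ucont_on (ucont_onN cw') => x _ _; rewrite mulN1r.
have pq := le_trans f2 f3.
have M1 x : p i <= x -> x <= q i -> asign s i * w (t i.+1) <= asign s i * w x.
  by move=> h1 h2; rewrite f5.
have M2 x : P i <= x -> x <= Q i -> asign s i * w x <= asign s i * w (t i.+1).
  by move=> h1 h2; have [_ /andP[]] := inPQ x h1 h2.
have M3 x : z i <= x -> x <= z i.+1 -> ~ (P i <= x <= Q i) -> asign s i * w x <= c.
  by move=> h1 h2 h3; have [] := outPQ x h1 h2 h3.
have [|h] := excess_integral_bounds cwz (ltW zP) Pp pq qQ (ltW Qz) M1 M2 M3; first by rewrite cI.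
by move: (lt_trans c3 h); rewrite ltxx.
Qed.

Section asymptotics.
Variables (n : nat) (t : nat -> R) (s : R) (w : R -> R) (z p q : nat -> R) (T0 : R).
Hypotheses (cw : ucont w) (A : zigzag n t s w) (Z : mid_point n t s w z) (F : flats n t s w p q).
Hypothesis pq : forall i, (i < n.-1)%N -> p i < q i.
Hypothesis small : forall T u, 0 < T -> T <= T0 -> solves T w u -> cut_by n t s w z T u.

Let pred_lt i : (i < n.-1)%N -> (i.+1 < n)%N := @ltn_pred_S _ _ _ _ _ A i.

Lemma cut_peak T u P Q i : 0 < T -> T <= T0 -> solves T w u -> flats n t s u P Q -> (i < n.-1)%N ->
  exists c, peak T s w u t z p q P Q i c.
Proof.
move=> T1 T2 S FU /pred_lt ni; have [_ _ _ C] := small T1 T2 S.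
by have [c Hc] := C i ni; exists c; exact: (cut_peak_at cw A Z F FU ni Hc).
Qed.

Lemma cut_cover T u P Q x : 0 < T -> T <= T0 -> solves T w u -> flats n t s u P Q ->
  0 <= x -> x <= 1 -> (forall i, (i < n.-1)%N -> ~ (P i <= x <= Q i)) -> u x = w x.
Proof.
move=> T1 T2 S FU x0 x1 N; have [A' l r C] := small T1 T2 S.
have [h|/ltW h] := leP x (z 0%N); first exact: l.
have [h'|/ltW h'] := leP (z n.-1) x; first exact: r.
suff K k : (k <= n.-1)%N -> x <= z k -> u x = w x by exact: (K n.-1).
elim: k => [|k IH] kn xk.
  by apply: l.
have [h2|/ltW h2] := leP x (z k); first exact: IH (ltnW kn) h2.
have [c [_ _ _ H _]] := cut_peak T1 T2 S FU kn.
by apply: H => //; exact: N.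
Qed.

(** Depth times width of the facet of [w] is at most [2 T], so the quotient is at most
    [2 / (q i - p i)] for every [T]. Nondegenerate facets thus provide the dominating constant. *)
Lemma cut_bound B T u P Q x : 0 < T -> T <= T0 -> solves T w u -> flats n t s u P Q -> 0 <= B ->
  (forall i, (i < n.-1)%N -> 2 / (q i - p i) <= B) ->
  0 <= x -> x <= 1 -> `|T^-1 * (u x - w x)| <= B.
Proof.
move=> T1 T2 S FU B0 HB x0 x1; have [s1 _ _ _ _] := A.
have Ti : 0 < T^-1 by rewrite invr_gt0.
have [[i ni /andP[xP xQ]]|N] := pselect (exists2 i, (i < n.-1)%N & P i <= x <= Q i); last first.
  rewrite (cut_cover T1 T2 S FU x0 x1); first by rewrite subrr mulr0 normr0.
  by move=> i ni h; apply: N; exists i.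
have [c [_ _ H _ /andP[H1 _]]] := cut_peak T1 T2 S FU ni.
have [h1 /andP[h2 h3]] := H x xP xQ; have pqi := pq ni.
have d0 : 0 < q i - p i by lra.
have E : `|u x - w x| = asign s i * w x - c.
  have -> : u x - w x = asign s i * (asign s i * (u x - w x)).
    by case: (asign1 i s1) => ->; ring.
  rewrite normrM; have -> : `|asign s i| = 1 by case: (asign1 i s1) => ->; rewrite ?normrN normr1.
  by rewrite mul1r mulrBr h1 distrC ger0_norm// subr_ge0.
rewrite normrM gtr0_norm// E; apply: le_trans (HB i ni).
apply: quotient_le => //; apply: le_trans H1.
by rewrite ler_pM2r// lerD2r.
Qed.

(** At points [x1] and [x2] just outside the facet, [w] misses the extremal level by at least some
    [d > 0]. Once the depth of the cut is below [d], the plateau cannot reach them. *)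
Lemma cut_close (e : R) : 0 < e -> exists2 T1 : R, 0 < T1 & forall i, (i < n.-1)%N -> forall T, T <= T1 ->
  forall u P Q, 0 < T -> T <= T0 -> solves T w u -> flats n t s u P Q ->
  p i - e < P i /\ Q i < q i + e.
Proof.
move=> e0; apply: finite_min => i im; have ni := pred_lt im.
have [z1 z2 _] := Z (ltnW ni); have [z5 z6 _] := Z ni.
have [zp qz] := flats_mid_point A Z F ni.
have [[f1 f2] [f3 f4] f5 f6 f7] := F ni; have d0 : 0 < q i - p i by rewrite subr_gt0 pq.
have e20 : 0 < e / 2 by rewrite divr_gt0.
have e21 : e / 2 < e by rewrite ltr_pdivrMr// ltr_pMr// ltr1n.
have [x1 [a1 a2 a3]] : exists x1, [/\ z i <= x1, p i - e < x1 & x1 < p i].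
  exists (Num.max (z i) (p i - e / 2)); split.
  - by rewrite le_max lexx.
  - by rewrite lt_max ltrD2l ltrN2 e21 orbT.
  - by rewrite gt_max zp gtrBl e20.
have [x2 [b1 b2 b3]] : exists x2, [/\ x2 <= z i.+1, x2 < q i + e & q i < x2].
  exists (Num.min (z i.+1) (q i + e / 2)); split.
  - by rewrite ge_min lexx.
  - by rewrite gt_min ltrD2l e21 orbT.
  - by rewrite lt_min qz ltrDl e20.
have k1 : asign s i * w x1 < asign s i * w (t i.+1) by exact: f6 (le_trans (ltW z1) a1) a3.
have k2 : asign s i * w x2 < asign s i * w (t i.+1) by exact: f7 b3 (le_trans b1 (ltW z6)).
have [M ME] : exists M, M = asign s i * w (t i.+1) by exists (asign s i * w (t i.+1)).
rewrite -ME in k1 k2.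
have [d [dd1 dd2 dd0]] : exists d, [/\ d <= M - asign s i * w x1, d <= M - asign s i * w x2 & 0 < d].
  exists (Num.min (M - asign s i * w x1) (M - asign s i * w x2)).
  by rewrite !ge_min !lexx orbT lt_min !subr_gt0 k1 k2.
have T10 : 0 < d * (q i - p i) / 4 by rewrite divr_gt0// mulr_gt0.
(* Depth times [q i - p i] is at most [2 T], hence at most half of [d * (q i - p i)]. *)
exists (d * (q i - p i) / 4) => // T TT u P Q T1 T2 S FU.
have [c [[H0 H1 H2 H3] _ Hin _ /andP[H4 _]]] := cut_peak T1 T2 S FU im.
rewrite -ME in H4.
have cd : M - c < d.
  rewrite -(ltr_pM2r d0); apply: (le_lt_trans H4); move: TT T10.
  by move: (d * _) => X TT X0; lra.
split; rewrite ltNge; apply/negP => h.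
  have := Hin x1 (le_trans h (ltW a2)) (le_trans (ltW a3) (le_trans (ltW (pq im)) H2)).
  by move=> [_ /andP[k _]]; lra.
have := Hin x2 (le_trans H1 (le_trans (ltW (pq im)) (ltW b3))) (le_trans (ltW b2) h).
by move=> [_ /andP[k _]]; lra.
Qed.

Lemma inv_width_close (d d' e : R) : 0 < d -> 0 < e -> d <= d' -> d' <= d + e * d * d / 2 ->
  0 <= 2 / d - 2 / d' <= e.
Proof.
move=> d0 e0 dd d'd; have d'0 : 0 < d' by lra.
have -> : 2 / d - 2 / d' = 2 * (d' - d) / (d * d') by field; apply/andP; split; rewrite gt_eqF.
have dd'0 : 0 < d * d' by rewrite mulr_gt0.
rewrite divr_ge0/=; [|lra|exact: ltW].
rewrite ler_pdivrMr//; apply: (@le_trans _ _ (e * (d * d))).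
  by lra.
by rewrite ler_pM2l// ler_pM2l.
Qed.

(** The depth divided by [T] is squeezed between [2 / (Q i - P i)] and [2 / (q i - p i)], and the
    two widths become equal in the limit. *)
Lemma cut_limit_in i x (e : R) : (i < n.-1)%N -> p i < x -> x < q i -> 0 < e ->
  exists2 T1 : R, 0 < T1 & forall T, T <= T1 ->
  forall u P Q, 0 < T -> T <= T0 -> solves T w u -> flats n t s u P Q ->
  [/\ P i < x, x < Q i, `|T^-1 * (u x - w x) + 2 * asign s i / (q i - p i)| <= e
    & `|2 * asign s i / (q i - p i) - 2 * asign s i / (Q i - P i)| <= e].
Proof.
move=> ni px xq e0; have [s1 _ _ _ _] := A; have pqi := pq ni.
have d0 : 0 < q i - p i by lra.
(* Moving each end by at most this amount keeps the gain in width within the bound of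
   [inv_width_close]. *)
have e'0 : 0 < e * (q i - p i) * (q i - p i) / 4 by rewrite divr_gt0// !mulr_gt0.
have [T1 T10 H1] := cut_close e'0; exists T1 => // T TT u P Q T1' T2 S FU.
have [k1 k2] := H1 i ni T TT u P Q T1' T2 S FU.
have Ti : 0 < T^-1 by rewrite invr_gt0.
have [c [[H2 H3 H4 H5] Hu Hin _ /andP[H6 H7]]] := cut_peak T1' T2 S FU ni.
have Px : P i < x by lra.
have xQ : x < Q i by lra.
have w1 : q i - p i <= Q i - P i by lra.
have w2 : Q i - P i <= q i - p i + e * (q i - p i) * (q i - p i) / 2.
  by lra.
have /andP[W1 W2] := inv_width_close d0 e0 w1 w2.
have [h1 /andP[h2 h3]] := Hin x (ltW Px) (ltW xQ).
have [[f1 f2] [f3 f4] f5 f6 f7] := F (pred_lt ni).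
have wx : w x = w (t i.+1) by apply: f5; exact: ltW.
have aa : asign s i * asign s i = 1 by case: (asign1 i s1) => ->; ring.
have a1 : `|asign s i| = 1 by case: (asign1 i s1) => ->; rewrite ?normrN normr1.
split => //.
  have -> : T^-1 * (u x - w x) + 2 * asign s i / (q i - p i) =
      asign s i * (2 / (q i - p i) - T^-1 * (asign s i * w (t i.+1) - c)).
    by rewrite -h1 wx; case: (asign1 i s1) => ->; ring.
  rewrite normrM a1 mul1r.
  have D0 : 0 < Q i - P i by lra.
  have l1 : T^-1 * (asign s i * w (t i.+1) - c) <= 2 / (q i - p i).
    exact: quotient_le.
  have l2 : 2 / (Q i - P i) <= T^-1 * (asign s i * w (t i.+1) - c).
    exact: quotient_ge.
  rewrite ler_norml; move: l1 l2 W1 W2 e0; set X := T^-1 * _; set Y := 2 / _; set Y' := 2 / _.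
  by move=> *; apply/andP; split; lra.
have -> : 2 * asign s i / (q i - p i) - 2 * asign s i / (Q i - P i) =
   asign s i * (2 / (q i - p i) - 2 / (Q i - P i)) by ring.
by rewrite normrM a1 mul1r ger0_norm.
Qed.

Lemma cut_limit_out x : 0 <= x -> x <= 1 -> (forall i, (i < n.-1)%N -> ~ (p i <= x <= q i)) ->
  exists2 T1 : R, 0 < T1 & forall T, T <= T1 ->
  forall u P Q, 0 < T -> T <= T0 -> solves T w u -> flats n t s u P Q ->
  u x = w x /\ forall i, (i < n.-1)%N -> ~ (P i <= x <= Q i).
Proof.
move=> x0 x1 N.
have [T1 T10 H] : exists2 T1 : R, 0 < T1 & forall i, (i < n.-1)%N -> forall T, T <= T1 ->
    forall u P Q, 0 < T -> T <= T0 -> solves T w u -> flats n t s u P Q -> ~ (P i <= x <= Q i).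
  apply: finite_min => i ni; have pqi := pq ni.
  have [h|h] := ltP x (p i).
    have [|T1 T10 H] := @cut_close (p i - x); first lra.
    exists T1 => // T TT u P Q T1' T2 S FU /andP[k1 k2].
    by have [k3 k4] := H i ni T TT u P Q T1' T2 S FU; lra.
  have h' : q i < x by rewrite ltNge; apply/negP => h'; apply: (N i ni); rewrite h.
  have [|T1 T10 H] := @cut_close (x - q i); first lra.
  exists T1 => // T TT u P Q T1' T2 S FU /andP[k1 k2].
  by have [k3 k4] := H i ni T TT u P Q T1' T2 S FU; lra.
exists T1 => // T TT u P Q T1' T2 S FU.
have K i : (i < n.-1)%N -> ~ (P i <= x <= Q i) by move=> ni; exact: (H i ni T TT u P Q T1' T2 S FU).
by split => //; apply: (cut_cover T1' T2 S FU).
Qed.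

Lemma cut_limit x (e : R) : 0 < x -> x < 1 -> x \notin flat_ends n p q -> 0 < e ->
  exists2 T1 : R, 0 < T1 & forall T, T <= T1 ->
  forall u P Q, 0 < T -> T <= T0 -> solves T w u -> flats n t s u P Q ->
  `|T^-1 * (u x - w x) - stair_slope s p q n.-1 x| <= e /\
  `|stair_slope s P Q n.-1 x - stair_slope s p q n.-1 x| <= e.
Proof.
move=> x0 x1 xE e0; have O := flats_ordered A F.
have [[i ni /andP[px xq]]|N] := pselect (exists2 i, (i < n.-1)%N & p i <= x <= q i).
  have [h1 h2] := notin_flat_ends xE ni.
  have px' : p i < x by rewrite lt_neqAle eq_sym h1.
  have xq' : x < q i by rewrite lt_neqAle h2.
  have [T1 T10 H] := cut_limit_in ni px' xq' e0; exists T1 => // T TT u P Q T1' T2 S FU.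
  have [k1 k2 k3 k4] := H T TT u P Q T1' T2 S FU.
  have [A' _ _ _] := small T1' T2 S.
  rewrite (stair_slope_in s O ni px' xq') (stair_slope_in s (flats_ordered A' FU) ni k1 k2) opprK.
  by split => //; rewrite addrC.
have N' i : (i < n.-1)%N -> ~ (p i <= x <= q i) by move=> ni h; apply: N; exists i.
have [T1 T10 H] := cut_limit_out (ltW x0) (ltW x1) N'; exists T1 => // T TT u P Q T1' T2 S FU.
have [k1 k2] := H T TT u P Q T1' T2 S FU.
rewrite k1 subrr mulr0.
rewrite (@stair_slope_out _ s p q n.-1)// ?(@stair_slope_out _ s P Q n.-1)//.
- by rewrite subrr normr0 ltW.
- by move=> i ni /andP[h1 h2]; apply: (k2 i ni); rewrite !ltW.
- by move=> i ni /andP[h1 h2]; apply: (N' i ni); rewrite !ltW.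
Qed.

Lemma stair_slope_bound B P Q x : ordered_itvs n.-1 P Q -> 0 <= B ->
  (forall i, (i < n.-1)%N -> [/\ P i <= p i & q i <= Q i]) ->
  (forall i, (i < n.-1)%N -> 2 / (q i - p i) <= B) -> `|stair_slope s P Q n.-1 x| <= B.
Proof.
move=> O B0 W HB; have [s1 _ _ _ _] := A.
have [[i ni /andP[px xq]]|N] := pselect (exists2 i, (i < n.-1)%N & P i < x < Q i); last first.
  rewrite (@stair_slope_out _ s P Q n.-1) ?normr0// => i ni h; apply: N; exists i => //.
rewrite (stair_slope_in s O ni px xq) normrN.
have [w1 w2] := W i ni; have pqi := pq ni.
have a1 : `|asign s i| = 1 by case: (asign1 i s1) => ->; rewrite ?normrN normr1.
have D0 : 0 < Q i - P i by lra.
have -> : 2 * asign s i / (Q i - P i) = asign s i * (2 / (Q i - P i)) by ring.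
rewrite normrM a1 mul1r gtr0_norm ?divr_gt0//.
apply: le_trans (HB i ni); rewrite ler_pM2l// lef_pV2 ?posrE//; lra.
Qed.

End asymptotics.

End small_parameter.

(** * Convergence in [L_q] as [lambda] tends to infinity, and the theorem *)

Section theorem.
Context {R : realType}.
Notation mu := (@lebesgue_measure R).
Notation O01 := (`]0, 1[%classic : set R).
Notation ucont := (ucont_on 0 1).
Implicit Types (f u v w : R -> R) (p q t z : nat -> R).

Lemma ucont_measurable f : ucont f -> measurable_fun O01 f.
Proof.
move=> cf; apply: (@measurable_eq_off _ O01 [::] f (f \o clamp 0 1)) => //.
  apply: measurable_funTS; apply: continuous_measurable_fun.
  exact: ucont_on_clamp ler01 cf.
by move=> x; rewrite /= in_itv/= => /andP[x0 x1] _; rewrite clamp_id// ltW.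
Qed.

(** For arbitrary [lambda] the solution may have fewer facets than [w]; they are still
    nondegenerate, which makes [sgn_bar] of the solution absolutely continuous. *)
Lemma solves_flats n t s T w u : 0 < T -> ucont w -> piecewise_smono n t s w -> solves T w u ->
  exists n' t' s' p q, [/\ zigzag n' t' s' u, flats n' t' s' u p q
    & forall i, (i < n'.-1)%N -> p i < q i].
Proof.
move=> T0 cw pw [cu [v S]].
have [n' [t' [s' A]]] := piecewise_zigzag (sol_piecewise_smono cw cu S pw).
have [p [q F]] := flats_ex cu A; exists n', t', s', p, q; split => // i ni.
have [s1 _ _ _ _] := A.
exact: (sol_facet_nondegenerate T0 cw cu S (asign1 i s1) (flats_facet A F (ltn_pred_S A ni))).
Qed.

Section large_lambda.
Variables (n : nat) (t : nat -> R) (s : R) (w : R -> R) (z p q : nat -> R) (T0 B : R).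
Hypotheses (cw : ucont w) (A : zigzag n t s w) (Z : mid_point n t s w z) (F : flats n t s w p q).
Hypothesis pq : forall i, (i < n.-1)%N -> p i < q i.
Hypothesis T00 : 0 < T0.
Hypothesis small : forall T u, 0 < T -> T <= T0 -> solves T w u -> cut_by n t s w z T u.
Hypotheses (B0 : 0 <= B) (HB : forall i, (i < n.-1)%N -> 2 / (q i - p i) <= B).

Lemma inv_small (T lambda : R) : 0 < T -> T^-1 < lambda -> 0 < lambda^-1 <= T.
Proof.
move=> T1 h; have l0 : 0 < lambda by apply: lt_trans h; rewrite invr_gt0.
by rewrite invr_gt0 l0 /= -[leRHS]invrK lef_pV2 ?posrE ?invr_gt0// ltW.
Qed.

Lemma small_flats T u : 0 < T -> T <= T0 -> solves T w u -> exists P Q,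
  [/\ flats n t s u P Q, forall i, (i < n.-1)%N -> P i < Q i
    & forall i, (i < n.-1)%N -> P i <= p i /\ q i <= Q i].
Proof.
move=> T1 T2 S; have [A' _ _ _] := small T1 T2 S; have [cu _] := S.
have [P [Q FU]] := flats_ex cu A'; exists P, Q.
have K i : (i < n.-1)%N -> P i <= p i /\ q i <= Q i.
  by move=> ni; have [c [[]]] := cut_peak cw A Z F small T1 T2 S FU ni.
split => // i ni; have [h1 h2] := K i ni; have := pq ni; lra.
Qed.

(** Both terms, the scaled difference of solution and datum and the derivative of the sign
    composition, tend boundedly to [stair_slope] for the facets of [w]. *)
Lemma cvg_Lq_defect (r : R) (u : R -> R -> R) : 1 <= r ->
  (forall lambda, 0 < lambda -> solves lambda^-1 w (u lambda)) ->
  cvg_Lq r (fun lambda x => lambda * (u lambda x - w x) - derive1 (sgn_bar (u lambda)) x) (fun=> 0).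
Proof.
move=> r1 Hu; have [s1 _ _ _ _] := A.
have l0 lambda : T0^-1 < lambda -> 0 < lambda by apply: lt_trans; rewrite invr_gt0.
have /choice[PQ HPQ] : forall lambda, exists PQ : (nat -> R) * (nat -> R), T0^-1 < lambda ->
    [/\ flats n t s (u lambda) PQ.1 PQ.2, forall i, (i < n.-1)%N -> PQ.1 i < PQ.2 i
    & forall i, (i < n.-1)%N -> PQ.1 i <= p i /\ q i <= PQ.2 i].
  move=> lambda; have [h|h] := ltP T0^-1 lambda; last by exists ((fun=> 0), (fun=> 0)).
  have /andP[T1 T2] := inv_small T00 h.
  by have [P [Q HPQ]] := small_flats T1 T2 (Hu _ (l0 _ h)); exists (P, Q).
apply: (@cvg_Lq_off R r (B + B) T0^-1 _ _
  (fun lambda x => lambda * (u lambda x - w x) - stair_slope s (PQ lambda).1 (PQ lambda).2 n.-1 x)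
  (fun=> 0) (flat_ends n p q)) => //.
- move=> lambda h; have /andP[T1 T2] := inv_small T00 h; have S := Hu _ (l0 _ h).
  have [FU pqU PQpq] := HPQ _ h; have [A' _ _ _] := small T1 T2 S; have [cu _] := S.
  split.
  + apply: measurable_funB; last exact: measurable_funTS (stair_slope_measurable _ _ _ _).
    by apply: measurable_funM => //; apply: measurable_funB; exact: ucont_measurable.
  + move=> x; rewrite /= in_itv/= => /andP[x0 x1].
    apply: (le_trans (ler_normB _ _)); apply: lerD.
      have := cut_bound cw A Z F pq small T1 T2 S FU B0 HB (ltW x0) (ltW x1).
      by rewrite invrK.
    apply: (stair_slope_bound A pq x (flats_ordered A' FU) B0 _ HB).
    by move=> i ni; have [] := PQpq i ni.
  + exists (flat_ends n (PQ lambda).1 (PQ lambda).2) => x; rewrite /= in_itv/= => /andP[x0 x1] xE.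
    by rewrite (derive1_sgn_bar cu A' FU pqU x0 x1 xE).
- by move=> x _; rewrite normr0 addr_ge0.
- move=> x; rewrite /= in_itv/= => /andP[x0 x1] xE e e0.
  have e20 : 0 < e / 2 by lra.
  have [T1 T10 H] := cut_limit cw A Z F pq small x0 x1 xE e20.
  exists T1^-1 => lambda h1 h2; have /andP[k1 k2] := inv_small T00 h1; have /andP[_ k3] := inv_small T10 h2.
  have [FU _ _] := HPQ _ h1.
  have [] := H _ k3 _ _ _ k1 k2 (Hu _ (l0 _ h1)) FU; rewrite invrK.
  set X := lambda * _; set Y := stair_slope _ _ _ _ _; set Y' := stair_slope _ _ _ _ _ => h3 h4.
  have -> : X - Y' - 0 = (X - Y) - (Y' - Y) by ring.
  by apply: (le_trans (ler_normB _ _)); lra.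
Qed.

Lemma cvg_Lq_yosida (r : R) (u v : R -> R -> R) : 1 <= r ->
  (forall lambda, 0 < lambda -> solves lambda^-1 w (u lambda)) ->
  (forall lambda, 0 < lambda -> solves (lambda^-1 + lambda^-1) w (v lambda)) ->
  cvg_Lq r (fun lambda x => lambda * (u lambda x - v lambda x)) (fun x => - derive1 (sgn_bar w) x).
Proof.
move=> r1 Hu Hv; have [s1 _ _ _ _] := A.
(* [v] solves at the parameter [2 / lambda], which must not exceed [T0] either. *)
pose T2 := T0 / 2; have T20 : 0 < T2 by rewrite divr_gt0.
have l0 lambda : T2^-1 < lambda -> 0 < lambda by apply: lt_trans; rewrite invr_gt0.
have sm lambda : T2^-1 < lambda ->
    [/\ 0 < lambda^-1, lambda^-1 <= T0, 0 < lambda^-1 + lambda^-1 & lambda^-1 + lambda^-1 <= T0].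
  by move=> h; have /andP[h1 h2] := inv_small T20 h; move: h2; rewrite /T2 => h2; split; lra.
have inv2 lambda : T2^-1 < lambda -> (lambda^-1 + lambda^-1)^-1 = lambda / 2.
  by move=> /l0 h; field; rewrite gt_eqF.
have split_ lambda x : lambda * (u lambda x - v lambda x) =
    lambda * (u lambda x - w x) - 2 * (lambda / 2 * (v lambda x - w x)) by field.
apply: (@cvg_Lq_off R r (B + 2 * B) T2^-1 _ _
  (fun lambda x => lambda * (u lambda x - v lambda x))
  (fun x => - stair_slope s p q n.-1 x) (flat_ends n p q)) => //.
- move=> lambda h; have [k1 k2 k3 k4] := sm _ h; have S := Hu _ (l0 _ h); have S' := Hv _ (l0 _ h).
  have [cu _] := S; have [cv _] := S'.
  have [P [Q [FU _ _]]] := small_flats k1 k2 S; have [P' [Q' [FU' _ _]]] := small_flats k3 k4 S'.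
  split.
  + by apply: measurable_funM => //; apply: measurable_funB; exact: ucont_measurable.
  + move=> x; rewrite /= in_itv/= => /andP[x0 x1].
    have h1 := cut_bound cw A Z F pq small k1 k2 S FU B0 HB (ltW x0) (ltW x1).
    have h2 := cut_bound cw A Z F pq small k3 k4 S' FU' B0 HB (ltW x0) (ltW x1).
    rewrite invrK in h1; rewrite inv2// in h2.
    rewrite split_; apply: (le_trans (ler_normB _ _)); apply: lerD => //.
    by rewrite normrM (ger0_norm (ler0n R 2)) ler_pM2l.
  + by exists [::].
- by apply: measurableT_comp => //; apply: measurable_funTS (stair_slope_measurable _ _ _ _).
- move=> x _; rewrite normrN.
  apply: (@le_trans _ _ B); last by rewrite lerDl mulr_ge0.
  by apply: (stair_slope_bound A pq x (flats_ordered A F) B0 _ HB) => i ni; split.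
- move=> x; rewrite /= in_itv/= => /andP[x0 x1] xE.
  by rewrite (derive1_sgn_bar cw A F pq x0 x1 xE).
- move=> x; rewrite /= in_itv/= => /andP[x0 x1] xE e e0.
  have e30 : 0 < e / 3 by lra.
  have [T1 T10 H] := cut_limit cw A Z F pq small x0 x1 xE e30.
  have T120 : 0 < T1 / 2 by lra.
  exists (T1 / 2)^-1 => lambda h1 h2; have [k1 k2 k3 k4] := sm _ h1.
  have /andP[_ k5] := inv_small T120 h2.
  have S := Hu _ (l0 _ h1); have S' := Hv _ (l0 _ h1).
  have [P [Q [FU _ _]]] := small_flats k1 k2 S; have [P' [Q' [FU' _ _]]] := small_flats k3 k4 S'.
  have [|H1 _] := H lambda^-1 _ _ _ _ k1 k2 S FU; first lra.
  have [|H2 _] := H (lambda^-1 + lambda^-1) _ _ _ _ k3 k4 S' FU'; first lra.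
  rewrite invrK in H1; rewrite inv2// in H2; rewrite split_.
  move: H1 H2; set X := lambda * _; set X' := lambda / 2 * _; set Y := stair_slope _ _ _ _ _ => H1 H2.
  have -> : X - 2 * X' - - Y = (X - Y) - 2 * (X' - Y) by ring.
  apply: (le_trans (ler_normB _ _)); rewrite normrM (ger0_norm (ler0n R 2)); lra.
Qed.

End large_lambda.

Lemma resolvent_solves (lambda ab ae : R) w u : 0 < lambda -> AF ab ae w -> mild_solution lambda w u ->
  solves (lambda^-1 + lambda^-1) w (resolvent lambda u).
Proof.
move=> l0 AFw mu_; have [AFu _] := mu_; have [acw _ _ _] := AFw.
have cw : ucont w by exact: abs_continuous_dist.
have [cu [p S]] := mild_sol l0 AFw mu_.
have [v [mv _ _]] := mild_exists l0 AFu.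
have mr : mild_solution lambda u (resolvent lambda u).
  exact: (@xgetPex _ u [set z | mild_solution lambda u z]) (ex_intro _ _ mv).
have [cr [q S']] := mild_sol l0 AFu mr.
by split => //; exists (fun x => p x + q x); exact: sol_comp S S'.
Qed.

End theorem.

Theorem theorem3p1 (R : realType) (ab ae : R) (w : R -> R) (hw : AF ab ae w) :
  exists u : R -> R -> R,
  [/\ (forall lambda, 0 < lambda ->
        [/\ mild_solution lambda w (u lambda),
            (forall v, mild_solution lambda w v ->
               {in `[0, 1], v =1 u lambda})
          & (BV_norm (derive1 (u lambda)) <= BV_norm (derive1 w))%E]),
      (exists2 lambda0 : R, 0 < lambda0 &
        forall lambda, lambda0 < lambda ->
          K_ess (u lambda) = K_ess w /\ (JR_norm (u lambda) <= JR_norm w)%E)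
    & (0 < L_ess w)%E ->
      (exists V : R -> R -> R,
        (forall lambda, 0 < lambda ->
           abs_continuous (sgn_bar (u lambda)) /\
           {ae (@lebesgue_measure R), forall x, x \in `]0, 1[ ->
             lambda * u lambda x - derive1 (sgn_bar (u lambda)) x
               = lambda * w x + V lambda x}) /\
        (forall q : R, 1 <= q -> cvg_Lq q V (fun=> 0))) /\
      (abs_continuous (sgn_bar w) /\
       forall q : R, 1 <= q ->
         cvg_Lq q (fun lambda => yosida lambda (u lambda))
           (fun x => - derive1 (sgn_bar w) x))].
Proof.
have [acw Jw _ _] := hw.
have cw : ucont_on 0 1 w by exact: abs_continuous_dist.
have [k [t' [s' pw]]] := J_regular_piecewise Jw.
have [n [t [s A]]] := piecewise_zigzag pw.
have [z Z] := mid_point_ex cw A.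
have [p [q F]] := flats_ex cw A.
have [T0 T00 small] := small_cut_sol cw A Z.
have /choice[u Hu] : forall lambda : R, exists u, 0 < lambda ->
    [/\ mild_solution lambda w u, solves lambda^-1 w u
    & (BV_norm (derive1 u) <= BV_norm (derive1 w))%E].
  move=> lambda; have [l0|_] := ltP 0 lambda; last by exists w.
  by have [u Hu] := mild_exists l0 hw; exists u.
exists u; split.
- move=> lambda l0; have [h1 _ h3] := Hu _ l0; split => // v mv x.
  by rewrite in_itv/= => /andP[x0 x1]; exact: (mild_unique l0 hw mv h1).
- exists T0^-1; first by rewrite invr_gt0.
  move=> lambda h; have /andP[T1 T2] := inv_small T00 h.
  have l0 : 0 < lambda by rewrite -invr_gt0.
  have [_ S bv] := Hu _ l0; have [A' _ _ _] := small _ _ T1 T2 S; have [cu _] := S.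
  have [P [Q F']] := flats_ex cu A'.
  (* Both functions alternate at the same breakpoints [t], so each has [n.-1] essential facets. *)
  have KE : K_ess (u lambda) = K_ess w by rewrite (K_ess_flats A' F') (K_ess_flats A F).
  by split => //; rewrite /JR_norm KE; exact: leeD2r.
- move=> L0; have pq := L_ess_flats A F L0.
  have [B B0 HB] := finite_max n.-1 (fun i => 2 / (q i - p i)).
  have Su lambda : 0 < lambda -> solves lambda^-1 w (u lambda).
    by move=> l0; have [] := Hu _ l0.
  split; last first.
    split; first exact: sgn_bar_abs_continuous cw A F pq.
    move=> r r1; apply: (cvg_Lq_yosida cw A Z F pq T00 small B0 HB r1 Su).
    by move=> lambda l0; have [h _ _] := Hu _ l0; exact: resolvent_solves hw h.
  (* With this [V] the restated equation is an identity; its content lies in the absolute continuity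
     of [sgn_bar] and in the convergence of [V] to 0. *)
  exists (fun lambda x => lambda * (u lambda x - w x) - derive1 (sgn_bar (u lambda)) x); split.
    move=> lambda l0; split.
      have li : 0 < lambda^-1 by rewrite invr_gt0.
      (* [lambda] need not be large here, so the breakpoints of the solution itself are used. *)
      have [n' [t'' [s'' [P [Q [A' F' PQ]]]]]] := solves_flats li cw pw (Su _ l0).
      by have [cu _] := Su _ l0; exact: sgn_bar_abs_continuous cu A' F' PQ.
    by apply: aeW => x _; ring.
  by move=> r r1; exact: (cvg_Lq_defect cw A Z F pq T00 small B0 HB r1 Su).
Qed.
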